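(* The curves $\widetilde{D_1}$, $\widetilde{D_2}$ and $\widetilde{D_3}$ are genus one curves defined over $\mathbb{Q}$, each birationally equivalent to an elliptic curve over $\mathbb{Q}$ with positive Mordell-Weil rank. In particular, there are infinitely many exotic quintuples.
   Context: $S$ is the affine surface over $\mathbb{Q}$ with coordinates $(r,t,y)$ defined by $$(1 + r - 2 r^2 t - t^2 + r t^2)(-1 + r + 2 r^2 t + t^2 + r t^2)(-r - r^2 - 2t - r t^2 + r^2 t^2)(r - r^2 - 2 t + r t^2 + r^2 t^2)=y^2,$$ and $\pi:S\rightarrow\mathbb{A}^2$ is the projection $\pi(r,t,y)=(r,t)$. Let $D_1,D_2,D_3$ be the plane genus zero curves in $\mathbb{A}^2$ defined by $$D_1:\ r^2t^2 - 4r^2t - 3r^2 - 2rt^2 - 2r - 3t^2 - 4t + 1 = 0,$$ $$D_2:\ r^2 t - r^2 + 2 r t^2 + 2 r - t - 1 =0,$$ $$D_3:\ r^2 t^2 + 3 r^2 - t^2 + 2t - 1 = 0,$$ and let $\widetilde{D_i}=\pi^{-1}(D_i)\subset S$ be their pullbacks to $S$ via $\pi$. (The genus means the genus of a smooth projective model.) A rational Diophantine $m$-tuple is a set of $m$ distinct nonzero rational numbers such that the product of any two distinct elements plus $1$ is a square in $\mathbb{Q}$. A Diophantine quadruple $\{a,b,c,d\}$ is called regular if $(a+b-c-d)^2=4(ab+1)(cd+1)$ (this condition is symmetric in $a,b,c,d$). A rational Diophantine quintuple $\{a,b,c,d,e\}$ (with its elements in this order) is called exotic if $abcd=1$, the quadruples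 $\{a,b,d,e\}$ and $\{a,c,d,e\}$ are regular, and the product of any two of its (distinct) elements is a square in $\mathbb{Q}$. *)

(* Defs.v *)
(* Varieties over Q are classical ones: point sets over algC
   (an algebraic closure of Q), and "over Q" means that the defining data have
   coefficients in Crat, the rational numbers inside algC. *)
From HB Require Import structures.
From mathcomp Require Import all_boot all_order all_algebra all_field.
From mathcomp Require Import boolp classical_sets cardinality.
From mathcomp Require Import mpoly.

Set Implicit Arguments.
Unset Strict Implicit.
Unset Printing Implicit Defensive.

Import Order.TTheory GRing.Theory Num.Theory.
Local Open Scope ring_scope.
Local Open Scope classical_set_scope.

Notation evalpt p v := (meval (fun_of_matrix v ord0) p).

Definition affine_defined_over_Q (n : nat) (X : set 'rV[algC]_n) : Prop :=
  exists2 fs : seq {mpoly algC[n]},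
    {in fs, forall f, f \is a mpolyOver n Crat} &
    X = [set v | {in fs, forall f, evalpt f v = 0}].

(* A point of P^n is represented by its nonzero coordinate vectors, a subset
   of P^n by the set of all the coordinate vectors of its points. *)

Definition same_point (n : nat) (v w : 'rV[algC]_n.+1) : Prop :=
  exists2 c : algC, c != 0 & w = c *: v.

Definition proj_zeros (n : nat) (T : set {mpoly algC[n.+1]}) :
    set 'rV[algC]_n.+1 :=
  [set v | v != 0 /\ forall p, T p -> evalpt p v = 0].

Definition proj_closed (A : {pred algC}) (n : nat) (X : set 'rV[algC]_n.+1) :
    Prop :=
  exists2 T : set {mpoly algC[n.+1]},
    forall p, T p -> (exists d, p \is d.-homog) /\ p \is a mpolyOver n.+1 A &
    X = proj_zeros T.

Definition geom_irreducible (n : nat) (X : set 'rV[algC]_n.+1) : Prop :=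
  X !=set0 /\
  forall Y Z, proj_closed predT Y -> proj_closed predT Z ->
    X `<=` Y `|` Z -> X `<=` Y \/ X `<=` Z.

Definition dense_open_over_Q (n : nat) (X U : set 'rV[algC]_n.+1) : Prop :=
  (exists2 Z, proj_closed Crat Z & U = X `\` Z) /\
  (forall W, proj_closed predT W -> U `<=` W -> X `<=` W).

(* A^n inside P^n, as the locus where the 0-th coordinate does not vanish. *)
Definition affine_in_proj (n : nat) (X : set 'rV[algC]_n) :
    set 'rV[algC]_n.+1 :=
  [set v | v ord0 ord0 != 0 /\
           X (\row_i (v ord0 (lift ord0 i) / v ord0 ord0))].

(* The coordinates of a rational map over Q from (a subset of) P^n to P^m. *)
Definition homog_tuple_over_Q (n m : nat)
    (phi : 'I_m.+1 -> {mpoly algC[n.+1]}) : Prop :=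
  exists d, forall i, phi i \is d.-homog /\ phi i \is a mpolyOver n.+1 Crat.

Definition apply_tuple (n m : nat) (phi : 'I_m.+1 -> {mpoly algC[n.+1]})
    (v : 'rV[algC]_n.+1) : 'rV[algC]_m.+1 :=
  \row_i evalpt (phi i) v.

(* X and Y have dense open subsets U and V that are isomorphic over Q.  Since
   the elements of V are nonzero vectors, V (apply_tuple phi x) includes the
   fact that the coordinates phi have no common zero at x. *)
Definition birational_over_Q (n m : nat)
    (X : set 'rV[algC]_n.+1) (Y : set 'rV[algC]_m.+1) : Prop :=
  exists (U : set 'rV[algC]_n.+1) (V : set 'rV[algC]_m.+1)
         (phi : 'I_m.+1 -> {mpoly algC[n.+1]})
         (psi : 'I_n.+1 -> {mpoly algC[m.+1]}),
    [/\ dense_open_over_Q X U /\ dense_open_over_Q Y V,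
        homog_tuple_over_Q phi,
        homog_tuple_over_Q psi,
        forall x, U x -> V (apply_tuple phi x) /\
                         same_point x (apply_tuple psi (apply_tuple phi x)) &
        forall y, V y -> U (apply_tuple psi y) /\
                         same_point y (apply_tuple phi (apply_tuple psi y))].

Definition jacobian (n : nat) (fs : seq {mpoly algC[n.+1]})
    (v : 'rV[algC]_n.+1) : 'M[algC]_(size fs, n.+1) :=
  \matrix_(i, j) evalpt ((fs`_i)^`M(j)) v.

(* h = dim (k[x_0..x_n] / I(X))_d with k = algC; I is the degree d part of
   the homogeneous ideal I(X). *)
Definition hilbert_function (n : nat) (X : set 'rV[algC]_n.+1) (d h : nat) :
    Prop :=
  exists2 I : {vspace dhomog n.+1 algC d},
    forall p : dhomog n.+1 algC d,
      p \in I <-> (forall v, X v -> evalpt (mpoly_of_dhomog p) v = 0) &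
    (\dim I + h = \dim {: dhomog n.+1 algC d})%N.

(* The Hilbert polynomial of X is deg * d + 1 - g, with deg > 0.  Thus X has
   dimension 1 and arithmetic genus g; the latter is the genus when X is a
   smooth irreducible projective curve. *)
Definition curve_with_arithmetic_genus (n : nat) (X : set 'rV[algC]_n.+1)
    (g : nat) : Prop :=
  exists deg N : nat, (0 < deg)%N /\
    forall d, (N <= d)%N ->
      exists2 h, hilbert_function X d h & (h + g = deg * d + 1)%N.

(* Jacobian criterion: rank n - 1 at each point of a curve in P^n. *)
Definition smooth_projective_curve_over_Q (n : nat) (X : set 'rV[algC]_n.+1)
    (g : nat) : Prop :=
  [/\ geom_irreducible X,
      curve_with_arithmetic_genus X g &
      exists fs : seq {mpoly algC[n.+1]},
        [/\ {in fs, forall f, (exists d, f \is d.-homog) /\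
                              f \is a mpolyOver n.+1 Crat},
            X = proj_zeros [set` fs] &
            forall v, X v -> (\rank (jacobian fs v)).+1 = n]].

(* The genus is that of a smooth projective model.  That C is geometrically
   irreducible and of dimension 1 follows from its being birational to the
   model. *)
Definition affine_curve_of_genus_over_Q (n : nat) (C : set 'rV[algC]_n)
    (g : nat) : Prop :=
  affine_defined_over_Q C /\
  exists (m : nat) (X : set 'rV[algC]_m.+1),
    smooth_projective_curve_over_Q X g /\
    birational_over_Q (affine_in_proj C) X.

Record weierstrass := Weierstrass { wa1 : rat; wa2 : rat; wa3 : rat;
                                    wa4 : rat; wa6 : rat }.

Section EllipticCurve.

Variable E : weierstrass.

Local Notation a1 := (wa1 E).
Local Notation a2 := (wa2 E).
Local Notation a3 := (wa3 E).
Local Notation a4 := (wa4 E).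
Local Notation a6 := (wa6 E).

Definition wdisc : rat :=
  let b2 := a1 ^+ 2 + 4 * a2 in
  let b4 := 2 * a4 + a1 * a3 in
  let b6 := a3 ^+ 2 + 4 * a6 in
  let b8 := a1 ^+ 2 * a6 + 4 * a2 * a6 - a1 * a3 * a4 + a2 * a3 ^+ 2
            - a4 ^+ 2 in
  - b2 ^+ 2 * b8 - 8 * b4 ^+ 3 - 27 * b6 ^+ 2 + 9 * b2 * b4 * b6.

Definition is_elliptic : Prop := wdisc != 0.

Definition wcurve : set 'rV[algC]_3 :=
  [set v : 'rV[algC]_3 | v != 0 /\
    let x := v ord0 0 in let y := v ord0 1 in let z := v ord0 2 in
    y ^+ 2 * z + ratr a1 * x * y * z + ratr a3 * y * z ^+ 2 =
    x ^+ 3 + ratr a2 * x ^+ 2 * z + ratr a4 * x * z ^+ 2 + ratr a6 * z ^+ 3].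

(* E(Q): None is the point at infinity [0 : 1 : 0], Some (x, y) is
   [x : y : 1]. *)
Definition on_wcurve (P : option (rat * rat)) : Prop :=
  if P is Some (x, y) then
    y ^+ 2 + a1 * x * y + a3 * y = x ^+ 3 + a2 * x ^+ 2 + a4 * x + a6
  else True.

Definition wopp (P : option (rat * rat)) : option (rat * rat) :=
  if P is Some (x, y) then Some (x, - y - a1 * x - a3) else None.

(* Chord and tangent law; meaningful for points that satisfy on_wcurve. *)
Definition wadd (P Q : option (rat * rat)) : option (rat * rat) :=
  match P, Q with
  | None, _ => Q
  | _, None => P
  | Some (x1, y1), Some (x2, y2) =>
    if (x1 == x2) && (y1 + y2 + a1 * x2 + a3 == 0) then None else
    let l := if x1 == x2
             then (3 * x1 ^+ 2 + 2 * a2 * x1 + a4 - a1 * y1)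
                    / (2 * y1 + a1 * x1 + a3)
             else (y2 - y1) / (x2 - x1) in
    let x3 := l ^+ 2 + a1 * l - a2 - x1 - x2 in
    Some (x3, - (l * (x3 - x1) + y1) - a1 * x3 - a3)
  end.

Definition wmulz (c : int) (P : option (rat * rat)) : option (rat * rat) :=
  match c with
  | Posz n => iter n (wadd P) None
  | Negz n => wopp (iter n.+1 (wadd P) None)
  end.

(* E(Q) contains r points that are linearly independent over Z. *)
Definition mordell_weil_rank_ge (r : nat) : Prop :=
  exists2 P : 'I_r -> option (rat * rat),
    forall i, on_wcurve (P i) &
    forall c : 'I_r -> int,
      \big[wadd/None]_(i < r) wmulz (c i) (P i) = None -> forall i, c i = 0.

End EllipticCurve.

Definition surface_S : set 'rV[algC]_3 :=
  [set v : 'rV[algC]_3 |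
    let r := v ord0 0 in let t := v ord0 1 in let y := v ord0 2 in
    (1 + r - 2 * r ^+ 2 * t - t ^+ 2 + r * t ^+ 2) *
    (- 1 + r + 2 * r ^+ 2 * t + t ^+ 2 + r * t ^+ 2) *
    (- r - r ^+ 2 - 2 * t - r * t ^+ 2 + r ^+ 2 * t ^+ 2) *
    (r - r ^+ 2 - 2 * t + r * t ^+ 2 + r ^+ 2 * t ^+ 2) = y ^+ 2].

Definition proj_rt (v : 'rV[algC]_3) : 'rV[algC]_2 :=
  \row_(i < 2) v ord0 (widen_ord (leqnSn 2) i).

Definition curve_D1 : set 'rV[algC]_2 :=
  [set v : 'rV[algC]_2 | let r := v ord0 0 in let t := v ord0 1 in
    r ^+ 2 * t ^+ 2 - 4 * r ^+ 2 * t - 3 * r ^+ 2 - 2 * r * t ^+ 2 - 2 * r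
    - 3 * t ^+ 2 - 4 * t + 1 = 0].

Definition curve_D2 : set 'rV[algC]_2 :=
  [set v : 'rV[algC]_2 | let r := v ord0 0 in let t := v ord0 1 in
    r ^+ 2 * t - r ^+ 2 + 2 * r * t ^+ 2 + 2 * r - t - 1 = 0].

Definition curve_D3 : set 'rV[algC]_2 :=
  [set v : 'rV[algC]_2 | let r := v ord0 0 in let t := v ord0 1 in
    r ^+ 2 * t ^+ 2 + 3 * r ^+ 2 - t ^+ 2 + 2 * t - 1 = 0].

Definition pullback_to_S (D : set 'rV[algC]_2) : set 'rV[algC]_3 :=
  surface_S `&` proj_rt @^-1` D.

Definition is_square (x : rat) : Prop := exists q : rat, x = q ^+ 2.

Definition rational_diophantine_tuple (s : seq rat) : Prop :=
  [/\ uniq s, 0 \notin s &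
      {in s &, forall x y, x != y -> is_square (x * y + 1)}].

Definition regular_quadruple (a b c d : rat) : Prop :=
  (a + b - c - d) ^+ 2 = 4 * (a * b + 1) * (c * d + 1).

Definition exotic_quintuple (a b c d e : rat) : Prop :=
  [/\ rational_diophantine_tuple [:: a; b; c; d; e],
      a * b * c * d = 1,
      regular_quadruple a b d e,
      regular_quadruple a c d e &
      {in [:: a; b; c; d; e] &, forall x y, x != y -> is_square (x * y)}].

(* The underlying sets, so that reorderings are not counted separately. *)
Definition exotic_quintuple_sets : set (set rat) :=
  [set X | exists a b c d e : rat,
     exotic_quintuple a b c d e /\ X = [set` [:: a; b; c; d; e]]].

(* Main.v *)
Require Import Defs.
From HB Require Import structures.
From mathcomp Require Import all_boot all_order all_algebra all_field.
From mathcomp Require Import boolp classical_sets cardinality.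
From mathcomp Require Import mpoly.
From mathcomp Require Import ring zify.

(** Each D_i is a rational curve.  It is quadratic in r, its discriminant is a
    square times a monic quadratic polynomial in t, and the lines s = t + m
    parametrize the conic on which s^2 equals this polynomial
    (parametrization_D1, parametrization_D2, parametrization_D3).  Along the
    parametrization, the product of the four factors that defines S becomes
    (K1 / K0)^2 Q, with Q a quartic polynomial in the parameter that takes the
    square value w0^2 at 0.  Hence the pullback of D_i is birational over the
    rational numbers to w^2 = Q(u) (pullback_birational), and so to the jacobian
    y^2 = f(x), where f is a cubic polynomial with three rational roots
    (quartic_birational).

    The projective Weierstrass cubic is itself the smooth model.  On
    w^2 = f(u), a form is a(u) + b(u) w, and a^2 - b^2 f is not zero since f has
    odd degree; this gives the irreducibility.  The forms of degree d that
    vanish on the curve are the multiples of its equation (form_vanishing), so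
    that the Hilbert function is 3d and the genus is one; a singular point would
    be a double root of f.

    Birational maps are handled in affine charts, as inverse bijections given by
    regular functions between the complements of finite sets.  A form that is
    zero at almost all points of one of these curves is zero on it, so that such
    complements are dense and the maps can be homogenized
    (birational_of_affine).

    The rank is positive by 2-descent.  For a root e of f, the class of x - e
    modulo squares is 1 or x(P) - e for every multiple of P.  The points of
    order 2 have other classes, and P is not a double, x(P) - ea being no square
    for some root ea.  If nP = O, then (n / 2)P = O when n is even, and P is the
    double of a multiple of itself when n is odd: this descent is impossible
    (infinite_order).  The associative law enters only as the cancellation
    - P + (P + Q) = Q (wadd_cancel).

    Finally, for rational x, y and z put a = xyz, b = x / (yz), c = y / (xz),
    d = z / (xy).  Then abcd = 1 and the products of two of them are the squares
    of x, y, z and of their inverses; these products plus 1 are squares if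
    x^2 + 1, y^2 + 1 and z^2 + 1 are.  For suitable functions x, y, z on D3,
    both triples a, b, d and a, c, d extend to regular quadruples by the same
    number e, and ae is a square exactly at the points of the double cover
    (exotic_on_D3).  The multiples of a point of infinite order provide
    infinitely many of these points (infinite_quartic_points), and a quintuple
    is obtained from finitely many parameters only. *)

Set Implicit Arguments.
Unset Strict Implicit.
Unset Printing Implicit Defensive.

Import Order.TTheory GRing.Theory Num.Theory.

(** * Chords and tangents on a short Weierstrass cubic *)

Section ChordTangent.
Local Open Scope ring_scope.

Variables (a2 a4 a6 : rat).
Local Notation E := (Weierstrass 0%R a2 0%R a4 a6).
Local Notation f x := (x ^+ 3 + a2 * x ^+ 2 + a4 * x + a6).

Lemma on_wcurve_short x y : on_wcurve E (Some (x, y)) <-> y ^+ 2 = f x.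
Proof.
rewrite /= (_ : y ^+ 2 + 0 * x * y + 0 * y = y ^+ 2) //; ring.
Qed.

Lemma wopp_short x y : wopp E (Some (x, y)) = Some (x, - y).
Proof. by rewrite /=; congr (Some (_, _)); ring. Qed.

Definition chord (x1 y1 l x2 : rat) :=
  let x3 := l ^+ 2 - a2 - x1 - x2 in Some (x3, - (l * (x3 - x1) + y1)).

Lemma wadd_opp x y : wadd E (Some (x, y)) (Some (x, - y)) = None.
Proof.
rewrite /= eqxx (_ : y - y + 0 * x + 0 = 0) ?eqxx //; ring.
Qed.

Lemma wadd_dbl x y : y != 0 -> wadd E (Some (x, y)) (Some (x, y)) =
  chord x y ((3 * x ^+ 2 + 2 * a2 * x + a4) / (2 * y)) x.
Proof.
move=> y0; rewrite /= eqxx (_ : y + y + 0 * x + 0 = 2 * y); last by ring.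
rewrite mulf_eq0 (negPf y0) /= (_ : 2 * y + 0 * x + 0 = 2 * y); last by ring.
rewrite /chord (_ : _ - 0 * y = 3 * x ^+ 2 + 2 * a2 * x + a4); last by ring.
by congr (Some (_, _)); ring.
Qed.

Lemma wadd_chord x1 y1 x2 y2 : x1 != x2 ->
  wadd E (Some (x1, y1)) (Some (x2, y2)) = chord x1 y1 ((y2 - y1) / (x2 - x1)) x2.
Proof.
by move=> n; rewrite /= (negPf n) /= /chord; congr (Some (_, _)); ring.
Qed.

(** On the curve, equal abscissas leave only y2 = - y1 and y2 = y1, and in the
    second case the tangent is not vertical. *)
Variant wadd_spec x1 y1 x2 y2 : option (rat * rat) -> Type :=
| WaddOpp of x2 = x1 & y2 = - y1 : wadd_spec x1 y1 x2 y2 None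
| WaddDbl of x2 = x1 & y2 = y1 & y1 != 0 : wadd_spec x1 y1 x2 y2
    (chord x1 y1 ((3 * x1 ^+ 2 + 2 * a2 * x1 + a4) / (2 * y1)) x1)
| WaddChord of x1 != x2 :
    wadd_spec x1 y1 x2 y2 (chord x1 y1 ((y2 - y1) / (x2 - x1)) x2).

Lemma waddP x1 y1 x2 y2 :
  y1 ^+ 2 = f x1 -> y2 ^+ 2 = f x2 ->
  wadd_spec x1 y1 x2 y2 (wadd E (Some (x1, y1)) (Some (x2, y2))).
Proof.
move=> h1 h2; have [e|n] := eqVneq x1 x2; last first.
  by rewrite wadd_chord //; apply: WaddChord.
rewrite -e in h2 *.
have [e2|n2] := eqVneq y2 (- y1).
  by rewrite e2 wadd_opp; apply: WaddOpp.
have e1 : y2 = y1.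
  have : y2 ^+ 2 == y1 ^+ 2 by rewrite h1 h2.
  by rewrite eqf_sqr (negPf n2) orbF => /eqP.
rewrite e1 in n2 *.
have y0 : y1 != 0.
  by apply: contraNneq n2 => ->; rewrite oppr0.
by rewrite wadd_dbl //; apply: WaddDbl.
Qed.

Lemma wadd_on P Q : on_wcurve E P -> on_wcurve E Q -> on_wcurve E (wadd E P Q).
Proof.
case: P => [[x1 y1]|//]; case: Q => [[x2 y2]|//].
move=> /on_wcurve_short h1 /on_wcurve_short h2.
(* a6 and a4 are recovered from the points, which turns the claim into an
   identity of rational functions *)
have a6E : a6 = y1 ^+ 2 - x1 ^+ 3 - a2 * x1 ^+ 2 - a4 * x1 by rewrite h1; ring.
case: (waddP h1 h2) => // [_ _ y0|n]; apply/on_wcurve_short.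
  by rewrite a6E; field; rewrite y0.
have n' : x2 - x1 != 0 by rewrite subr_eq0 eq_sym.
have a4E : a4 = (y2 ^+ 2 - y1 ^+ 2 - (x2 ^+ 3 - x1 ^+ 3)
                  - a2 * (x2 ^+ 2 - x1 ^+ 2)) / (x2 - x1).
  by rewrite h1 h2; field.
by rewrite a6E a4E; field.
Qed.

Lemma wopp_add P Q : wopp E (wadd E P Q) = wadd E (wopp E P) (wopp E Q).
Proof.
case: P => [[x1 y1]|//]; case: Q => [[x2 y2]|//].
rewrite !wopp_short; have [<-|n] := eqVneq x1 x2; last first.
  by rewrite !wadd_chord // /chord wopp_short; congr (Some (_, _));
     have n' : x2 - x1 != 0 by [rewrite subr_eq0 eq_sym]; field.
have [e|ne] := eqVneq (y1 + y2) 0.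
  have -> : y2 = - y1 by rewrite (addr0_eq e).
  by rewrite !wadd_opp.
rewrite /wadd /= eqxx (_ : y1 + y2 + 0 * x1 + 0 = y1 + y2); last by ring.
rewrite (_ : - y1 - y2 + 0 * x1 + 0 = - (y1 + y2)); last by ring.
rewrite oppr_eq0 (negPf ne) /=.
have -> : 2 * - y1 + 0 * x1 + 0 = - (2 * y1 + 0 * x1 + 0) by ring.
by congr (Some (_, _)); rewrite invrN; ring.
Qed.

Lemma wadd_comm P Q : on_wcurve E P -> on_wcurve E Q ->
  wadd E P Q = wadd E Q P.
Proof.
case: P => [[x1 y1]|]; case: Q => [[x2 y2]|] //.
move=> /on_wcurve_short h1 /on_wcurve_short h2.
case: (waddP h1 h2) => [-> ->|-> -> y0|n].
- by rewrite -{2}[y1]opprK wadd_opp.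
- by rewrite wadd_dbl.
have n2 : x2 - x1 != 0 by rewrite subr_eq0 eq_sym.
have n3 : x1 - x2 != 0 by rewrite subr_eq0.
rewrite wadd_chord 1?eq_sym // /chord.
by congr (Some (_, _)); field; rewrite ?n2 ?n3.
Qed.

(** The instance of associativity that makes the multiples of P subtract.  If
    P + Q has the abscissa of P, then the chord through P and Q is the tangent
    at P; this tangent is not vertical because y1 <> 0. *)
Lemma wadd_cancel x1 y1 Q : y1 != 0 -> y1 ^+ 2 = f x1 -> on_wcurve E Q ->
  wadd E (Some (x1, - y1)) (wadd E (Some (x1, y1)) Q) = Q.
Proof.
move=> y0 h1; case: Q => [[x2 y2]|_]; last first.
  by rewrite [wadd _ _ None]/= -{2}[y1]opprK wadd_opp.
move=> /on_wcurve_short h2.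
have y0' : - y1 != 0 by rewrite oppr_eq0.
case: (waddP h1 h2) => [-> -> //|-> -> _|n].
  set l := _ / (2 * y1); rewrite /chord.
  set x3 := _ - x1 - x1.
  have lE : 2 * y1 * l = 3 * x1 ^+ 2 + 2 * a2 * x1 + a4.
    by rewrite /l; field; rewrite y0.
  have [e|n3] := eqVneq x1 x3.
    rewrite -e subrr mulr0 add0r wadd_dbl // /chord.
    rewrite (_ : _ / (2 * - y1) = - l); last first.
      by rewrite -lE; field; rewrite y0.
    by rewrite sqrrN -/x3 -e; congr (Some (_, _)); ring.
  have n3' : x3 - x1 != 0 by rewrite subr_eq0 eq_sym.
  rewrite wadd_chord // /chord.
  rewrite (_ : (_ - - y1) / _ = - l); last by field.
  by congr (Some (_, _)); rewrite /x3; ring.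
set l := (y2 - y1) / (x2 - x1).
have n' : x2 - x1 != 0 by rewrite subr_eq0 eq_sym.
have lE : y2 = y1 + l * (x2 - x1) by rewrite /l; field.
rewrite /chord; set x3 := _ - x1 - x2.
have [e|n3] := eqVneq x1 x3.
  (* the chord is the tangent at P *)
  have E2 : l ^+ 2 = a2 + 2 * x1 + x2.
    have -> : 2 * x1 = x1 + x3 by rewrite -e; ring.
    by rewrite /x3; ring.
  have tE : (3 * x1 ^+ 2 + 2 * a2 * x1 + a4) / (2 * y1) = l.
    have E1 : l * (y2 + y1) = x2 ^+ 2 + x2 * x1 + x1 ^+ 2 + a2 * (x1 + x2) + a4.
      apply: (mulIf n'); transitivity (y2 ^+ 2 - y1 ^+ 2).
        by rewrite {1}lE; rewrite [in RHS]lE; ring.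
      by rewrite h1 h2; ring.
    have E3 : 2 * l * y1 = 3 * x1 ^+ 2 + 2 * a2 * x1 + a4.
      transitivity (l * (y2 + y1) - l ^+ 2 * (x2 - x1)).
        by rewrite lE; ring.
      by rewrite E1 E2; ring.
    by rewrite -E3; field; rewrite y0.
  rewrite -e subrr mulr0 add0r wadd_dbl // /chord.
  rewrite (_ : _ / (2 * - y1) = - l); last first.
    by rewrite -tE; field; rewrite y0.
  by rewrite sqrrN E2 lE; congr (Some (_, _)); ring.
have n3' : x3 - x1 != 0 by rewrite subr_eq0 eq_sym.
rewrite wadd_chord // /chord.
rewrite (_ : (_ - - y1) / _ = - l); last by field.
by congr (Some (_, _)); rewrite ?lE /x3; ring.
Qed.

End ChordTangent.
(** * Points of infinite order *)

(** Polynomial identities modulo an equation are proved by giving the cofactor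
    k of the equation; [ring] or [field] does the rest. *)
Lemma eq_of_multiple (R : pzRingType) (k x y a b : R) :
  (x = y -> a - b = k * (x - y) -> a = b)%R.
Proof. by move=> ->; rewrite subrr mulr0 => /subr0_eq. Qed.

Section Orbit.
Local Open Scope ring_scope.
Variables (a2 a4 a6 : rat).
Local Notation E := (Weierstrass 0%R a2 0%R a4 a6).
Local Notation f x := (x ^+ 3 + a2 * x ^+ 2 + a4 * x + a6).
Local Notation chord := (chord a2).

(** The line through P and Q, of slope l, as an identity of polynomials in x:
    both the norm relation and the product formula at a root follow from it by
    evaluation. *)
Lemma wadd_line x1 y1 x2 y2 x3 y3 :
  y1 ^+ 2 = f x1 -> y2 ^+ 2 = f x2 ->
  wadd E (Some (x1, y1)) (Some (x2, y2)) = Some (x3, y3) ->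
  exists l, forall x,
    f x - (l * (x - x1) + y1) ^+ 2 = (x - x1) * (x - x2) * (x - x3).
Proof.
move=> h1 h2.
have a6E : a6 = y1 ^+ 2 - x1 ^+ 3 - a2 * x1 ^+ 2 - a4 * x1 by rewrite h1; ring.
case: (waddP h1 h2) => // [-> _ y0|n]; set l := _ / _ => -[<- _]; exists l => x.
  have a4E : a4 = 2 * y1 * l - 3 * x1 ^+ 2 - 2 * a2 * x1.
    by rewrite /l; field; rewrite y0.
  by rewrite a6E a4E; ring.
have n' : x2 - x1 != 0 by rewrite subr_eq0 eq_sym.
have lE : y2 = y1 + l * (x2 - x1) by rewrite /l; field.
have a4E : a4 = 2 * y1 * l - (x2 ^+ 2 + x1 * x2 + x1 ^+ 2) - a2 * (x1 + x2)
                + l ^+ 2 * (x2 - x1).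
  apply: (mulIf n'); apply: (eq_of_multiple (k := -1) h2).
  by rewrite a6E lE; ring.
by rewrite a6E a4E; ring.
Qed.

Variables e e' e'' : rat.
Hypothesis fE : forall x, f x = (x - e) * (x - e') * (x - e'').

(** If the third point is the 2-torsion point (e, 0), then f(x) / (x - e) and
    (x - x1) (x - x2) differ by l^2 (x - e), so they agree at e.  Both are
    monic quadratics: the values at e + 1 and e - 1 determine those at e. *)
Lemma line_through_root l x1 y1 x2 :
  (forall x, f x - (l * (x - x1) + y1) ^+ 2 = (x - x1) * (x - x2) * (x - e)) ->
  (x1 - e) * (x2 - e) = (e - e') * (e - e'').
Proof.
move=> H.
have y1E : y1 = l * (x1 - e).
  have := H e; rewrite fE subrr !mul0r mulr0 sub0r => /eqP.
  by rewrite oppr_eq0 sqrf_eq0 => /eqP h; apply: (eq_of_multiple (k := 1) h); ring.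
have h1 := H (e + 1); have h2 := H (e - 1); rewrite !fE y1E in h1 h2.
pose c := (x1 - e) * (x2 - e) - (e - e') * (e - e'').
suff : 2 * c = 0 by move/eqP; rewrite mulf_eq0 => /eqP/subr0_eq.
by apply: (eq_of_multiple (k := -1) (congr2 (fun u v => u - v) h1 h2)); rewrite /c; ring.
Qed.

Variables (xP yP : rat).
Hypotheses (onP : yP ^+ 2 = f xP) (yP0 : yP != 0).

Lemma root_neq x y : y != 0 -> y ^+ 2 = f x -> x - e != 0.
Proof.
move=> y0 h; apply: contra_neq y0 => x0.
by apply/eqP; rewrite -sqrf_eq0 h fE x0 !mul0r.
Qed.

(** P + P = (xP, yP) with tangent of slope l gives
    (x - e)^2 (xP - e) = (l (e - x) + y)^2. *)
Lemma double_square x y : y ^+ 2 = f x ->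
  wadd E (Some (x, y)) (Some (x, y)) = Some (xP, yP) ->
  exists s, xP - e = s ^+ 2.
Proof.
move=> h H.
have y0 : y != 0.
  apply: contra_eq_neq H => ->; rewrite -{2}oppr0.
  by rewrite wadd_opp.
have [l /(_ e) L] := wadd_line h h H.
have x0 := root_neq y0 h.
exists ((l * (e - x) + y) / (x - e)).
apply: (mulIf (expf_neq0 2 x0)); rewrite -exprMn divfK //.
by apply: (eq_of_multiple (k := 1) L); rewrite fE; ring.
Qed.

Local Notation c := (xP - e).
Local Notation d := ((e - e') * (e - e'')).

Definition in_classes x := exists2 s : rat, s != 0 & x = s ^+ 2 \/ x = c * s ^+ 2.

Hypothesis dnsq : forall s : rat, s ^+ 2 <> d /\ s ^+ 2 <> c * d.

Let c0 : c != 0. Proof. exact: root_neq yP0 onP. Qed.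

(** Up to squares, x - e is the 2-descent homomorphism from E(Q) to the
    nonzero rationals modulo squares that belongs to (e, 0).  It sends P to c
    and (e, 0) itself to d, so that the multiples of P stay in the classes of
    1 and c, and do not meet (e, 0). *)
Lemma class_wadd x y x3 y3 : y ^+ 2 = f x -> in_classes (x - e) ->
  wadd E (Some (xP, yP)) (Some (x, y)) = Some (x3, y3) -> in_classes (x3 - e).
Proof.
move=> h [s s0 xs] H; have [l L] := wadd_line onP h H.
have [x3e|x3e] := eqVneq x3 e.
  have D := line_through_root (l := l) (y1 := yP) (x1 := xP) (x2 := x).
  rewrite x3e in L; have {D L} D := D L.
  case: xs => xs; rewrite xs in D.
    by case: (dnsq (c * s)) => _ []; rewrite -D; ring.
  by case: (dnsq (c * s)) => [] []; rewrite -D; ring.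
have x3e' : x3 - e != 0 by rewrite subr_eq0.
pose k := l * (e - xP) + yP.
have {}L : c * (x - e) * (x3 - e) = k ^+ 2.
  by apply: (eq_of_multiple (k := 1) (L e)); rewrite fE /k; ring.
have k0 : k != 0.
  rewrite -sqrf_eq0 -L !mulf_neq0 //.
  by case: xs => ->; rewrite ?mulf_neq0 ?sqrf_eq0 // expf_neq0.
case: xs => xs; rewrite xs in L.
  exists (k / (c * s)); first by rewrite !mulf_neq0 ?invr_eq0 ?mulf_neq0.
  by right; rewrite exprMn -L; field; rewrite c0 s0.
exists (k / (c * s)); first by rewrite !mulf_neq0 ?invr_eq0 ?mulf_neq0.
by left; rewrite exprMn -L; field; rewrite c0 s0.
Qed.

Definition multiple n := iter n (wadd E (Some (xP, yP))) None.

Lemma multipleS n : multiple n.+1 = wadd E (Some (xP, yP)) (multiple n).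
Proof. by []. Qed.

Lemma multiple_on n : on_wcurve E (multiple n).
Proof.
by elim: n => // n IH; rewrite multipleS; apply: wadd_on => //; apply/on_wcurve_short.
Qed.

Lemma multiple_class n x y : multiple n = Some (x, y) -> in_classes (x - e).
Proof.
elim: n x y => // n IH x y; rewrite multipleS.
case q: (multiple n) => [[x1 y1]|]; last first.
  by case=> <- _; exists 1; rewrite ?oner_eq0 //; right; rewrite expr1n mulr1.
have := multiple_on n; rewrite q => /on_wcurve_short h.
exact: class_wadd (IH _ _ q).
Qed.

Hypothesis torsion_class : forall s : rat,
  [/\ s ^+ 2 <> e' - e, s ^+ 2 <> e'' - e,
      s ^+ 2 <> c * (e' - e) & s ^+ 2 <> c * (e'' - e)].

Lemma multiple_not_two_torsion n x y : multiple n = Some (x, y) -> y != 0.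
Proof.
move=> q; have [s s0 xs] := multiple_class q.
have := multiple_on n; rewrite q => /on_wcurve_short; rewrite fE => h.
apply: contra_neq s0 => y0; move: h; rewrite y0 expr0n /= => /esym/eqP.
rewrite !mulf_eq0 -orbA => /or3P[/eqP x0|/eqP/subr0_eq x0|/eqP/subr0_eq x0].
- case: xs => xs; move: x0; rewrite xs => /eqP; rewrite ?mulf_eq0 ?(negPf c0) /=.
    by rewrite orbb => /eqP.
  by rewrite orbb => /eqP.
- have [] := torsion_class s; have [] := torsion_class (c * s).
  move: xs; rewrite x0 => -[] E1 _ _ A B C _ D F; first by case: C.
  by case: A; rewrite E1; ring.
- have [] := torsion_class s; have [] := torsion_class (c * s).
  move: xs; rewrite x0 => -[] E1 _ _ A B C D _ F; first by case: D.
  by case: B; rewrite E1; ring.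
Qed.

(** Descending induction from NP = O = - 0P. *)
Lemma multiple_opp N i : multiple N = None -> (i <= N)%N ->
  multiple (N - i) = wopp E (multiple i).
Proof.
move=> qN; elim: i => [|i IH] iN; first by rewrite subn0 qN.
have E1 : multiple (N - i) = wadd E (Some (xP, yP)) (multiple (N - i.+1)).
  by rewrite -(subnSK iN).
rewrite -[LHS](wadd_cancel yP0 onP (multiple_on _)) -E1 IH ?(ltnW iN) //.
by rewrite multipleS wopp_add wopp_short.
Qed.

(** If NP = O with N = 2k, then kP = - kP, so that kP = O, as kP is not a
    2-torsion point; this halves N.  If N = 2j + 1, then (j + 1)P = - jP, so
    that P is the double of - jP. *)
Lemma multiple_eq_None n : (0 < n)%N -> multiple n = None ->
  exists x y, y ^+ 2 = f x /\
    wadd E (Some (x, y)) (Some (x, y)) = Some (xP, yP).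
Proof.
have [k] := ubnP n; elim: k n => // k IH n nk n0 qn.
have := odd_double_half n; case: (odd n) => /= nE; last first.
  rewrite add0n in nE; have h0 : (0 < n./2)%N by rewrite -double_gt0 nE.
  apply: (IH n./2) => //; first by rewrite -nE -addnn in nk; lia.
  have hn : (n./2 <= n)%N by rewrite -{2}nE -addnn leq_addr.
  have := multiple_opp qn hn; rewrite -{1}nE -addnn addnK.
  case q: (multiple n./2) => [[x y]|] //; rewrite wopp_short => -[] /eqP.
  rewrite -subr_eq0 opprK -mulr2n mulrn_eq0 /= => /eqP y0.
  by move: (multiple_not_two_torsion q); rewrite y0 eqxx.
have hn : (n./2 <= n)%N by rewrite -{2}nE; lia.
have := multiple_opp qn hn.
have -> : (n - n./2 = n./2.+1)%N by rewrite -{1}nE; lia.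
rewrite multipleS; case q: (multiple n./2) => [[x y]|] //; rewrite wopp_short => H.
have := multiple_on n./2; rewrite q => /on_wcurve_short h.
have y0 := multiple_not_two_torsion q.
have h' : on_wcurve E (Some (x, - y)) by apply/on_wcurve_short; rewrite sqrrN.
have D : wadd E (Some (x, - y)) (Some (x, - y)) = Some (xP, yP).
  have onP' : on_wcurve E (Some (xP, yP)) by apply/on_wcurve_short.
  have onR : on_wcurve E (Some (x, y)) by apply/on_wcurve_short.
  by rewrite -{2}H (wadd_comm onP' onR) wadd_cancel.
by exists x, (- y); split=> //; rewrite sqrrN.
Qed.
End Orbit.

(** A criterion of 2-descent.  The conditions on e keep the three points of
    order 2 out of the multiples of P, whose classes are those of 1 and xP - e;
    the condition on ea says that P is not a double. *)
Lemma infinite_order (a2 a4 a6 e e' e'' ea xP yP : rat) :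
  (forall x, x ^+ 3 + a2 * x ^+ 2 + a4 * x + a6
             = (x - e) * (x - e') * (x - e''))%R ->
  (exists ea' ea'', forall x, x ^+ 3 + a2 * x ^+ 2 + a4 * x + a6
             = (x - ea) * (x - ea') * (x - ea''))%R ->
  (yP ^+ 2 = xP ^+ 3 + a2 * xP ^+ 2 + a4 * xP + a6)%R -> (yP != 0)%R ->
  (forall s : rat, s ^+ 2 <> xP - ea)%R ->
  (forall s : rat, [/\ s ^+ 2 <> (e - e') * (e - e''), s ^+ 2 <> e' - e &
                     s ^+ 2 <> e'' - e])%R ->
  (forall s : rat, [/\ s ^+ 2 <> (xP - e) * ((e - e') * (e - e'')),
     s ^+ 2 <> (xP - e) * (e' - e) & s ^+ 2 <> (xP - e) * (e'' - e)])%R ->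
  forall n, (0 < n)%N -> multiple a2 a4 a6 xP yP n <> None.
Proof.
move=> fE [ea' [ea'' fEa]] onP yP0 nsa n1 n2 n n0 qn.
have [||x [y [h D]]] := multiple_eq_None fE onP yP0 _ _ n0 qn.
- by move=> s; case: (n1 s) (n2 s) => ? ? ? [].
- by move=> s; case: (n1 s) (n2 s) => ? ? ? [].
by have [s hs] := double_square fEa h D; apply: (nsa s).
Qed.

Section RankOne.
Local Open Scope ring_scope.
Variables (a2 a4 a6 xP yP : rat).
Local Notation E := (Weierstrass 0%R a2 0%R a4 a6).
Local Notation multiple := (multiple a2 a4 a6 xP yP).
Hypothesis onP : yP ^+ 2 = xP ^+ 3 + a2 * xP ^+ 2 + a4 * xP + a6.
Hypothesis yP0 : yP != 0.
Hypothesis P_inf : forall n, (0 < n)%N -> multiple n <> None.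

Lemma rank_ge1 : mordell_weil_rank_ge E 1.
Proof.
exists (fun=> Some (xP, yP)) => [_|c]; first exact/on_wcurve_short.
have wadd0 P : wadd E P None = P by case: P => [[]|].
rewrite big_ord_recl big_ord0 wadd0 => c0 i; rewrite ord1.
case: (c ord0) c0 => [[|n]|n] //; first by move=> q; case: (P_inf (ltn0Sn n) q).
rewrite /wmulz -/(multiple n.+1); case q: (multiple n.+1) => [[x y]|] // _.
by case: (P_inf (ltn0Sn n) q).
Qed.

Lemma multiple_inj : injective multiple.
Proof.
have key m n : (m < n)%N -> multiple m <> multiple n.
  elim: m n => [|m IH] [|n] // mn; first by move/esym; apply: P_inf.
  rewrite !multipleS => /(congr1 (wadd E (Some (xP, - yP)))).
  by rewrite !wadd_cancel //; try exact: multiple_on; exact: IH.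
move=> m n; case: (ltngtP m n) => // mn => [|/esym] /key; exact.
Qed.
End RankOne.
(** * Polynomial functions and affine charts *)

Section PolynomialFunctions.
Local Open Scope ring_scope.
Local Open Scope classical_set_scope.

(** Polynomial functions with coefficients in S, as an inductive predicate:
    this makes composition, homogenization and membership provable by
    following the shape of a formula, with no polynomial in sight. *)
Inductive polyfun (S : {pred algC}) n : ('rV[algC]_n -> algC) -> Prop :=
| PolyC c of c \in S : polyfun S (fun=> c)
| PolyX i : polyfun S (fun v => v ord0 i)
| PolyD f g of polyfun S f & polyfun S g : polyfun S (fun v => f v + g v)
| PolyN f of polyfun S f : polyfun S (fun v => - f v)
| PolyM f g of polyfun S f & polyfun S g : polyfun S (fun v => f v * g v).

Section Closure.
Variables (S : {pred algC}) (n : nat).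
Implicit Types f g : 'rV[algC]_n -> algC.

Lemma eq_polyfun f g : polyfun S f -> f =1 g -> polyfun S g.
Proof. by move=> h /funext <-. Qed.

Lemma polyfunXn f k : 1 \in S -> polyfun S f -> polyfun S (fun v => f v ^+ k).
Proof.
move=> S1 hf; elim: k => [|k IH]; first exact: PolyC.
by apply: eq_polyfun (PolyM hf IH) _ => v; rewrite exprS.
Qed.

Lemma polyfun_sum (I : Type) (r : seq I) (F : I -> 'rV[algC]_n -> algC) :
  0 \in S -> (forall i, polyfun S (F i)) -> polyfun S (fun v => \sum_(i <- r) F i v).
Proof.
move=> S0 hF; elim: r => [|i r IH].
  by apply: eq_polyfun (PolyC _ S0) _ => v; rewrite big_nil.
by apply: eq_polyfun (PolyD (hF i) IH) _ => v; rewrite big_cons.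
Qed.

Lemma polyfun_prod (I : Type) (r : seq I) (P : pred I) (F : I -> 'rV[algC]_n -> algC) :
  1 \in S -> (forall i, polyfun S (F i)) ->
  polyfun S (fun v => \prod_(i <- r | P i) F i v).
Proof.
move=> S1 hF; elim: r => [|i r IH].
  by apply: eq_polyfun (PolyC _ S1) _ => v; rewrite big_nil.
have [Pi|Pi] := boolP (P i).
  by apply: eq_polyfun (PolyM (hF i) IH) _ => v; rewrite big_cons Pi.
by apply: eq_polyfun IH _ => v; rewrite big_cons (negPf Pi).
Qed.
End Closure.

Lemma polyfun_comp (S : {pred algC}) n k F (g : 'rV[algC]_n -> 'rV[algC]_k) :
  polyfun S F -> (forall i, polyfun S (fun v => g v ord0 i)) ->
  polyfun S (fun v => F (g v)).
Proof.
move=> hF hg; elim: F / hF => [c Sc|i|f1 f2 _ h1 _ h2|f1 _ h1|f1 f2 _ h1 _ h2] //.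
- exact: PolyC.
- exact: PolyD h1 h2.
- exact: PolyN h1.
- exact: PolyM h1 h2.
Qed.

Lemma polyfun_mpoly n (F : 'rV[algC]_n -> algC) : polyfun Crat F ->
  exists2 p, p \is a mpolyOver n Crat & forall v, F v = evalpt p v.
Proof.
elim => {F} [c Sc|i|f g _ [p hp pE] _ [q hq qE]|f _ [p hp pE]|f g _ [p hp pE] _ [q hq qE]].
- by exists c%:MP => [|v]; rewrite ?mpolyOverC ?mevalC.
- by exists 'X_i => [|v]; rewrite ?mpolyOverX ?mevalXU.
- by exists (p + q) => [|v]; rewrite ?rpredD // mevalD pE qE.
- by exists (- p) => [|v]; rewrite ?rpredN // mevalN pE.
- by exists (p * q) => [|v]; rewrite ?rpredM // mevalM pE qE.
Qed.

Lemma mpoly_polyfun n k (p : {mpoly algC[n]}) (g : 'rV[algC]_k -> 'rV[algC]_n) :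
  (forall i, polyfun predT (fun v => g v ord0 i)) ->
  polyfun predT (fun v => evalpt p (g v)).
Proof.
move=> hg; have T (c : algC) : c \in predT by [].
apply: (@eq_polyfun _ _ (fun v => \sum_(m <- msupp p)
   p@_m * \prod_i g v ord0 i ^+ m i)); last by move=> v; rewrite mevalE.
apply: polyfun_sum => // m; apply: PolyM; first exact: PolyC.
by apply: polyfun_prod => // i; exact: polyfunXn.
Qed.

Definition chart n (h : 'I_n.+1) (v : 'rV[algC]_n.+1) : 'rV[algC]_n :=
  \row_i (v ord0 (lift h i) / v ord0 h).

Definition unchart n (h : 'I_n.+1) (w : 'rV[algC]_n) : 'rV[algC]_n.+1 :=
  \row_j (if unlift h j is Some i then w ord0 i else 1).

Lemma unchart_h n h (w : 'rV[algC]_n) : unchart h w ord0 h = 1.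
Proof. by rewrite mxE unlift_none. Qed.

Lemma unchart_lift n h (w : 'rV[algC]_n) i : unchart h w ord0 (lift h i) = w ord0 i.
Proof. by rewrite mxE liftK. Qed.

Lemma chart_scale n h c (w : 'rV[algC]_n) : c != 0 ->
  chart h (c *: unchart h w) = w.
Proof.
move=> c0; apply/rowP => i; rewrite !mxE liftK unlift_none mulr1.
by rewrite [c * _]mulrC mulfK.
Qed.

Lemma unchart_chart n h (v : 'rV[algC]_n.+1) : v ord0 h != 0 ->
  v = v ord0 h *: unchart h (chart h v).
Proof.
move=> v0; apply/rowP => j; rewrite !mxE.
case: unliftP => [i ->|->]; last by rewrite mulr1.
by rewrite mxE mulrC divfK.
Qed.

Lemma polyfun_unchart n h j : polyfun predT (fun w : 'rV[algC]_n => unchart h w ord0 j).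
Proof.
case: (unliftP h j) => [i|] ->.
  by apply: eq_polyfun (PolyX _ i) _ => w; rewrite unchart_lift.
by apply: (@eq_polyfun _ _ (fun=> 1)); [exact: PolyC | move=> w; rewrite unchart_h].
Qed.

Lemma evalpt_scale n d (p : {mpoly algC[n]}) c (v : 'rV[algC]_n) :
  p \is d.-homog -> evalpt p (c *: v) = c ^+ d * evalpt p v.
Proof.
move=> hp; rewrite !mevalE mulr_sumr; apply: eq_big_seq => m hm.
rewrite mulrCA; congr (_ * _); rewrite -(dhomog_mf hp hm) /= mdegE.
rewrite -prodrXr -big_split /=; apply: eq_bigr => i _.
by rewrite mxE exprMn.
Qed.

Lemma evalpt_chart n d (p : {mpoly algC[n.+1]}) h (v : 'rV[algC]_n.+1) :
  p \is d.-homog -> v ord0 h != 0 ->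
  evalpt p v = v ord0 h ^+ d * evalpt p (unchart h (chart h v)).
Proof. by move=> hp v0; rewrite {1}(unchart_chart v0) (evalpt_scale _ _ hp). Qed.

(** All sufficiently large degrees are available, so that several functions
    can be homogenized in the same degree. *)
Lemma homogenize n (h : 'I_n.+1) (F : 'rV[algC]_n -> algC) : polyfun Crat F ->
  exists d0, forall d, (d0 <= d)%N -> exists2 p,
    p \is d.-homog /\ p \is a mpolyOver n.+1 Crat &
    forall v : 'rV[algC]_n.+1, v ord0 h != 0 -> evalpt p v = v ord0 h ^+ d * F (chart h v).
Proof.
have X1 i : 'X_i \is [in algC[n.+1], 1.-homog] by rewrite dhomogX /= mdeg1.
have Xd d : 'X_h ^+ d \is [in algC[n.+1], d.-homog] by rewrite -{2}[d]mul1n dhomogMn.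
elim => {F} [c Sc|i|f g _ [d1 IH1] _ [d2 IH2]|f _ [d1 IH1]|f g _ [d1 IH1] _ [d2 IH2]].
- exists 0%N => d _; exists (c *: 'X_h ^+ d).
    by rewrite dhomogZ // mpolyOverZ // rpredX ?mpolyOverX.
  by move=> v _; rewrite mevalZ !rmorphXn /= mevalXU mulrC.
- exists 1%N => [[//|d] _]; exists ('X_(lift h i) * 'X_h ^+ d).
    by rewrite -[d.+1]add1n dhomogM // rpredM ?rpredX ?mpolyOverX.
  move=> v v0; rewrite mevalM rmorphXn /= !mevalXU mxE exprS; field; exact: v0.
- exists (maxn d1 d2) => d; rewrite geq_max => /andP[/IH1[p [hp pQ] pE] /IH2[q [hq qQ] qE]].
  exists (p + q) => [|v v0]; first by rewrite rpredD // rpredD.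
  by rewrite mevalD pE // qE // mulrDr.
- exists d1 => d /IH1[p [hp pQ] pE]; exists (- p) => [|v v0]; first by rewrite rpredN // rpredN.
  by rewrite mevalN pE // mulrN.
- exists (d1 + d2)%N => d hd.
  have [p [hp pQ] pE] := IH1 _ (leqnn d1).
  have [q [hq qQ] qE] : exists2 p, p \is (d - d1).-homog /\ p \is a mpolyOver n.+1 Crat &
    forall v : 'rV[algC]_n.+1, v ord0 h != 0 -> evalpt p v = v ord0 h ^+ (d - d1) * g (chart h v).
    by apply: IH2; lia.
  have dE : d = (d1 + (d - d1))%N by lia.
  exists (p * q) => [|v v0]; first by rewrite {1}dE dhomogM // rpredM.
  by rewrite mevalM pE // qE // mulrACA -exprD -dE.
Qed.
End PolynomialFunctions.

(** * Regular functions on principal open sets *)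

Section RegularFunctions.
Local Open Scope ring_scope.
Local Open Scope classical_set_scope.

Definition principal_open n (U : set 'rV[algC]_n) : Prop :=
  exists2 q, polyfun Crat q & forall v, U v <-> q v != 0.

(** The denominator q vanishes exactly outside U.  With this choice a sum or a
    product of two fractions has a denominator of the same kind, and powers of
    denominators need not be tracked. *)
Definition regular n (U : set 'rV[algC]_n) (F : 'rV[algC]_n -> algC) : Prop :=
  exists N q, [/\ polyfun Crat N, polyfun Crat q, forall v, U v <-> q v != 0 &
                  forall v, U v -> F v = N v / q v].

Section Closure.
Variable n : nat.
Implicit Types (U V : set 'rV[algC]_n) (f g : 'rV[algC]_n -> algC).

Lemma regular_open U f : regular U f -> principal_open U.
Proof. by move=> [N [q [_ hq hU _]]]; exists q. Qed.

Lemma eq_regular U f g : regular U f -> (forall v, U v -> f v = g v) -> regular U g.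
Proof.
by move=> [N [q [hN hq hU hf]]] h; exists N, q; split=> // v Uv; rewrite -h ?hf.
Qed.

Lemma polyfun_regular U f : principal_open U -> polyfun Crat f -> regular U f.
Proof.
move=> [q hq hU] hf; exists (fun v => f v * q v), q; split=> //; first exact: PolyM.
by move=> v /hU q0; rewrite mulfK.
Qed.

Lemma regular_sub U V f : regular U f -> principal_open V -> regular (U `&` V) f.
Proof.
move=> [N [p [hN hp hU hf]]] [q hq hV].
exists (fun v => N v * q v), (fun v => p v * q v); split; try exact: PolyM.
  move=> v; rewrite mulf_eq0 negb_or; split; first by move=> [/hU -> /hV ->].
  by move=> /andP[/hU ? /hV].
by move=> v [Uv /hV q0]; rewrite hf // -mulf_div divff // mulr1.
Qed.

Lemma regularD U f g : regular U f -> regular U g -> regular U (fun v => f v + g v).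
Proof.
move=> [N [p [hN hp hU hf]]] [M [q [hM hq hV hg]]].
exists (fun v => N v * q v + M v * p v), (fun v => p v * q v); split.
- by apply: PolyD; apply: PolyM.
- exact: PolyM.
- move=> v; rewrite mulf_eq0 negb_or; split; last by move=> /andP[/hU].
  by move=> Uv; apply/andP; split; [apply/hU|apply/hV].
- move=> v Uv; rewrite hf // hg // addf_div //; [exact/hU|exact/hV].
Qed.

Lemma regularM U f g : regular U f -> regular U g -> regular U (fun v => f v * g v).
Proof.
move=> [N [p [hN hp hU hf]]] [M [q [hM hq hV hg]]].
exists (fun v => N v * M v), (fun v => p v * q v); split; try exact: PolyM.
  move=> v; rewrite mulf_eq0 negb_or; split; last by move=> /andP[/hU].
  by move=> Uv; apply/andP; split; [apply/hU|apply/hV].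
by move=> v Uv; rewrite hf // hg // mulf_div.
Qed.

Lemma regularN U f : regular U f -> regular U (fun v => - f v).
Proof.
move=> [N [p [hN hp hU hf]]]; exists (fun v => - N v), p; split=> //.
  exact: PolyN.
by move=> v Uv; rewrite hf // mulNr.
Qed.

Lemma regularV U f : regular U f ->
  regular (U `&` [set v | f v != 0]) (fun v => (f v)^-1).
Proof.
move=> [N [p [hN hp hU hf]]].
have E v : (U `&` [set v | f v != 0]) v <-> p v * N v != 0.
  rewrite mulf_eq0 negb_or; split.
    move=> [Uv]; rewrite /= hf // mulf_eq0 invr_eq0 negb_or => /andP[-> ->].
    by [].
  move=> /andP[/[dup] p0 /hU Uv N0]; split=> //=.
  by rewrite hf // mulf_neq0 ?invr_eq0.
exists (fun v => p v * p v), (fun v => p v * N v); split=> //; try exact: PolyM.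
move=> v /[dup] /E; rewrite mulf_eq0 negb_or => /andP[p0 N0] [Uv _].
by rewrite hf // invf_div -mulf_div divff // mul1r.
Qed.

Lemma principal_open_neq0 U f : regular U f -> principal_open (U `&` [set v | f v != 0]).
Proof. by move=> /regularV/regular_open. Qed.

End Closure.

Section Composition.
Variables (n k : nat) (U : set 'rV[algC]_n) (g : 'rV[algC]_n -> 'rV[algC]_k).
Hypothesis oU : principal_open U.
Hypothesis hg : forall i, regular U (fun v => g v ord0 i).

Lemma polyfun_regular_comp F : polyfun Crat F -> regular U (fun v => F (g v)).
Proof.
elim => {F} [c Sc|i|f1 f2 _ h1 _ h2|f1 _ h1|f1 f2 _ h1 _ h2] //.
- by apply: polyfun_regular oU _; exact: PolyC.
- exact: regularD h1 h2.
- exact: regularN h1.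
- exact: regularM h1 h2.
Qed.

Lemma regular_comp V F : regular V F ->
  regular (U `&` g @^-1` V) (fun v => F (g v)).
Proof.
move=> [N [q [hN hq hV hF]]].
have E : U `&` g @^-1` V = U `&` (U `&` [set v | q (g v) != 0]).
  by apply/seteqP; split=> v /= => [[Uv /hV ?]|[Uv [_ /hV]]].
have hq' := regularV (polyfun_regular_comp hq).
have hN' := regular_sub (polyfun_regular_comp hN) (regular_open hq').
have hq2 := regular_sub hq' oU; rewrite setIC in hq2.
by rewrite E; apply: eq_regular (regularM hN' hq2) _ => v [_ [_ /hV /hF]].
Qed.

Lemma principal_open_preimage V : principal_open V -> principal_open (U `&` g @^-1` V).
Proof.
move=> oV; apply: regular_open; apply: (regular_comp (F := fun=> 1)).
by apply: polyfun_regular => //; apply: PolyC; rewrite rpred1.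
Qed.
End Composition.

Lemma regular_common_denominator n k (U : set 'rV[algC]_n) (F : 'I_k -> 'rV[algC]_n -> algC) :
  principal_open U -> (forall i, regular U (F i)) ->
  exists (N : 'I_k -> 'rV[algC]_n -> algC) q,
  [/\ forall i, polyfun Crat (N i), polyfun Crat q, forall v, U v <-> q v != 0 &
      forall i v, U v -> F i v = N i v / q v].
Proof.
move=> [q0 hq0 hU0] hF.
have [N hN] := choice hF; have [q {}hN] := choice hN.
exists (fun i v => N i v * (q0 v * \prod_(j | j != i) q j v)),
       (fun v => q0 v * \prod_j q j v).
have R1 : 1 \in Crat by rewrite rpred1.
split.
- move=> i; case: (hN i) => hNi _ _ _; apply: PolyM => //; apply: PolyM => //.
  by apply: polyfun_prod => // j; case: (hN j).
- by apply: PolyM => //; apply: polyfun_prod => // j; case: (hN j).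
- move=> v; split; last by rewrite mulf_eq0 negb_or => /andP[/hU0].
  move=> Uv; apply: mulf_neq0; first exact/hU0.
  by apply/prodf_neq0 => j _; case: (hN j) => _ _ hU _; apply/hU.
- move=> i v Uv; rewrite (bigD1 i (P := predT)) //= [q0 v * (q i v * _)]mulrCA -mulf_div divff ?mulr1.
    by case: (hN i) => _ _ _; apply.
  apply: mulf_neq0; first exact/hU0.
  by apply/prodf_neq0 => j _; case: (hN j) => _ _ hU _; apply/hU.
Qed.
End RegularFunctions.
(** * Birational maps between affine sets *)

Section AffineBirational.
Local Open Scope ring_scope.
Local Open Scope classical_set_scope.

(** Inverse bijections over Q between the parts of C and E in principal open
    sets with finite complements.  The finiteness makes the relation
    transitive and, when there are no isolated points, the domains dense. *)
Definition affine_birational n k (C : set 'rV[algC]_n) (E : set 'rV[algC]_k) : Prop :=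
  exists (U : set 'rV[algC]_n) (V : set 'rV[algC]_k)
         (f : 'rV[algC]_n -> 'rV[algC]_k) (g : 'rV[algC]_k -> 'rV[algC]_n),
  [/\ (principal_open U /\ forall i, regular U (fun v => f v ord0 i)) /\
      (principal_open V /\ forall i, regular V (fun v => g v ord0 i)),
      finite_set (C `\` U) /\ finite_set (E `\` V),
      forall v, C v -> U v -> [/\ E (f v), V (f v) & g (f v) = v] &
      forall w, E w -> V w -> [/\ C (g w), U (g w) & f (g w) = w]].

Lemma affine_birational_trans n k l (C : set 'rV[algC]_n)
    (D : set 'rV[algC]_k) (E : set 'rV[algC]_l) :
  affine_birational C D -> affine_birational D E -> affine_birational C E.
Proof.
move=> [U1 [V1 [f1 [g1 [[[oU1 rf1] [oV1 rg1]] [fC1 fD1] h1 k1]]]]].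
move=> [U2 [V2 [f2 [g2 [[[oU2 rf2] [oV2 rg2]] [fC2 fD2] h2 k2]]]]].
exists (U1 `&` f1 @^-1` U2), (V2 `&` g2 @^-1` V1), (f2 \o f1), (g1 \o g2).
split.
- split; split; try exact: principal_open_preimage.
    by move=> i; apply: (regular_comp oU1 rf1 (rf2 i)).
  by move=> i; apply: (regular_comp oV2 rg2 (rg1 i)).
- split.
    apply: (@sub_finite_set _ _ ((C `\` U1) `|` g1 @` (D `\` U2))).
      move=> v [Cv nU]; have [Uv|nUv] := pselect (U1 v); last by left.
      right; have [Df Vf gf] := h1 v Cv Uv; exists (f1 v) => //.
      by split=> // ?; apply: nU.
    by rewrite finite_setU; split=> //; apply: finite_image.
  apply: (@sub_finite_set _ _ ((E `\` V2) `|` f2 @` (D `\` V1))).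
    move=> v [Cv nU]; have [Uv|nUv] := pselect (V2 v); last by left.
    right; have [Df Vf gf] := k2 v Cv Uv; exists (g2 v) => //.
    by split=> // ?; apply: nU.
  by rewrite finite_setU; split=> //; apply: finite_image.
- move=> v Cv [U1v U2v]; have [D1 V1f gf] := h1 v Cv U1v.
  have [Ef V2f gf2] := h2 _ D1 U2v; split=> //=; last by rewrite gf2.
  by split=> //=; rewrite gf2.
- move=> w Ew [V2w V1w]; have [D1 U2g fg] := k2 w Ew V2w.
  have [Cg U1g fg2] := k1 _ D1 V1w; split=> //=; last by rewrite fg2.
  by split=> //=; rewrite fg2.
Qed.

(** The last clause says that X has no isolated point and no component at
    infinity; it makes complements of finite sets dense. *)
Definition affine_part n (h : 'I_n.+1) (C : set 'rV[algC]_n)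
    (X : set 'rV[algC]_n.+1) : Prop :=
  [/\ forall v, X v -> v != 0,
      forall v : 'rV[algC]_n.+1, v ord0 h != 0 -> (X v <-> C (chart h v)) &
      forall d p, p \is d.-homog -> forall A, finite_set A ->
        (forall w, C w -> ~ A w -> evalpt p (unchart h w) = 0) ->
        forall v, X v -> evalpt p v = 0].

(** The factor 'X_h removes the hyperplane at infinity of the chart h. *)
Lemma projective_open n (h : 'I_n.+1) (U : set 'rV[algC]_n) :
  principal_open U ->
  exists2 Z, proj_closed Crat Z &
    forall v : 'rV[algC]_n.+1, v != 0 -> ~ Z v <-> v ord0 h != 0 /\ U (chart h v).
Proof.
move=> [q hq hU]; have [d0 /(_ _ (leqnn d0)) [p [hp pQ] pE]] := homogenize h hq.
have X1 : 'X_h \is [in algC[n.+1], 1.-homog] by rewrite dhomogX /= mdeg1.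
exists (proj_zeros [set 'X_h * p]).
  exists [set 'X_h * p] => // _ ->; split; last by rewrite rpredM // mpolyOverX.
  by exists (1 + d0)%N; rewrite dhomogM.
move=> v v0; split.
  move=> nZ; have nz : evalpt ('X_h * p) v != 0.
    by apply/eqP => e; apply: nZ; split=> // _ ->.
  move: nz; rewrite mevalM mevalXU mulf_eq0 negb_or => /andP[vh].
  by rewrite pE // mulf_eq0 negb_or => /andP[_ /hU].
move=> [vh /hU q0] [_ /(_ _ erefl)] /eqP; apply/negP.
by rewrite mevalM mevalXU pE // !mulf_neq0 // expf_neq0.
Qed.

(** The coordinates of f have a common denominator; with it, they are
    homogenized in the same degree. *)
Lemma projective_tuple n k (h : 'I_n.+1) (h' : 'I_k.+1) (U : set 'rV[algC]_n)
    (f : 'rV[algC]_n -> 'rV[algC]_k) :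
  principal_open U -> (forall i, regular U (fun v => f v ord0 i)) ->
  exists2 phi, homog_tuple_over_Q phi &
    forall v : 'rV[algC]_n.+1, v ord0 h != 0 -> U (chart h v) ->
      exists2 c, c != 0 & apply_tuple phi v = c *: unchart h' (f (chart h v)).
Proof.
move=> oU rf.
have [N [q [hN hq hU hf]]] := regular_common_denominator oU rf.
pose M j := if unlift h' j is Some i then N i else q.
have hM j : polyfun Crat (M j) by rewrite /M; case: unlift.
have [d hd] := choice (fun j => homogenize h (hM j)).
pose D := (\max_j d j)%N.
have hD j : (d j <= D)%N by apply: leq_bigmax.
have hd' j : exists p : {mpoly algC[n.+1]},
    (p \is D.-homog /\ p \is a mpolyOver n.+1 Crat) /\
    forall v : 'rV_n.+1, v ord0 h != 0 ->
      evalpt p v = v ord0 h ^+ D * M j (chart h v).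
  by have [p hp pE] := hd j D (hD j); exists p.
have [phi hphi] := choice hd'.
exists phi; first by exists D => j; case: (hphi j).
move=> v vh Uv; exists (v ord0 h ^+ D * q (chart h v)).
  by rewrite mulf_neq0 ?expf_neq0 //; apply/hU.
apply/rowP => j; rewrite !mxE; have [_ ->] := hphi j; rewrite // -mulrA.
congr (_ * _); rewrite /M; case: unlift => [i|]; last by rewrite mulr1.
by rewrite hf // mulrC divfK //; apply/hU.
Qed.

Lemma birational_of_affine n k (h : 'I_n.+1) (h' : 'I_k.+1) C E X Y :
  affine_part h C X -> affine_part h' E Y -> affine_birational C E ->
  birational_over_Q X Y.
Proof.
move=> [X0 XC Xd] [Y0 YE Yd].
move=> [U [V [f [g [[[oU rf] [oV rg]] [fC fE] hU hV]]]]].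
have [Z hZ ZE] := projective_open h oU.
have [Z' hZ' ZE'] := projective_open h' oV.
have [phi hphi phiE] := projective_tuple h h' oU rf.
have [psi hpsi psiE] := projective_tuple h' h oV rg.
have open m (a : 'I_m.+1) (B : set 'rV_m) T (W : set 'rV_m) S :
    affine_part a B T -> finite_set (B `\` W) -> proj_closed Crat S ->
    (forall v : 'rV[algC]_m.+1, v != 0 -> ~ S v <-> v ord0 a != 0 /\ W (chart a v)) ->
    dense_open_over_Q T (T `\` S).
  move=> [T0 TB Td] fB hS SE; split; first by exists S.
  move=> _ [Ps hPs ->] sub v Tv; split; first exact: T0.
  move=> p hp; have [[d pd] _] := hPs _ hp.
  apply: (Td d p pd _ fB) => // w Bw nBw.
  have c1 : chart a (unchart a w) = w.
    by rewrite -[X in chart a X]scale1r chart_scale ?oner_neq0.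
  have a1 : unchart a w ord0 a != 0 by rewrite unchart_h oner_neq0.
  have Tw : T (unchart a w) by apply/TB; rewrite ?c1.
  have [] // := sub (unchart a w); last by move=> _; apply.
  split=> //; apply/SE; first exact: T0.
  split=> //; rewrite c1; apply: contrapT => nW; exact: nBw.
have inv_scale m (a : 'I_m.+1) (u : 'rV[algC]_m.+1) : u ord0 a != 0 ->
    (u ord0 a)^-1 *: u = unchart a (chart a u).
  by move=> u0; rewrite {2}(unchart_chart u0) scalerA mulVf // scale1r.
exists (X `\` Z), (Y `\` Z'), phi, psi; split=> //.
- split; first exact: open fC hZ ZE.
  exact: open fE hZ' ZE'.
- move=> v [Xv /ZE [|vh Uv]]; first exact: X0.
  have Cv : C (chart h v) by apply/XC.
  have [Ef Vf gf] := hU _ Cv Uv.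
  have [c c0 cE] := phiE _ vh Uv.
  have ch : chart h' (apply_tuple phi v) = f (chart h v) by rewrite cE chart_scale.
  have ph : apply_tuple phi v ord0 h' != 0 by rewrite cE mxE unchart_h mulr1.
  have Yp : Y (apply_tuple phi v) by apply/YE; rewrite ?ch.
  split; first by split=> //; apply/ZE'; [exact: Y0|rewrite ch].
  have [|c' c'0 ->] := psiE _ ph; first by rewrite ch.
  exists (c' / v ord0 h); first by rewrite mulf_neq0 ?invr_eq0.
  by rewrite ch gf -scalerA (inv_scale _ _ _ vh).
- move=> w [Yw /ZE' [|wh Vw]]; first exact: Y0.
  have Ew : E (chart h' w) by apply/YE.
  have [Cg Ug fg] := hV _ Ew Vw.
  have [c c0 cE] := psiE _ wh Vw.
  have ch : chart h (apply_tuple psi w) = g (chart h' w) by rewrite cE chart_scale.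
  have ph : apply_tuple psi w ord0 h != 0 by rewrite cE mxE unchart_h mulr1.
  have Xp : X (apply_tuple psi w) by apply/XC; rewrite ?ch.
  split; first by split=> //; apply/ZE; [exact: X0|rewrite ch].
  have [|c' c'0 ->] := phiE _ ph; first by rewrite ch.
  exists (c' / w ord0 h'); first by rewrite mulf_neq0 ?invr_eq0.
  by rewrite ch fg -scalerA (inv_scale _ _ _ wh).
Qed.
End AffineBirational.
(** * Double covers of the line *)

Section DoubleCovers.
Local Open Scope ring_scope.
Local Open Scope classical_set_scope.

Definition pt2 (x y : algC) : 'rV[algC]_2 := \row_i [:: x; y]`_i.

Lemma pt2E x y : (pt2 x y ord0 0 = x) * (pt2 x y ord0 1 = y).
Proof. by rewrite !mxE. Qed.

Lemma pt2_eta (w : 'rV[algC]_2) : w = pt2 (w ord0 0) (w ord0 1).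
Proof.
apply/rowP => i; rewrite mxE; case: i => [[|[|//]]] h /=; congr (w _ _); exact: val_inj.
Qed.

Definition double_cover (f : {poly algC}) : set 'rV[algC]_2 :=
  [set w | w ord0 1 ^+ 2 = f.[w ord0 0]].

Lemma double_coverE f x y : double_cover f (pt2 x y) <-> y ^+ 2 = f.[x].
Proof. by rewrite /double_cover /= !pt2E. Qed.

Lemma poly_cofinite_eq0 (A : set algC) (p : {poly algC}) : finite_set A ->
  (forall x, ~ A x -> p.[x] = 0) -> p = 0.
Proof.
move=> /finite_seqP[s sE] hp; pose q := p * \prod_(a <- s) ('X - a%:P).
have q0 : q = 0.
  apply/eqP; apply: contraT => qn0; have := max_poly_roots (rs := [seq i%:R | i <- iota 0 (size q)]) qn0.
  rewrite size_map size_iota ltnn => -> //.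
    apply/allP => x _; rewrite rootE hornerM; have [sx|sx] := boolP (x \in s).
      by rewrite [X in _ * X](_ : _ = 0) ?mulr0 //; apply/rootP; rewrite root_prod_XsubC.
    by rewrite hp ?mul0r // sE /=; apply/negP.
  by rewrite map_inj_uniq ?iota_uniq //; apply: (mulrIn (R := algC)); rewrite oner_neq0.
have := q0; move/eqP; rewrite mulf_eq0 => /orP[/eqP //|].
by rewrite (negPf (monic_neq0 (monic_prod_XsubC _ _ _))).
Qed.

Lemma finite_root_set (p : {poly algC}) : p != 0 -> finite_set [set x | p.[x] = 0].
Proof.
move=> p0; have [r pE] := closed_field_poly_normal p.
apply: (@sub_finite_set _ _ [set` r]); last exact: finite_seq.
move=> x /= /rootP; rewrite pE rootZ ?lead_coef_eq0 //.
by rewrite root_prod_XsubC.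
Qed.

Lemma finite_double_cover f (B : set algC) : finite_set B ->
  finite_set (double_cover f `&` [set w | B (w ord0 0)]).
Proof.
move=> fB.
apply: (@sub_finite_set _ _
   ((fun x => pt2 x (sqrtC f.[x])) @` B `|` (fun x => pt2 x (- sqrtC f.[x])) @` B)).
  move=> w [/= hw Bw]; have : w ord0 1 ^+ 2 == sqrtC f.[w ord0 0] ^+ 2.
    by rewrite sqrtCK hw.
  rewrite eqf_sqr => /orP[/eqP e|/eqP e]; [left|right]; exists (w ord0 0) => //;
    by rewrite -e -pt2_eta.
by rewrite finite_setU; split; apply: finite_image.
Qed.

(** Both square roots of f(x) occur over x, so that a(x) and b(x) f(x) vanish
    for almost all x. *)
Lemma double_cover_identity f (a b : {poly algC}) (A : set 'rV[algC]_2) :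
  f != 0 -> finite_set A ->
  (forall w, double_cover f w -> ~ A w -> a.[w ord0 0] + b.[w ord0 0] * w ord0 1 = 0) ->
  a = 0 /\ b = 0.
Proof.
move=> f0 fA H.
have fB : finite_set ((fun w : 'rV[algC]_2 => w ord0 0) @` A) by apply: finite_image.
have key x : ~ ((fun w : 'rV[algC]_2 => w ord0 0) @` A) x ->
    a.[x] = 0 /\ b.[x] * sqrtC f.[x] = 0.
  move=> nA; pose y := sqrtC f.[x]; have yE : y ^+ 2 = f.[x] by rewrite sqrtCK.
  have h1 : a.[x] + b.[x] * y = 0.
    have := H (pt2 x y); rewrite !pt2E; apply; first by apply/double_coverE.
    by move=> Ap; apply: nA; exists (pt2 x y); rewrite ?pt2E.
  have h2 : a.[x] + b.[x] * - y = 0.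
    have := H (pt2 x (- y)); rewrite !pt2E; apply.
      by apply/double_coverE; rewrite sqrrN.
    by move=> Ap; apply: nA; exists (pt2 x (- y)); rewrite ?pt2E.
  have a0 : a.[x] = 0.
    have : 2 * a.[x] = 0.
      by rewrite -[RHS](addr0 0) -{1}h1 -h2; ring.
    by move/eqP; rewrite mulf_eq0 pnatr_eq0 /= => /eqP.
  by split=> //; move: h1; rewrite a0 add0r.
split; first by apply: (poly_cofinite_eq0 fB) => x /key[].
suff : b * f = 0 by move/eqP; rewrite mulf_eq0 (negPf f0) orbF => /eqP.
apply: (poly_cofinite_eq0 fB) => x /key[_ h].
by rewrite hornerM -(sqrtCK f.[x]) expr2 mulrA h mul0r.
Qed.

Lemma polyfun_double_cover f F : polyfun predT F ->
  exists a b : {poly algC}, forall w, double_cover f w ->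
    F w = a.[w ord0 0] + b.[w ord0 0] * w ord0 1.
Proof.
elim => {F} [c _|i|F G _ [a [b h]] _ [c [d k]]|F _ [a [b h]]|F G _ [a [b h]] _ [c [d k]]].
- by exists c%:P, 0 => w _; rewrite !hornerE.
- case: i => [[|[|//]]] hi.
    by exists 'X, 0 => w _; rewrite !hornerE; congr (w _ _); apply: val_inj.
  by exists 0, 1 => w _; rewrite !hornerE; congr (w _ _); apply: val_inj.
- exists (a + c), (b + d) => w hw; rewrite h // k // !hornerD.
  have R (p q r s y : algC) : p + q * y + (r + s * y) = p + r + (q + s) * y by ring.
  exact: R.
- exists (- a), (- b) => w hw; rewrite h // !hornerN.
  have R (p q y : algC) : - (p + q * y) = - p + - q * y by ring.
  exact: R.
- exists (a * c + b * d * f), (a * d + b * c) => w hw.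
  rewrite h // k // !(hornerD, hornerM) -hw.
  have R (p q r s y : algC) :
    (p + q * y) * (r + s * y) = p * r + q * s * y ^+ 2 + (p * s + q * r) * y by ring.
  exact: R.
Qed.

(** A double cover of the line has no isolated point. *)
Lemma polyfun_cofinite_eq0 f F (A : set 'rV[algC]_2) : f != 0 ->
  polyfun predT F -> finite_set A ->
  (forall w, double_cover f w -> ~ A w -> F w = 0) ->
  forall w, double_cover f w -> F w = 0.
Proof.
move=> f0 /(polyfun_double_cover f)[a [b FE]] fA H w hw.
have [|a0 b0] := double_cover_identity (a := a) (b := b) f0 fA.
  by move=> u hu nA; rewrite -FE // H.
by rewrite FE // a0 b0 !hornerE.
Qed.
End DoubleCovers.
(** * The ideal of a plane cubic *)

Section PlaneCubic.
Local Open Scope ring_scope.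
Local Open Scope classical_set_scope.

Variables (a2 a4 a6 : algC).

Local Notation X := ('X_(0 : 'I_3) : {mpoly algC[3]}).
Local Notation Y := ('X_(1 : 'I_3) : {mpoly algC[3]}).
Local Notation Z := ('X_(2 : 'I_3) : {mpoly algC[3]}).

Definition cubic_form : {mpoly algC[3]} :=
  Y ^+ 2 * Z - X ^+ 3 - a2%:MP * X ^+ 2 * Z - a4%:MP * X * Z ^+ 2 - a6%:MP * Z ^+ 3.

Definition cubic_poly : {poly algC} := 'X^3 + a2 *: 'X^2 + a4 *: 'X + a6%:P.

Local Notation W := cubic_form.
Local Notation f := cubic_poly.

Definition monom i j k : {mpoly algC[3]} := X ^+ i * Y ^+ j * Z ^+ k.

(** Every form of degree d is one of these modulo W, which allows the
    elimination of x^3.  The even bound on j lets the values on the curve split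
    into even and odd powers of y. *)
Definition normal_form d (c : nat -> nat -> algC) : {mpoly algC[3]} :=
  \sum_(i < 3) \sum_(j < d.+1.*2 | (i + j <= d)%N) c i j *: monom i j (d - (i + j)).

Definition normalizable d (p : {mpoly algC[3]}) :=
  exists q c, p = W * q + normal_form d c /\ q \is (d - 3).-homog.

Lemma monom_homog i j k : monom i j k \is (i + j + k).-homog.
Proof.
have X1 i' l : 'X_i' ^+ l \is [in algC[3], l.-homog].
  by rewrite -{2}[l]mul1n dhomogMn // dhomogX /= mdeg1.
by rewrite /monom !dhomogM.
Qed.

Lemma cubic_form_homog : W \is 3.-homog.
Proof.
have C (c : algC) i j k : (i + j + k = 3)%N -> c%:MP * monom i j k \is 3.-homog.
  by move=> e; rewrite mul_mpolyC dhomogZ //; have := monom_homog i j k; rewrite e.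
have -> : W = 1%:MP * monom 0 2 1 - 1%:MP * monom 3 0 0 - a2%:MP * monom 2 0 1
              - a4%:MP * monom 1 0 2 - a6%:MP * monom 0 0 3.
  by rewrite /W /monom; ring.
by rewrite !rpredB ?C.
Qed.

Lemma normal_formD d c c' :
  normal_form d c + normal_form d c' = normal_form d (fun i j => c i j + c' i j).
Proof.
rewrite -big_split; apply: eq_bigr => i _; rewrite -big_split /=.
by apply: eq_bigr => j _; rewrite scalerDl.
Qed.

Lemma normal_formZ d a c : a *: normal_form d c = normal_form d (fun i j => a * c i j).
Proof.
rewrite scaler_sumr; apply: eq_bigr => i _; rewrite scaler_sumr.
by apply: eq_bigr => j _; rewrite scalerA.
Qed.

Lemma normalizableD d p p' : normalizable d p -> normalizable d p' -> normalizable d (p + p').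
Proof.
move=> [q [c [-> hq]]] [q' [c' [-> hq']]]; exists (q + q'), (fun i j => c i j + c' i j).
by rewrite -normal_formD rpredD //; split=> //; rewrite mulrDr addrACA.
Qed.

Lemma normalizableZ d a p : normalizable d p -> normalizable d (a *: p).
Proof.
move=> [q [c [-> hq]]]; exists (a *: q), (fun i j => a * c i j).
by rewrite -normal_formZ dhomogZ // scalerDr scalerAr.
Qed.

Lemma normalizable_multiple d q : q \is (d - 3).-homog -> normalizable d (W * q).
Proof.
move=> hq; exists q, (fun _ _ => 0); split=> //.
rewrite /normal_form big1 ?addr0 // => i _; rewrite big1 // => j _.
by rewrite scale0r.
Qed.

(** Induction on the exponent of x, by rewriting x^3 with the equation. *)
Lemma normalizable_monom i j k : normalizable (i + j + k) (monom i j k).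
Proof.
have [m] := ubnP i; elim: m i j k => // m IH i j k im.
have [i3|i3] := ltnP i 3.
  exists 0, (fun i' j' => ((i' == i) && (j' == j))%:R); rewrite rpred0 mulr0 add0r.
  split=> //; rewrite /normal_form (bigD1 (Ordinal i3)) //=.
  have hj : (j < (i + j + k).+1.*2)%N by lia.
  rewrite [X in _ + X]big1 ?addr0 => [|i' ni]; last first.
    rewrite big1 // => j' _; rewrite [_ == i](_ : _ = false) ?scale0r //.
    by apply: contraNF ni => /eqP e; apply/eqP/val_inj.
  rewrite (bigD1 (Ordinal hj)) /=; last by lia.
  rewrite !eqxx scale1r big1 ?addr0; first by congr monom; lia.
  move=> j' /andP[_ nj]; rewrite [_ == j](_ : _ = false) ?andbF ?scale0r //.
  by apply: contraNF nj => /eqP e; apply/eqP/val_inj.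
case: i i3 im => [|[|[|i]]] // _ im.
have -> : monom i.+3 j k = W * (- 1 *: monom i j k)
   + (monom i j.+2 k.+1 + (- a2 *: monom i.+2 j k.+1
   + (- a4 *: monom i.+1 j k.+2 + - a6 *: monom i j k.+3))).
  by rewrite /W /monom !exprS -!mul_mpolyC !mpolyCN mpolyC1; ring.
apply: normalizableD.
  apply: normalizable_multiple; apply: dhomogZ.
  by rewrite (_ : _ - 3 = i + j + k)%N ?monom_homog //; lia.
apply: normalizableD.
  by rewrite (_ : i.+3 + j + k = i + j.+2 + k.+1)%N; [apply: IH; lia|lia].
apply: normalizableD.
  by apply: normalizableZ; rewrite (_ : i.+3 + j + k = i.+2 + j + k.+1)%N; [apply: IH; lia|lia].
apply: normalizableD; apply: normalizableZ.
  by rewrite (_ : i.+3 + j + k = i.+1 + j + k.+2)%N; [apply: IH; lia|lia].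
by rewrite (_ : i.+3 + j + k = i + j + k.+3)%N; [apply: IH; lia|lia].
Qed.

Lemma normalizable_homog d p : p \is d.-homog -> normalizable d p.
Proof.
move=> hp; rewrite (mpolyE p) big_seq.
have N0 : normalizable d 0 by rewrite -(mulr0 W); apply: normalizable_multiple; rewrite rpred0.
elim/big_rec: _ => // m q hm IH; apply: normalizableD => //; apply: normalizableZ.
have /= := dhomog_mf hp hm; rewrite mdegE !big_ord_recl big_ord0 addn0 addnA => <-.
have -> : 'X_[m] = monom (m ord0) (m (lift ord0 ord0)) (m (lift ord0 (lift ord0 ord0))).
  rewrite mpolyXE_id !big_ord_recl big_ord0 mulr1 /monom mulrA.
  by congr ('X_ _ ^+ _ * 'X_ _ ^+ _ * 'X_ _ ^+ _); apply: val_inj.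
exact: normalizable_monom.
Qed.

Lemma unchart2E (w : 'rV[algC]_2) :
  [/\ unchart (2 : 'I_3) w ord0 0 = w ord0 0, unchart (2 : 'I_3) w ord0 1 = w ord0 1
    & unchart (2 : 'I_3) w ord0 2 = 1].
Proof.
have e0 : 0 = lift (2 : 'I_3) (0 : 'I_2) by apply: val_inj.
have e1 : 1 = lift (2 : 'I_3) (1 : 'I_2) by apply: val_inj.
split; last exact: unchart_h.
  by rewrite [X in unchart _ _ _ X]e0 unchart_lift.
by rewrite [X in unchart _ _ _ X]e1 unchart_lift.
Qed.

Lemma cubic_polyE x : f.[x] = x ^+ 3 + a2 * x ^+ 2 + a4 * x + a6.
Proof. by rewrite /cubic_poly !hornerE. Qed.

Lemma size_cubic_poly : size f = 4%N.
Proof.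
rewrite /cubic_poly -!addrA size_addl ?size_polyXn //.
rewrite (leq_ltn_trans (size_add _ _)) // gtn_max; apply/andP; split.
  by rewrite (leq_ltn_trans (size_scale_leq _ _)) // size_polyXn.
rewrite (leq_ltn_trans (size_add _ _)) // gtn_max; apply/andP; split.
  by rewrite (leq_ltn_trans (size_scale_leq _ _)) // size_polyX.
by rewrite (leq_ltn_trans (size_polyC_leq1 _)).
Qed.

Lemma cubic_poly_neq0 : f != 0.
Proof. by rewrite -size_poly_gt0 size_cubic_poly. Qed.

Lemma cubic_form_chart w :
  evalpt W (unchart (2 : 'I_3) w) = w ord0 1 ^+ 2 - f.[w ord0 0].
Proof.
have [e0 e1 e2] := unchart2E w.
rewrite cubic_polyE /cubic_form !(mevalB, mevalM, mevalC, rmorphXn) /= !mevalXU.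
by rewrite e0 e1 e2; ring.
Qed.

(** The coefficient of y^j in a normal form at z = 1.  Its degree is at most 2,
    so that it can serve as a digit in base f. *)
Definition digit d (c : nat -> nat -> algC) j : {poly algC} :=
  \sum_(i < 3 | (i + j <= d)%N) c i j *: 'X^i.

Lemma normal_form_chart d c w :
  evalpt (normal_form d c) (unchart (2 : 'I_3) w) =
  \sum_(j < d.+1.*2) (digit d c j).[w ord0 0] * w ord0 1 ^+ j.
Proof.
have [e0 e1 e2] := unchart2E w.
rewrite /normal_form rmorph_sum /=; under eq_bigr => i _.
  rewrite rmorph_sum /=; under eq_bigr => j _.
    rewrite mevalZ /monom !(mevalM, rmorphXn) /= !mevalXU e0 e1 e2 expr1n mulr1 mulrA.
    over.
  rewrite big_mkcond /=; over.
rewrite exchange_big /=; apply: eq_bigr => j _.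
rewrite -big_mkcond /digit horner_sum mulr_suml /=.
by apply: eq_bigr => i _; rewrite !hornerE.
Qed.

Lemma size_digit d c j : (size (digit d c j) <= 3)%N.
Proof.
apply: (leq_trans (size_sum _ _ _)); apply/bigmax_leqP => i _.
by rewrite (leq_trans (size_scale_leq _ _)) // size_polyXn.
Qed.

Lemma expansion_eq0 n (u : nat -> {poly algC}) :
  (forall k, (size (u k) <= 3)%N) -> \sum_(k < n) u k * f ^+ k = 0 ->
  forall k, (k < n)%N -> u k = 0.
Proof.
elim: n u => // n IH u hu; rewrite big_ord_recl expr0 mulr1.
pose s := \sum_(k < n) u k.+1 * f ^+ k.
have -> : \sum_(i < n) u (lift ord0 i) * f ^+ lift ord0 i = s * f.
  by rewrite mulr_suml; apply: eq_bigr => i _; rewrite lift0 exprSr mulrA.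
move=> H; have s0 : s = 0.
  apply/eqP; apply: contraT => s0; have := hu 0%N.
  have -> : u 0%N = - (s * f) by apply/eqP; rewrite -addr_eq0; apply/eqP.
  rewrite size_polyN size_mul ?cubic_poly_neq0 // size_cubic_poly.
  by move: s0; rewrite -size_poly_gt0; case: (size s) => // k _; rewrite addSn !addnS.
case=> [_|k kn]; last by apply: (IH (fun k => u k.+1)).
by move: H; rewrite s0 mul0r addr0.
Qed.

Lemma sum_even_odd (R : comPzRingType) n (u : nat -> R) y :
  \sum_(j < n.*2) u j * y ^+ j =
  \sum_(k < n) u k.*2 * y ^+ 2 ^+ k + (\sum_(k < n) u k.*2.+1 * y ^+ 2 ^+ k) * y.
Proof.
elim: n => [|n IH]; first by rewrite !big_ord0 mul0r addr0.
rewrite doubleS !big_ord_recr /= IH -!exprM mul2n [y ^+ n.*2.+1]exprSr; ring.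
Qed.

(** A form of degree d that vanishes on the curve has, modulo W, a normal form
    that vanishes on it.  At z = 1 its even and odd parts in y are expansions
    in base f = y^2, with the digits above; they vanish identically, so all
    the digits do. *)
Lemma form_vanishing d p (A : set 'rV[algC]_2) : p \is d.-homog ->
  finite_set A ->
  (forall w, double_cover f w -> ~ A w -> evalpt p (unchart (2 : 'I_3) w) = 0) ->
  exists2 q, p = W * q & q \is (d - 3).-homog.
Proof.
move=> /normalizable_homog[q [c [pE hq]]] fA H; exists q => //.
suff c0 i j : (i < 3)%N -> (i + j <= d)%N -> c i j = 0.
  rewrite pE; have -> : normal_form d c = 0; last by rewrite addr0.
  rewrite /normal_form big1 // => i _; rewrite big1 // => j hij.
  by rewrite c0 ?scale0r.
have [|e0 o0] := @double_cover_identity f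
    (\sum_(k < d.+1) digit d c k.*2 * f ^+ k)
    (\sum_(k < d.+1) digit d c k.*2.+1 * f ^+ k) A cubic_poly_neq0 fA.
  move=> w hw nA; have := H w hw nA.
  rewrite pE mevalD mevalM cubic_form_chart hw subrr mul0r add0r normal_form_chart.
  rewrite (sum_even_odd _ (fun j => (digit d c j).[w ord0 0])) hw => E.
  rewrite -[RHS]E !horner_sum; congr (_ + _ * _); apply: eq_bigr => k _;
    by rewrite hornerM horner_exp.
move=> i3 ijd.
have dj : digit d c j = 0.
  have hj : (j./2 < d.+1)%N by lia.
  rewrite -(odd_double_half j); case: (odd j) => /=.
    exact: (@expansion_eq0 _ (fun k => digit d c k.*2.+1) (fun k => size_digit _ _ _) o0).
  exact: (@expansion_eq0 _ (fun k => digit d c k.*2) (fun k => size_digit _ _ _) e0).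
have := congr1 (fun p : {poly algC} => p`_i) dj.
rewrite coef0 coef_sum (bigD1 (Ordinal i3)) //= coefZ coefXn eqxx mulr1.
rewrite big1 ?addr0 // => k /andP[_ ki]; rewrite coefZ coefXn.
rewrite [_ == _](_ : _ = false) ?mulr0 //.
by apply: contraNF ki => /eqP e; apply/eqP/val_inj.
Qed.
End PlaneCubic.
(** * Weierstrass curves as smooth projective models *)

Section WeierstrassCurve.
Local Open Scope ring_scope.
Local Open Scope classical_set_scope.

Variables (b2 b4 b6 : rat).
Local Notation E := (Weierstrass 0%R b2 0%R b4 b6).
Local Notation a2 := (ratr b2 : algC).
Local Notation a4 := (ratr b4 : algC).
Local Notation a6 := (ratr b6 : algC).
Local Notation W := (cubic_form a2 a4 a6).
Local Notation f := (cubic_poly a2 a4 a6).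
Local Notation u2 := (unchart (2 : 'I_3)).

Lemma cubic_formE (v : 'rV[algC]_3) : evalpt W v =
  v ord0 1 ^+ 2 * v ord0 2 - v ord0 0 ^+ 3 - a2 * v ord0 0 ^+ 2 * v ord0 2
  - a4 * v ord0 0 * v ord0 2 ^+ 2 - a6 * v ord0 2 ^+ 3.
Proof. by rewrite /cubic_form !(mevalB, mevalM, mevalC, rmorphXn) /= !mevalXU. Qed.

Lemma wcurveE : wcurve E = proj_zeros [set` [:: W]].
Proof.
apply/seteqP; split=> v [v0 H]; split=> //.
  move=> p; rewrite /= inE => /eqP ->.
  move: H; rewrite /= rmorph0 cubic_formE => H.
  by apply: (eq_of_multiple (k := 1) H); ring.
have {}H : evalpt W v = 0 by apply: H; rewrite /= inE.
rewrite /= rmorph0; apply: (eq_of_multiple (k := 1) H).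
by rewrite cubic_formE; ring.
Qed.

Lemma in_wcurve (v : 'rV[algC]_3) : wcurve E v <-> v != 0 /\ evalpt W v = 0.
Proof.
rewrite wcurveE; split=> [[v0 H]|[v0 H]]; split=> //; first by apply: H; rewrite /= inE.
by move=> p; rewrite /= inE => /eqP ->.
Qed.

Lemma wcurve_chart (v : 'rV[algC]_3) : v ord0 2 != 0 ->
  wcurve E v <-> double_cover f (chart (2 : 'I_3) v).
Proof.
move=> v2; have v0 : v != 0 by apply: contraNneq v2 => ->; rewrite mxE.
rewrite in_wcurve (evalpt_chart (cubic_form_homog _ _ _) v2) cubic_form_chart.
rewrite /double_cover /=; split=> [[_ /eqP]|->]; last by rewrite subrr mulr0.
by rewrite mulf_eq0 expf_eq0 /= (negPf v2) subr_eq0 => /eqP.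
Qed.

Lemma wcurve_affine_part : affine_part (2 : 'I_3) (double_cover f) (wcurve E).
Proof.
split; [by move=> v /in_wcurve[] | exact: wcurve_chart |].
move=> d p hp A fA H v /in_wcurve[_ Wv].
by have [q -> _] := form_vanishing hp fA H; rewrite mevalM Wv mul0r.
Qed.

Lemma wcurve_unchart w : double_cover f w -> wcurve E (u2 w).
Proof.
move=> hw; apply/wcurve_chart; first by rewrite unchart_h oner_neq0.
by rewrite -[X in chart _ X]scale1r chart_scale ?oner_neq0.
Qed.

(** f has odd degree, hence is not a square in the field of rational
    functions. *)
Lemma norm_eq0 (a b : {poly algC}) : a ^+ 2 = b ^+ 2 * f -> a = 0 /\ b = 0.
Proof.
have f0 := cubic_poly_neq0 a2 a4 a6; have sf := size_cubic_poly a2 a4 a6.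
have [->|b0] := eqVneq b 0.
  by rewrite expr0n mul0r => /eqP; rewrite sqrf_eq0 => /eqP.
have [->|a0] := eqVneq a 0.
  by rewrite expr0n => /esym/eqP; rewrite mulf_eq0 sqrf_eq0 (negPf b0) (negPf f0).
move/(congr1 (fun p : {poly algC} => size p)); rewrite !expr2 !size_mul ?mulf_neq0 // sf.
move: a0 b0; rewrite -!size_poly_gt0; case: (size a) => // m _; case: (size b) => // k _.
by lia.
Qed.

(** A form p that is not zero on the curve restricts to a + b y with nonzero
    norm a^2 - b^2 f.  If the curve were covered by two closed sets not
    containing it, the product of two such norms would vanish at every x. *)
Lemma wcurve_irreducible : geom_irreducible (wcurve E).
Proof.
split.
  exists (u2 (pt2 0 (sqrtC f.[0]))); apply: wcurve_unchart.
  by apply/double_coverE; rewrite sqrtCK.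
have sep (B : set 'rV[algC]_3) : proj_closed predT B -> ~ wcurve E `<=` B ->
    exists p (a b : {poly algC}), [/\ forall v, B v -> evalpt p v = 0,
      forall w, double_cover f w -> evalpt p (u2 w) = a.[w ord0 0] + b.[w ord0 0] * w ord0 1 &
      a ^+ 2 - b ^+ 2 * f != 0].
  move=> [T hT ->] /existsNP[v /not_implyP[Ev nZ]].
  have [p Tp pv] : exists2 p, T p & evalpt p v <> 0.
    apply: contrapT => nex; apply: nZ; split; first by case/in_wcurve: Ev.
    by move=> p Tp; apply: contrapT => pv; apply: nex; exists p.
  have [[d hp] _] := hT p Tp.
  have [a [b ab]] := polyfun_double_cover f (mpoly_polyfun p (polyfun_unchart (2 : 'I_3))).
  exists p, a, b; split=> //; first by move=> w [_]; apply.
  rewrite subr_eq0; apply/eqP => /norm_eq0[a0 b0]; apply: pv.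
  have [_ _ ] := wcurve_affine_part; move/(_ d p hp set0 (finite_set0 _)); apply=> // w hw _.
  by rewrite ab // a0 b0 !horner0 mul0r addr0.
move=> Y Z hY hZ sub; apply: contrapT => /not_orP[nY nZ].
have [p [a [b [pY pE /negP]]]] := sep _ hY nY.
have [q [c [d [qZ qE]]]] := sep _ hZ nZ.
move=> N2 N1; pose N := (a ^+ 2 - b ^+ 2 * f) * (c ^+ 2 - d ^+ 2 * f).
have : N = 0.
  apply: (poly_cofinite_eq0 (finite_set0 _)) => x _.
  pose y := sqrtC f.[x]; have yE : f.[x] = y ^+ 2 by rewrite sqrtCK.
  have hw : double_cover f (pt2 x y) by apply/double_coverE; rewrite yE.
  have NE (g h : {poly algC}) : (g ^+ 2 - h ^+ 2 * f).[x] = (g.[x] + h.[x] * y) * (g.[x] - h.[x] * y).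
    rewrite hornerD hornerN (hornerM (h ^+ 2)) yE !expr2 (hornerM g) (hornerM h) -expr2.
    have R (s t z : algC) : s * s - t * t * z ^+ 2 = (s + t * z) * (s - t * z) by ring.
    exact: R.
  rewrite /N hornerM !NE; have := pE _ hw; have := qE _ hw; rewrite !pt2E => <- <-.
  by case: (sub _ (wcurve_unchart hw)) => [/pY|/qZ] ->; rewrite ?mul0r ?mulr0.
by move/eqP; rewrite mulf_eq0 (negPf N2) orbF => /N1.
Qed.

(** The ideal in degree d is W times the forms of degree d - 3, so that the
    Hilbert function is the difference of two binomials, 3d for d >= 3. *)
Lemma wcurve_genus1 : curve_with_arithmetic_genus (wcurve E) 1.
Proof.
exists 3%N, 3%N; split=> // d d3.
have hM (q : dhomog 3 algC (d - 3)) : W * (q : {mpoly algC[3]}) \is d.-homog.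
  have := dhomogM (cubic_form_homog a2 a4 a6) (dhomog_is_dhomog q).
  by rewrite subnKC.
pose M q : dhomog 3 algC d := DHomog (hM q).
have linM : linear M by move=> c p q; apply: val_inj; rewrite /= mulrDr scalerAr.
pose mM := GRing.isLinear.Build _ _ _ _ M linM.
pose LM : {linear dhomog 3 algC (d - 3) -> dhomog 3 algC d} := HB.pack M mM.
have W0 : W != 0.
  apply/eqP => W0; have := cubic_form_chart a2 a4 a6 (pt2 0 (sqrtC (f.[0] + 1))).
  rewrite W0 meval0 !pt2E sqrtCK => /esym/eqP.
  by rewrite [_ + 1]addrC addrK (negPf (oner_neq0 _)).
have ker0 : lker (linfun LM) == 0%VS.
  apply/lker0P => p q; rewrite !lfunE /= => /(congr1 val) /= /(mulfI W0) e.
  exact: val_inj.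
have dimI : \dim (limg (linfun LM)) = 'C(d - 3 + 2, d - 3).
  by rewrite limg_dim_eq ?(eqP ker0) ?capv0 // dimvf.
exists (3 * d)%N; last by rewrite mulnC.
exists (limg (linfun LM)).
  move=> p; split.
    move=> /memv_imgP[q _ ->] v /in_wcurve[_ Wv].
    by rewrite lfunE /= mevalM Wv mul0r.
  move=> H; have [||q pE hq] := @form_vanishing a2 a4 a6 d p set0 (dhomog_is_dhomog p).
  - exact: finite_set0.
  - by move=> w hw _; apply/H/wcurve_unchart.
  apply/memv_imgP; exists (DHomog hq); rewrite ?memvf // lfunE /=.
  by apply: val_inj.
have dimD e : 'C(e + 2, e) = 'C(e + 2, 2) by rewrite -[RHS]bin_sub ?addnK //; lia.
have dimV : \dim {: dhomog 3 algC d} = 'C(d + 2, d) by rewrite dimvf.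
rewrite dimI dimV !dimD.
have [e dE] : exists e, d = e.+3 by exists (d - 3)%N; lia.
rewrite dE (_ : e.+3 - 3 = e)%N; last by lia.
by rewrite !addn2 !binS !bin1 !bin0; lia.
Qed.

Hypothesis disc : is_elliptic E.

Lemma mderivXU n (i j : 'I_n) : ('X_i : {mpoly algC[n]})^`M(j) = (i == j)%:R.
Proof.
rewrite mderivX mnm1E; case: eqP => [->|_]; last by rewrite scale0r.
by rewrite scale1r (_ : (_ - _)%MM = 0%MM) ?mpolyX0 //; apply/mnmP => k; rewrite mnmBE subnn mnm0E.
Qed.

(** A singular point with z <> 0 would give a common root x / z of f and its
    derivative; a4 and a6 are then determined by x / z and a2, and make the
    discriminant vanish.  The only point with z = 0 is (0 : 1 : 0),
    where the derivative with respect to z is 1. *)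
Lemma wcurve_smooth : smooth_projective_curve_over_Q (wcurve E) 1.
Proof.
split; [exact: wcurve_irreducible | exact: wcurve_genus1 |].
exists [:: W]; split; last 1 first.
- move=> v /in_wcurve[v0 Wv].
  suff J0 : jacobian [:: W] v != 0.
    have : (\rank (jacobian [:: W] v) <= 1)%N by apply: rank_leq_row.
    have : \rank (jacobian [:: W] v) != 0%N by rewrite mxrank_eq0.
    by case: (\rank _) => [|[|r]].
  apply: contra_neq v0 => J0.
  have D (j : 'I_3) : evalpt (W^`M(j)) v = 0.
    by have /matrixP/(_ ord0 j) := J0; rewrite !mxE.
  move: Wv (D 0) (D 1) (D 2); rewrite cubic_formE.
  rewrite /cubic_form !exprS !expr0 !mulr1.
  rewrite !(mderivB, mderivM, mderivC, mderivXU) /=.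
  rewrite !(mevalB, mevalD, mevalM, mevalC, mevalXU, meval0, meval1).
  set x := v ord0 0; set y := v ord0 1; set z := v ord0 2 => E0 E1 E2 E3.
  have Hx : 3 * x ^+ 2 + 2 * a2 * x * z + a4 * z ^+ 2 = 0.
    by apply: (eq_of_multiple (k := -1) E1); ring.
  have Hy : 2 * y * z = 0 by apply: (eq_of_multiple (k := 1) E2); ring.
  have Hz : y ^+ 2 = a2 * x ^+ 2 + 2 * a4 * x * z + 3 * a6 * z ^+ 2.
    by apply: (eq_of_multiple (k := 1) E3); ring.
  have [z0|z0] := eqVneq z 0.
    have x0 : x = 0.
      move: Hx; rewrite z0 => /eqP.
      rewrite !(mulr0, addr0, expr0n) mulf_eq0 pnatr_eq0 expf_eq0 /=.
      by move/eqP.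
    have y0 : y = 0.
      move: Hz; rewrite z0 x0 !(mulr0, addr0, expr0n) => /eqP.
      by rewrite expf_eq0 => /eqP.
    apply/rowP => j; rewrite mxE; case: j => [[|[|[|//]]]] hj.
    - by rewrite -[RHS]x0; congr (v _ _); apply: val_inj.
    - by rewrite -[RHS]y0; congr (v _ _); apply: val_inj.
    - by rewrite -[RHS]z0; congr (v _ _); apply: val_inj.
  have y0 : y = 0.
    by move/eqP: Hy; rewrite !mulf_eq0 pnatr_eq0 (negPf z0) orbF /= => /eqP.
  have H4 : a4 = - (3 * (x / z) ^+ 2 + 2 * a2 * (x / z)).
    apply: (mulIf (expf_neq0 2 z0)); apply: (eq_of_multiple (k := 1) Hx).
    by field.
  have H6 : a6 = - ((x / z) ^+ 3 + a2 * (x / z) ^+ 2 + a4 * (x / z)).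
    apply: (mulIf (expf_neq0 3 z0)); apply: (eq_of_multiple (k := -1) E0).
    by rewrite y0; field.
  have : ratr (wdisc E) != 0 :> algC by rewrite fmorph_eq0.
  suff -> : ratr (wdisc E) = 0 :> algC by rewrite eqxx.
  have -> : ratr (wdisc E) = 16 * (a2 ^+ 2 * a4 ^+ 2 - 4 * a4 ^+ 3
      - 4 * a2 ^+ 3 * a6 - 27 * a6 ^+ 2 + 18 * a2 * a4 * a6) :> algC.
    by rewrite /wdisc /=; ring.
  by rewrite H6 H4; ring.
- move=> p; rewrite inE => /eqP ->; split; first by exists 3%N; exact: cubic_form_homog.
  rewrite /cubic_form !(rpredB, rpredM, rpredX) ?mpolyOverC ?mpolyOverX ?Crat_rat //.
- exact: wcurveE.
Qed.

End WeierstrassCurve.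
(** * A quartic with a rational point and its jacobian *)

Section QuarticIdentities.
Local Open Scope ring_scope.
Variables (F : numFieldType) (w0 c1 c2 c3 c4 : F).
Hypothesis w00 : w0 != 0.

(** The maps below are the classical ones between w^2 = Q(u), where Q(0) is the
    square of w0, and its jacobian y^2 = f(x); they send the point (0, w0) to
    the point at infinity of the cubic. *)
Definition quartic_value u := w0 ^+ 2 + c1 * u + c2 * u ^+ 2 + c3 * u ^+ 3 + c4 * u ^+ 4.
Definition cubic_value x :=
  x ^+ 3 + c2 * x ^+ 2 + (c1 * c3 - 4 * w0 ^+ 2 * c4) * x
  + (w0 ^+ 2 * c3 ^+ 2 + c1 ^+ 2 * c4 - 4 * w0 ^+ 2 * c2 * c4).

Definition to_cubic_x u w := (2 * w0 * (w + w0) + c1 * u) / u ^+ 2.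
Definition to_cubic_y u w :=
  (4 * w0 ^+ 2 * (w + w0) + 2 * w0 * (c1 * u + c2 * u ^+ 2)
   + c1 * u * (w + w0) + w0 * c3 * u ^+ 3) / u ^+ 3.
Definition to_quartic_num x := 4 * w0 ^+ 2 * (x + c2) - c1 ^+ 2.
Definition to_quartic_den x y := 2 * w0 * y - c1 * x - 2 * w0 ^+ 2 * c3.
Definition to_quartic_u x y := to_quartic_num x / to_quartic_den x y.
Definition to_quartic_w x y :=
  (to_quartic_num x * (to_quartic_num x * x - c1 * to_quartic_den x y)
   - 2 * w0 ^+ 2 * to_quartic_den x y ^+ 2) / (2 * w0 * to_quartic_den x y ^+ 2).
(** Its zeros form the parabola that osculates the quartic at (0, - w0). *)
Definition tangency u w :=
  8 * w0 ^+ 3 * (w + w0) + 4 * w0 ^+ 2 * (c1 * u + c2 * u ^+ 2) - c1 ^+ 2 * u ^+ 2.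

Lemma to_cubic_on u w : u != 0 -> w ^+ 2 = quartic_value u ->
  to_cubic_y u w ^+ 2 = cubic_value (to_cubic_x u w).
Proof.
move=> u0 h; apply: (mulIf (expf_neq0 6 u0)).
have -> : to_cubic_y u w ^+ 2 * u ^+ 6 =
   (4 * w0 ^+ 2 * (w + w0) + 2 * w0 * (c1 * u + c2 * u ^+ 2)
   + c1 * u * (w + w0) + w0 * c3 * u ^+ 3) ^+ 2.
  by rewrite /to_cubic_y; field.
have -> : cubic_value (to_cubic_x u w) * u ^+ 6 =
  (2 * w0 * (w + w0) + c1 * u) ^+ 3 + c2 * u ^+ 2 * (2 * w0 * (w + w0) + c1 * u) ^+ 2
  + (c1 * c3 - 4 * w0 ^+ 2 * c4) * u ^+ 4 * (2 * w0 * (w + w0) + c1 * u)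
  + (w0 ^+ 2 * c3 ^+ 2 + c1 ^+ 2 * c4 - 4 * w0 ^+ 2 * c2 * c4) * u ^+ 6.
  by rewrite /cubic_value /to_cubic_x; field.
move: h; rewrite /quartic_value => h.
apply: (eq_of_multiple (k := - (8 * w0 ^+ 3 * (w + w0) + 4 * w0 ^+ 2 * c1 * u
   + 4 * w0 ^+ 2 * c2 * u ^+ 2 - c1 ^+ 2 * u ^+ 2)) h).
ring.
Qed.

Lemma to_quartic_den_to_cubic u w : u != 0 ->
  to_quartic_den (to_cubic_x u w) (to_cubic_y u w) = tangency u w / u ^+ 3.
Proof.
by move=> u0; rewrite /to_quartic_den /to_cubic_x /to_cubic_y /tangency; field.
Qed.

Lemma to_quartic_num_to_cubic u w : u != 0 ->
  to_quartic_num (to_cubic_x u w) = tangency u w / u ^+ 2.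
Proof. by move=> u0; rewrite /to_quartic_num /to_cubic_x /tangency; field. Qed.

Lemma to_cubicK u w : u != 0 -> tangency u w != 0 ->
  to_quartic_u (to_cubic_x u w) (to_cubic_y u w) = u /\
  to_quartic_w (to_cubic_x u w) (to_cubic_y u w) = w.
Proof.
move=> u0 t0; rewrite /to_quartic_u /to_quartic_w.
rewrite to_quartic_den_to_cubic // to_quartic_num_to_cubic //.
move: t0; set t := tangency u w => t0; rewrite /to_cubic_x; split; first by field; rewrite u0 t0.
by field; rewrite u0 w00 t0.
Qed.

Lemma to_quarticK x y : to_quartic_num x != 0 -> to_quartic_den x y != 0 ->
  to_cubic_x (to_quartic_u x y) (to_quartic_w x y) = x /\
  to_cubic_y (to_quartic_u x y) (to_quartic_w x y) = y.
Proof.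
move=> n0 d0.
have c2E : c2 = (to_quartic_num x + c1 ^+ 2) / (4 * w0 ^+ 2) - x.
  by rewrite /to_quartic_num; field.
have yE : y = (to_quartic_den x y + c1 * x + 2 * w0 ^+ 2 * c3) / (2 * w0).
  by rewrite /to_quartic_den; field.
rewrite /to_cubic_x /to_cubic_y /to_quartic_u /to_quartic_w.
split; first by field; rewrite d0 n0 w00.
rewrite [RHS]yE c2E.
move: n0 d0; set n := to_quartic_num x; set d := to_quartic_den x y => n0 d0.
by field; rewrite d0 n0 w00.
Qed.

Lemma to_quartic_on x y : to_quartic_den x y != 0 ->
  y ^+ 2 = cubic_value x ->
  to_quartic_w x y ^+ 2 = quartic_value (to_quartic_u x y).
Proof.
move=> d0 h.
pose n := to_quartic_num x; pose d := to_quartic_den x y.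
have d0' : d != 0 by [].
apply: (mulIf (expf_neq0 4 d0')); apply: (mulIf (expf_neq0 2 w00)).
have -> : to_quartic_w x y ^+ 2 * d ^+ 4 * w0 ^+ 2 =
  (n * (n * x - c1 * d) - 2 * w0 ^+ 2 * d ^+ 2) ^+ 2 / 4.
  by rewrite /to_quartic_w -/n -/d; field; rewrite d0' w00.
have -> : quartic_value (to_quartic_u x y) * d ^+ 4 * w0 ^+ 2 =
  (w0 ^+ 2 * d ^+ 4 + c1 * n * d ^+ 3 + c2 * n ^+ 2 * d ^+ 2 + c3 * n ^+ 3 * d + c4 * n ^+ 4) * w0 ^+ 2.
  by rewrite /quartic_value /to_quartic_u -/n -/d; field; rewrite d0'.
have E : d ^+ 2 + 2 * (c1 * x + 2 * w0 ^+ 2 * c3) * d + (c1 * x + 2 * w0 ^+ 2 * c3) ^+ 2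
   = 4 * w0 ^+ 2 * cubic_value x.
  by rewrite -h /d /to_quartic_den; ring.
have N : n = 4 * w0 ^+ 2 * (x + c2) - c1 ^+ 2 by [].
move: E; rewrite /cubic_value => E.
by apply: (eq_of_multiple (k := - n ^+ 3 / 4) E); rewrite N; field.
Qed.
End QuarticIdentities.
(** * The birational map from a quartic to its jacobian *)

Section PolynomialTactics.
Local Open Scope ring_scope.
Local Open Scope classical_set_scope.

Lemma Crat1 : 1 \in Crat. Proof. exact: rpred1. Qed.
Lemma Crat_nat n : n%:R \in Crat. Proof. exact: rpred_nat. Qed.

Lemma regular_frac n (U : set 'rV[algC]_n) N D : principal_open U ->
  polyfun Crat N -> polyfun Crat D -> (forall v, U v -> D v != 0) ->
  regular U (fun v => N v / D v).
Proof.
move=> [q hq hU] hN hD D0; exists (fun v => N v * q v), (fun v => D v * q v).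
split; try exact: PolyM.
  move=> v; split=> [/[dup] /D0 d0 /hU q0|]; first by rewrite mulf_neq0.
  by rewrite mulf_eq0 negb_or => /andP[_ /hU].
by move=> v /hU q0; rewrite -mulf_div divff // mulr1.
Qed.

Lemma principal_open2 n (p q : 'rV[algC]_n -> algC) :
  polyfun Crat p -> polyfun Crat q ->
  principal_open [set v | p v != 0 /\ q v != 0].
Proof.
move=> hp hq; exists (fun v => p v * q v); first exact: PolyM.
move=> v; rewrite mulf_eq0 negb_or /=.
by split=> [[-> ->]|/andP[]].
Qed.
End PolynomialTactics.

Ltac prove_polyfun := repeat (
  first [ assumption | exact: PolyX | apply: PolyC; first [exact: Crat1 | exact: Crat_nat | exact: Crat_rat]
        | apply: PolyD | apply: PolyN | apply: PolyM | apply: polyfunXn; first exact: Crat1 ]).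

Section QuarticBirational.
Local Open Scope ring_scope.
Local Open Scope classical_set_scope.
Variables (w0 c1 c2 c3 c4 : rat).
Hypothesis w00 : w0 != 0.
Hypothesis hk : 64 * w0 ^+ 6 * c4 != (4 * w0 ^+ 2 * c2 - c1 ^+ 2) ^+ 2.

Definition quartic_a4 := c1 * c3 - 4 * w0 ^+ 2 * c4.
Definition quartic_a6 := w0 ^+ 2 * c3 ^+ 2 + c1 ^+ 2 * c4 - 4 * w0 ^+ 2 * c2 * c4.

Definition quartic_poly : {poly algC} :=
  (ratr w0 ^+ 2)%:P + ratr c1 *: 'X + ratr c2 *: 'X^2 + ratr c3 *: 'X^3 + ratr c4 *: 'X^4.

Lemma quartic_polyE x : quartic_poly.[x] =
  quartic_value (ratr w0) (ratr c1) (ratr c2) (ratr c3) (ratr c4) x.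
Proof. by rewrite /quartic_poly !(hornerD, hornerZ, hornerC, hornerXn, hornerX). Qed.

Lemma quartic_cubicE x :
  (cubic_poly (ratr c2) (ratr quartic_a4) (ratr quartic_a6)).[x] =
  cubic_value (ratr w0) (ratr c1) (ratr c2) (ratr c3) (ratr c4) x.
Proof.
by rewrite cubic_polyE /quartic_a4 /quartic_a6 /cubic_value; ring.
Qed.

Local Notation W0 := (ratr w0 : algC).
Local Notation C1 := (ratr c1 : algC).
Local Notation C2 := (ratr c2 : algC).
Local Notation C3 := (ratr c3 : algC).
Local Notation C4 := (ratr c4 : algC).

Let W00 : W0 != 0. Proof. by rewrite fmorph_eq0. Qed.

Lemma finite_affine_root (a b : algC) : b != 0 -> finite_set [set x | a + b * x = 0].
Proof.
move=> b0; apply: (@sub_finite_set _ _ [set - a / b]); last exact: finite_set1.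
move=> x /= /eqP; rewrite addrC addr_eq0 => /eqP <-.
by rewrite mulrC mulKf.
Qed.

Let W2 : 2 * W0 != 0. Proof. by apply: mulf_neq0 W00; rewrite pnatr_eq0. Qed.

Let W4 : 4 * W0 ^+ 2 != 0.
Proof. by apply: mulf_neq0 (expf_neq0 2 W00); rewrite pnatr_eq0. Qed.

Lemma regular_to_cubic (U : set 'rV[algC]_2) : principal_open U ->
  (forall v : 'rV[algC]_2, U v -> v ord0 0 != 0) ->
  forall i, regular U (fun v =>
    pt2 (to_cubic_x W0 C1 (v ord0 0) (v ord0 1))
        (to_cubic_y W0 C1 C2 C3 (v ord0 0) (v ord0 1)) ord0 i).
Proof.
move=> oU u0.
have r k (N : 'rV[algC]_2 -> algC) : polyfun Crat N ->
    regular U (fun v => N v / v ord0 0 ^+ k).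
  move=> hN; apply: (regular_frac oU hN); first by prove_polyfun.
  by move=> v Uv; rewrite expf_neq0 ?u0.
case=> [[|[|//]]] hi.
  apply: eq_regular (r 2%N (fun v => 2 * W0 * (v ord0 1 + W0) + C1 * v ord0 0) _) _.
    by prove_polyfun.
  by move=> v _; rewrite mxE.
apply: eq_regular (r 3%N (fun v => 4 * W0 ^+ 2 * (v ord0 1 + W0)
  + 2 * W0 * (C1 * v ord0 0 + C2 * v ord0 0 ^+ 2)
  + C1 * v ord0 0 * (v ord0 1 + W0) + W0 * C3 * v ord0 0 ^+ 3) _) _.
  by prove_polyfun.
by move=> v _; rewrite mxE.
Qed.

Local Notation num v := (to_quartic_num W0 C1 C2 (v ord0 0)).
Local Notation den v := (to_quartic_den W0 C1 C3 (v ord0 0) (v ord0 1)).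

Let polyfun_num : polyfun Crat (fun v : 'rV[algC]_2 => num v).
Proof. by rewrite /to_quartic_num; prove_polyfun. Qed.

Let polyfun_den : polyfun Crat (fun v : 'rV[algC]_2 => den v).
Proof. by rewrite /to_quartic_den; prove_polyfun. Qed.

Lemma regular_to_quartic (V : set 'rV[algC]_2) : principal_open V ->
  (forall v : 'rV[algC]_2, V v -> den v != 0) ->
  forall i, regular V (fun v =>
    pt2 (to_quartic_u W0 C1 C2 C3 (v ord0 0) (v ord0 1))
        (to_quartic_w W0 C1 C2 C3 (v ord0 0) (v ord0 1)) ord0 i).
Proof.
move=> oV d0.
case=> [[|[|//]]] hi.
  apply: eq_regular (regular_frac oV polyfun_num polyfun_den d0) _.
  by move=> v _; rewrite mxE.
have hN : polyfun Crat (fun v : 'rV[algC]_2 =>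
    num v * (num v * v ord0 0 - C1 * den v) - 2 * W0 ^+ 2 * den v ^+ 2).
  by prove_polyfun.
have hD : polyfun Crat (fun v : 'rV[algC]_2 => 2 * W0 * den v ^+ 2).
  by prove_polyfun.
apply: eq_regular (regular_frac oV hN hD _) _ => v Vv; last by rewrite mxE.
exact: mulf_neq0 W2 (expf_neq0 2 (d0 v Vv)).
Qed.

Local Notation dom_quartic := [set v : 'rV[algC]_2 | v ord0 0 != 0 /\
  tangency W0 C1 C2 (v ord0 0) (v ord0 1) != 0].
Local Notation dom_cubic := [set v : 'rV[algC]_2 | num v != 0 /\ den v != 0].
Local Notation cubic := (cubic_poly C2 (ratr quartic_a4) (ratr quartic_a6)).

(** On the quartic, the tangency and the conjugate expression that belongs to
    - w multiply to a multiple of u^3; so u is zero, or is the fourth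
    intersection of the osculating parabola, which hk makes a single value. *)
Lemma finite_quartic_complement : finite_set (double_cover quartic_poly `\` dom_quartic).
Proof.
pose a := 64 * W0 ^+ 6 * C3 - 8 * W0 ^+ 2 * C1 * (4 * W0 ^+ 2 * C2 - C1 ^+ 2).
pose b := 64 * W0 ^+ 6 * C4 - (4 * W0 ^+ 2 * C2 - C1 ^+ 2) ^+ 2.
have b0 : b != 0.
  have := hk; rewrite -subr_eq0 -(fmorph_eq0 (ratr : {rmorphism rat -> algC})).
  by congr (_ != 0); rewrite /b; ring.
apply: (@sub_finite_set _ _ (double_cover quartic_poly `&`
   [set w | ([set 0] `|` [set x | a + b * x = 0]) (w ord0 0)])); last first.
  apply: finite_double_cover; rewrite finite_setU; split; first exact: finite_set1.
  exact: finite_affine_root.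
move=> v [Cv nU]; split; first exact: Cv.
have [u0|u0] := eqVneq (v ord0 0) 0; [left; exact: u0 | right].
have t0 : tangency W0 C1 C2 (v ord0 0) (v ord0 1) = 0.
  by apply/eqP; apply: contrapT => /negP t0; exact: (nU (conj u0 t0)).
move: Cv; rewrite /double_cover /= quartic_polyE /quartic_value => Cv.
apply: (mulIf (expf_neq0 3 u0)); rewrite mul0r.
rewrite [RHS](_ : 0 = 64 * W0 ^+ 6 * (v ord0 1 ^+ 2 - v ord0 1 ^+ 2)
   - tangency W0 C1 C2 (v ord0 0) (v ord0 1) *
   (tangency W0 C1 C2 (v ord0 0) (v ord0 1) - 16 * W0 ^+ 3 * v ord0 1)); last by rewrite t0; ring.
by rewrite {1}Cv /a /b /tangency; ring.
Qed.

(** Points of the cubic where the denominator is zero, and not the numerator,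
    lie over x = 2 w0 sqrt(c4) or x = - 2 w0 sqrt(c4): they are the images of
    the points of the quartic at infinity. *)
Lemma finite_cubic_complement : finite_set (double_cover cubic `\` dom_cubic).
Proof.
apply: (@sub_finite_set _ _ (double_cover cubic `&`
   [set w | ([set x | to_quartic_num W0 C1 C2 x = 0] `|`
      [set x | (x - 2 * W0 * sqrtC C4) * (x + 2 * W0 * sqrtC C4) = 0]) (w ord0 0)])); last first.
  apply: finite_double_cover; rewrite finite_setU; split.
    apply: (@sub_finite_set _ _ [set x | (4 * W0 ^+ 2 * C2 - C1 ^+ 2) + 4 * W0 ^+ 2 * x = 0]).
      by move=> x /=; rewrite /to_quartic_num => <-; ring.
    exact: (finite_affine_root _ W4).
  apply: (@sub_finite_set _ _ ([set 2 * W0 * sqrtC C4] `|` [set - (2 * W0 * sqrtC C4)])).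
    move=> x /= /eqP; rewrite mulf_eq0 subr_eq0 addr_eq0 => /orP[/eqP|/eqP] ?; [left|right]; assumption.
  by rewrite finite_setU; split; exact: finite_set1.
move=> v [Ev nV]; split; first exact: Ev.
have [n0|n0] := eqVneq (num v) 0; [left; exact: n0|right].
have d0 : to_quartic_den W0 C1 C3 (v ord0 0) (v ord0 1) = 0.
  by apply/eqP; apply: contrapT => /negP d0; exact: (nV (conj n0 d0)).
move: Ev; rewrite /double_cover /= quartic_cubicE /cubic_value => Ev.
apply: (mulfI n0); rewrite mulr0.
rewrite [RHS](_ : 0 = 4 * W0 ^+ 2 * (v ord0 1 ^+ 2 - v ord0 1 ^+ 2)
   + to_quartic_den W0 C1 C3 (v ord0 0) (v ord0 1) *
   (2 * W0 * v ord0 1 + C1 * v ord0 0 + 2 * W0 ^+ 2 * C3)); last by rewrite d0; ring.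
rewrite {1}Ev /to_quartic_num /to_quartic_den.
rewrite (_ : (_ - _) * (_ + _) = v ord0 0 ^+ 2 - 4 * W0 ^+ 2 * sqrtC C4 ^+ 2); last by ring.
by rewrite sqrtCK; ring.
Qed.

Lemma quartic_birational :
  affine_birational (double_cover quartic_poly) (double_cover cubic).
Proof.
have oU : principal_open dom_quartic.
  by apply: principal_open2; rewrite /tangency; prove_polyfun.
have oV : principal_open dom_cubic by apply: principal_open2.
exists dom_quartic, dom_cubic,
  (fun v => pt2 (to_cubic_x W0 C1 (v ord0 0) (v ord0 1))
                (to_cubic_y W0 C1 C2 C3 (v ord0 0) (v ord0 1))),
  (fun v => pt2 (to_quartic_u W0 C1 C2 C3 (v ord0 0) (v ord0 1))
                (to_quartic_w W0 C1 C2 C3 (v ord0 0) (v ord0 1))).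
split.
- by split; split; [|apply: regular_to_cubic oU _ => v [] | |
                    apply: regular_to_quartic oV _ => v []].
- exact: (conj finite_quartic_complement finite_cubic_complement).
- move=> v Cv [u0 t0]; move: Cv; rewrite /double_cover /= quartic_polyE => Cv.
  have [e1 e2] := to_cubicK C3 W00 u0 t0.
  split.
  + apply/double_coverE; rewrite quartic_cubicE; exact: to_cubic_on.
  + have ui k : (v ord0 0 ^- k) != 0 by rewrite invr_eq0; exact: expf_neq0.
    rewrite /= !pt2E (to_quartic_num_to_cubic _ _ _ _ u0).
    rewrite (to_quartic_den_to_cubic _ _ _ _ _ u0).
    by split; exact: mulf_neq0 t0 (ui _).
  + by rewrite !pt2E e1 e2 -pt2_eta.
- move=> v Ev [n0 d0]; move: Ev; rewrite /double_cover /= quartic_cubicE => Ev.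
  have [e1 e2] := to_quarticK W00 n0 d0.
  have u0 : to_quartic_u W0 C1 C2 C3 (v ord0 0) (v ord0 1) != 0.
    by rewrite /to_quartic_u mulf_neq0 ?invr_eq0.
  split.
  + by apply/double_coverE; rewrite quartic_polyE; exact: to_quartic_on Ev.
  + rewrite /= !pt2E; split; first exact: u0.
    have := to_quartic_den_to_cubic W0 C1 C2 C3 (to_quartic_w W0 C1 C2 C3 (v ord0 0) (v ord0 1)) u0.
    rewrite e1 e2 => dE; move: d0; rewrite dE mulf_eq0 negb_or => /andP[]//.
  + by rewrite !pt2E e1 e2 -pt2_eta.
Qed.
End QuarticBirational.
(** * Pullback of a parametrized rational curve *)

Section RationalCurvePullback.
Local Open Scope ring_scope.
Local Open Scope classical_set_scope.

Definition pt3 (x y z : algC) : 'rV[algC]_3 := \row_i [:: x; y; z]`_i.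

Lemma pt3_eta (v : 'rV[algC]_3) : v = pt3 (v ord0 0) (v ord0 1) (v ord0 2).
Proof.
apply/rowP => i; rewrite mxE.
by case: i => [[|[|[|//]]]] h /=; congr (v _ _); exact: val_inj.
Qed.

Lemma pt3E x y z :
  (pt3 x y z ord0 0 = x) * (pt3 x y z ord0 1 = y) * (pt3 x y z ord0 2 = z).
Proof. by rewrite !mxE. Qed.

Lemma proj_rtE v : (proj_rt v ord0 0 = v ord0 0) * (proj_rt v ord0 1 = v ord0 1).
Proof. by split; rewrite mxE; congr (v _ _); exact: val_inj. Qed.

Definition quartic_product (r t : algC) : algC :=
  (1 + r - 2 * r ^+ 2 * t - t ^+ 2 + r * t ^+ 2) *
  (- 1 + r + 2 * r ^+ 2 * t + t ^+ 2 + r * t ^+ 2) *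
  (- r - r ^+ 2 - 2 * t - r * t ^+ 2 + r ^+ 2 * t ^+ 2) *
  (r - r ^+ 2 - 2 * t + r * t ^+ 2 + r ^+ 2 * t ^+ 2).

Definition polyfun1 (R : algC -> algC) : Prop :=
  polyfun Crat (fun v : 'rV[algC]_1 => R (v ord0 ord0)).

Lemma polyfun1_comp R n (F : 'rV[algC]_n -> algC) :
  polyfun1 R -> polyfun Crat F -> polyfun Crat (fun v => R (F v)).
Proof.
move=> hR hF; apply: (@eq_polyfun _ _ (fun v => R ((const_mx (F v) : 'rV_1) ord0 ord0))).
  by apply: (polyfun_comp hR) => i; apply: (eq_polyfun hF) => v; rewrite mxE.
by move=> v; rewrite mxE.
Qed.

Lemma polyfunT S n (F : 'rV[algC]_n -> algC) : polyfun S F -> polyfun predT F.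
Proof.
elim => {F} [c _|i|F G _ h _ k|F _ h|F G _ h _ k].
- exact: PolyC.
- exact: PolyX.
- exact: PolyD.
- exact: PolyN.
- exact: PolyM.
Qed.

Lemma polyfun1_poly R : polyfun1 R -> exists p : {poly algC}, forall x, R x = p.[x].
Proof.
have key F : polyfun Crat F ->
    exists p : {poly algC}, forall v : 'rV[algC]_1, F v = p.[v ord0 ord0].
  elim => {F} [c _|i|F G _ [p h] _ [q k]|F _ [p h]|F G _ [p h] _ [q k]].
  - by exists c%:P => v; rewrite hornerC.
  - by exists 'X => v; rewrite hornerX; congr (v _ _); apply: val_inj; case: i => [[]].
  - by exists (p + q) => v; rewrite h k hornerD.
  - by exists (- p) => v; rewrite h hornerN.
  - by exists (p * q) => v; rewrite h k hornerM.
by move=> /key[p pE]; exists p => x; have := pE (const_mx x); rewrite !mxE.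
Qed.

Lemma finite_zeros R u : polyfun1 R -> R u != 0 -> finite_set [set x | R x = 0].
Proof.
move=> /polyfun1_poly[p pE] Ru; have p0 : p != 0.
  by apply: contraNneq Ru => p0; rewrite pE p0 horner0.
by apply: (sub_finite_set _ (finite_root_set p0)) => x /=; rewrite pE.
Qed.

Variables (D : set 'rV[algC]_2) (Q : {poly algC}).
Variables (R0 R1 T0 T1 K0 K1 L : algC -> algC) (M0 M1 : algC -> algC -> algC).

Local Notation pr u := (R1 u / R0 u).
Local Notation pt u := (T1 u / T0 u).

(** A rational parametrization (r, t) = (R1/R0, T1/T0) of D with the rational
    inverse u = M1/M0, along which the product of the four factors of S is
    (K1/K0)^2 Q.  The points where M0 = 0 are reached by the parametrization
    (par_surj0), but are not in the domain of its inverse; L controls their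
    parameters. *)
Record parametrization : Prop := Parametrization {
  par_poly : [/\ polyfun1 R0, polyfun1 R1, polyfun1 T0 & polyfun1 T1] /\
             [/\ polyfun1 K0, polyfun1 K1 & polyfun1 L];
  par_inv_poly : polyfun Crat (fun w : 'rV[algC]_2 => M0 (w ord0 0) (w ord0 1)) /\
             polyfun Crat (fun w : 'rV[algC]_2 => M1 (w ord0 0) (w ord0 1));
  par_nonzero : exists u, [/\ R0 u != 0, T0 u != 0, K1 u != 0 & L u != 0];
  par_K0 : forall u, R0 u != 0 -> T0 u != 0 -> K0 u != 0;
  par_on : forall u, R0 u != 0 -> T0 u != 0 -> D (pt2 (pr u) (pt u));
  par_product : forall u, R0 u != 0 -> T0 u != 0 ->
    quartic_product (pr u) (pt u) = (K1 u / K0 u) ^+ 2 * Q.[u];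
  par_inv : forall u, R0 u != 0 -> T0 u != 0 -> M0 (pr u) (pt u) != 0 ->
    M1 (pr u) (pt u) / M0 (pr u) (pt u) = u;
  par_L : forall u, R0 u != 0 -> T0 u != 0 -> M0 (pr u) (pt u) = 0 -> L u = 0;
  par_surj : forall r t, D (pt2 r t) -> M0 r t != 0 -> let u := M1 r t / M0 r t in
    [/\ R0 u != 0, T0 u != 0, pr u = r & pt u = t];
  par_surj0 : forall r t, D (pt2 r t) -> M0 r t = 0 -> exists u,
    [/\ R0 u != 0, T0 u != 0, pr u = r & pt u = t] }.

Hypotheses (P : parametrization) (Q0 : Q != 0).
Local Notation C := (pullback_to_S D).
Local Notation C' := (double_cover Q).

Lemma in_pullback v : C v <->
  D (pt2 (v ord0 0) (v ord0 1)) /\ quartic_product (v ord0 0) (v ord0 1) = v ord0 2 ^+ 2.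
Proof.
have e : proj_rt v = pt2 (v ord0 0) (v ord0 1) by rewrite (pt2_eta (proj_rt v)) !proj_rtE.
rewrite /pullback_to_S /quartic_product -e; split; first by case.
by case.
Qed.

Definition lift_par (w : 'rV[algC]_2) : 'rV[algC]_3 :=
  let u := w ord0 0 in pt3 (pr u) (pt u) (K1 u / K0 u * w ord0 1).

Definition lift_inv (v : 'rV[algC]_3) : 'rV[algC]_2 :=
  let u := M1 (v ord0 0) (v ord0 1) / M0 (v ord0 0) (v ord0 1) in
  pt2 u (v ord0 2 * K0 u / K1 u).

Lemma lift_par_on w : C' w -> R0 (w ord0 0) != 0 -> T0 (w ord0 0) != 0 ->
  C (lift_par w).
Proof.
move=> Cw r0 t0; apply/in_pullback; rewrite !pt3E; split; first exact: par_on P _ r0 t0.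
by rewrite (par_product P r0 t0) [RHS]exprMn Cw.
Qed.

(** Where K1 = 0 the coordinate y of the pullback is zero and does not
    determine w; any square root of Q(u) is then a preimage. *)
Lemma lift_par_surj v : C v -> exists2 w, C' w &
  [/\ R0 (w ord0 0) != 0, T0 (w ord0 0) != 0 & lift_par w = v].
Proof.
move=> /in_pullback[Dv Ev].
have [u [r0 t0 er et]] : exists u,
    [/\ R0 u != 0, T0 u != 0, pr u = v ord0 0 & pt u = v ord0 1].
  have [m0|m0] := eqVneq (M0 (v ord0 0) (v ord0 1)) 0.
    exact: par_surj0 P _ _ Dv m0.
  by eexists; exact: par_surj P _ _ Dv m0.
have k0 := par_K0 P r0 t0; have := par_product P r0 t0; rewrite er et Ev => yE.
have [k1|k1] := eqVneq (K1 u) 0.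
  exists (pt2 u (sqrtC Q.[u])); first by apply/double_coverE; rewrite sqrtCK.
  rewrite !pt2E; split; [exact: r0|exact: t0|].
  rewrite /lift_par !pt2E er et k1 !mul0r [RHS]pt3_eta; congr pt3.
  have : v ord0 2 ^+ 2 == 0 by rewrite yE k1 mul0r expr0n mul0r; exact: eqxx.
  by rewrite sqrf_eq0 => /eqP.
exists (pt2 u (v ord0 2 * K0 u / K1 u)).
  apply/double_coverE; rewrite exprMn exprMn yE; field.
  by rewrite k1 k0.
rewrite !pt2E; split; [exact: r0|exact: t0|].
rewrite /lift_par !pt2E er et [RHS](pt3_eta v); congr pt3; field.
by rewrite k1 k0.
Qed.

Definition dom_inv : set 'rV[algC]_3 :=
  [set v | M0 (v ord0 0) (v ord0 1) != 0] `&`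
  [set v | K1 (M1 (v ord0 0) (v ord0 1) / M0 (v ord0 0) (v ord0 1)) != 0].

Definition dom_par : set 'rV[algC]_2 :=
  [set w | R0 (w ord0 0) * T0 (w ord0 0) * K1 (w ord0 0) != 0] `&`
  [set w | M0 (pr (w ord0 0)) (pt (w ord0 0)) != 0].

Lemma dom_par_neq0 w : dom_par w -> [/\ R0 (w ord0 0) != 0, T0 (w ord0 0) != 0,
  K1 (w ord0 0) != 0 & M0 (pr (w ord0 0)) (pt (w ord0 0)) != 0].
Proof.
case=> /=; rewrite mulf_eq0 negb_or => /andP[]; rewrite mulf_eq0 negb_or => /andP[].
by move=> a b c d; split; assumption.
Qed.

Lemma lift_parK w : C' w -> dom_par w ->
  [/\ C (lift_par w), dom_inv (lift_par w) & lift_inv (lift_par w) = w].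
Proof.
move=> Cw /dom_par_neq0[r0 t0 k1 m0].
have k0 := par_K0 P r0 t0; have e := par_inv P r0 t0 m0.
split; first exact: lift_par_on.
  by split; rewrite /lift_par /= !pt3E ?e; [exact: m0|exact: k1].
rewrite /lift_inv /lift_par !pt3E e [RHS]pt2_eta; congr pt2; field.
by rewrite k1 k0.
Qed.

Lemma lift_invK v : C v -> dom_inv v ->
  [/\ C' (lift_inv v), dom_par (lift_inv v) & lift_par (lift_inv v) = v].
Proof.
move=> /in_pullback[Dv Ev] [/= m0 k1].
have [r0 t0 er et] := par_surj P Dv m0.
have k0 := par_K0 P r0 t0; have := par_product P r0 t0; rewrite er et Ev => yE.
rewrite /lift_inv; move: k1 r0 t0 er et k0 yE; set u := _ / _ => k1 r0 t0 er et k0 yE.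
split.
- apply/double_coverE; rewrite exprMn exprMn yE; field.
  by rewrite k1 k0.
- split; rewrite /= !pt2E; last by rewrite er et; exact: m0.
  exact: mulf_neq0 (mulf_neq0 r0 t0) k1.
- rewrite /lift_par !pt2E er et [RHS]pt3_eta; congr pt3; field.
  by rewrite k1 k0.
Qed.

Lemma polyfun_proj i :
  polyfun Crat (fun v : 'rV[algC]_3 => pt2 (v ord0 0) (v ord0 1) ord0 i).
Proof.
case: i => [[|[|//]]] hi.
  by apply: (eq_polyfun (PolyX _ 0)) => v; rewrite mxE.
by apply: (eq_polyfun (PolyX _ 1)) => v; rewrite mxE.
Qed.

Lemma dom_inv_open : [/\ principal_open dom_inv,
  regular dom_inv (fun v : 'rV[algC]_3 => M1 (v ord0 0) (v ord0 1) / M0 (v ord0 0) (v ord0 1)) &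
  regular dom_inv (fun v : 'rV[algC]_3 =>
    (K1 (M1 (v ord0 0) (v ord0 1) / M0 (v ord0 0) (v ord0 1)))^-1)].
Proof.
have [[_ _ _ _] [_ hK1 _]] := par_poly P; have [hM0 hM1] := par_inv_poly P.
have h0 : polyfun Crat (fun v : 'rV[algC]_3 => M0 (v ord0 0) (v ord0 1)).
  by apply: (eq_polyfun (polyfun_comp hM0 polyfun_proj)) => v; rewrite !pt2E.
have h1 : polyfun Crat (fun v : 'rV[algC]_3 => M1 (v ord0 0) (v ord0 1)).
  by apply: (eq_polyfun (polyfun_comp hM1 polyfun_proj)) => v; rewrite !pt2E.
pose U0 := [set v : 'rV[algC]_3 | M0 (v ord0 0) (v ord0 1) != 0].
have oU0 : principal_open U0 by exists (fun v => M0 (v ord0 0) (v ord0 1)).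
have rm : regular U0 (fun v => M1 (v ord0 0) (v ord0 1) / M0 (v ord0 0) (v ord0 1)).
  exact: regular_frac oU0 h1 h0 _.
have rk : regular U0 (fun v => K1 (M1 (v ord0 0) (v ord0 1) / M0 (v ord0 0) (v ord0 1))).
  have := @polyfun_regular_comp _ _ U0 (fun v =>
    const_mx (M1 (v ord0 0) (v ord0 1) / M0 (v ord0 0) (v ord0 1)) : 'rV_1) oU0 _ _ hK1.
  move=> H; apply: eq_regular (H _) _ => [i|v _]; last by rewrite mxE.
  by apply: eq_regular rm _ => v _; rewrite mxE.
have rV := regularV rk; split; [exact: regular_open rV | | exact: rV].
have := regular_sub rm (regular_open rV).
by rewrite setIA setIid.
Qed.

Lemma regular_lift_inv i : regular dom_inv (fun v => lift_inv v ord0 i).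
Proof.
have [oU rm rk] := dom_inv_open; have [_ [hK0 _ _]] := par_poly P.
case: i => [[|[|//]]] hi.
  by apply: eq_regular rm _ => v _; rewrite mxE.
have rk0 : regular dom_inv (fun v => K0 (M1 (v ord0 0) (v ord0 1) / M0 (v ord0 0) (v ord0 1))).
  have := @polyfun_regular_comp _ _ dom_inv (fun v =>
    const_mx (M1 (v ord0 0) (v ord0 1) / M0 (v ord0 0) (v ord0 1)) : 'rV_1) oU _ _ hK0.
  move=> H; apply: eq_regular (H _) _ => [j|v _]; last by rewrite mxE.
  by apply: eq_regular rm _ => v _; rewrite mxE.
have ry := polyfun_regular oU (PolyX Crat 2).
by apply: eq_regular (regularM (regularM ry rk0) rk) _ => v _; rewrite mxE.
Qed.

Let coord0 R : polyfun1 R -> polyfun Crat (fun w : 'rV[algC]_2 => R (w ord0 0)).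
Proof. by move=> hR; apply: polyfun1_comp hR _; exact: PolyX. Qed.

Lemma dom_par_open : principal_open dom_par.
Proof.
have [[hR0 hR1 hT0 hT1] [hK0 hK1 hL]] := par_poly P; have [hM0 _] := par_inv_poly P.
pose V0 := [set w : 'rV[algC]_2 | R0 (w ord0 0) * T0 (w ord0 0) * K1 (w ord0 0) != 0].
have oV0 : principal_open V0.
  exists (fun w => R0 (w ord0 0) * T0 (w ord0 0) * K1 (w ord0 0)) => //.
  exact: PolyM (PolyM (coord0 hR0) (coord0 hT0)) (coord0 hK1).
have nz (w : 'rV[algC]_2) : V0 w -> R0 (w ord0 0) != 0 /\ T0 (w ord0 0) != 0.
  by rewrite /V0 /= !mulf_eq0 !negb_or => /andP[/andP[-> ->]].
have rr := regular_frac oV0 (coord0 hR1) (coord0 hR0) (fun w hw => (nz w hw).1).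
have rt := regular_frac oV0 (coord0 hT1) (coord0 hT0) (fun w hw => (nz w hw).2).
have := @polyfun_regular_comp _ _ V0 (fun w => pt2 (pr (w ord0 0)) (pt (w ord0 0))) oV0 _ _ hM0.
case=> [i|]; last first.
  move=> N [q H]; have rM : regular V0 (fun w => M0 (pr (w ord0 0)) (pt (w ord0 0))).
    by apply: eq_regular (ex_intro _ N (ex_intro _ q H)) _ => w _; rewrite !pt2E.
  exact: principal_open_neq0 rM.
case: i => [[|[|//]]] hi.
  by apply: eq_regular rr _ => w _; rewrite mxE.
by apply: eq_regular rt _ => w _; rewrite mxE.
Qed.

Lemma regular_lift_par i : regular dom_par (fun w => lift_par w ord0 i).
Proof.
have [[hR0 hR1 hT0 hT1] [hK0 hK1 hL]] := par_poly P.
have oV := dom_par_open.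
have nz w : dom_par w -> [/\ R0 (w ord0 0) != 0, T0 (w ord0 0) != 0 & K0 (w ord0 0) != 0].
  by move=> /dom_par_neq0[r0 t0 _ _]; rewrite r0 t0 (par_K0 P r0 t0).
case: i => [[|[|[|//]]]] hi.
- apply: eq_regular (regular_frac oV (coord0 hR1) (coord0 hR0) _) _ => w; last by rewrite mxE.
  by case/nz.
- apply: eq_regular (regular_frac oV (coord0 hT1) (coord0 hT0) _) _ => w; last by rewrite mxE.
  by case/nz.
- have rk := regular_frac oV (coord0 hK1) (coord0 hK0) (fun w hw => let: And3 _ _ k := nz w hw in k).
  by apply: eq_regular (regularM rk (polyfun_regular oV (PolyX Crat 1))) _ => w _; rewrite mxE.
Qed.

(** All the conditions that keep a point of the double cover from being in the
    domain constrain u alone, and each excludes finitely many values of u. *)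
Lemma finite_bad_parameters : finite_set [set u | R0 u = 0 \/ T0 u = 0 \/ K1 u = 0 \/ L u = 0].
Proof.
have [[hR0 _ hT0 _] [_ hK1 hL]] := par_poly P.
have [u [r0 t0 k1 l0]] := par_nonzero P.
have := finite_zeros hL l0; have := finite_zeros hK1 k1.
have := finite_zeros hT0 t0; have := finite_zeros hR0 r0.
move=> fR fT fK fL.
apply: (@sub_finite_set _ _ ([set u | R0 u = 0] `|` ([set u | T0 u = 0] `|`
   ([set u | K1 u = 0] `|` [set u | L u = 0])))); first by [].
by rewrite !finite_setU.
Qed.

Lemma good_parameter w : C' w ->
  ~ (R0 (w ord0 0) = 0 \/ T0 (w ord0 0) = 0 \/ K1 (w ord0 0) = 0 \/ L (w ord0 0) = 0) ->
  dom_par w.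
Proof.
move=> Cw /not_orP[/eqP r0 /not_orP[/eqP t0 /not_orP[/eqP k1 l0]]].
split; first exact: mulf_neq0 (mulf_neq0 r0 t0) k1.
by apply/eqP => /= m0; apply: l0; exact: (par_L P r0 t0 m0).
Qed.

Let fB := finite_double_cover Q finite_bad_parameters.

Lemma finite_dom_par : finite_set (C' `\` dom_par).
Proof.
apply: sub_finite_set fB => w [Cw nV]; split; first exact: Cw.
by apply: contrapT => nB; apply: nV; exact: good_parameter.
Qed.

Lemma finite_dom_inv : finite_set (C `\` dom_inv).
Proof.
apply: (sub_finite_set _ (finite_image lift_par fB)) => v [Cv nU].
have [w Cw [r0 t0 wv]] := lift_par_surj Cv; exists w; last exact: wv.
split; first exact: Cw; apply: contrapT => nB; apply: nU.
by have [_ + _] := lift_parK Cw (good_parameter Cw nB); rewrite wv.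
Qed.

Lemma pullback_birational : affine_birational C C'.
Proof.
exists dom_inv, dom_par, lift_inv, lift_par; split.
- have [oU _ _] := dom_inv_open.
  split; split; [exact: oU | exact: regular_lift_inv | exact: dom_par_open | exact: regular_lift_par].
- exact: (conj finite_dom_inv finite_dom_par).
- exact: lift_invK.
- exact: lift_parK.
Qed.

(** A form that is zero at almost all points of the pullback gives, through
    the parametrization, a polynomial function that is zero almost everywhere
    on the double cover, hence everywhere; and the parametrization is onto. *)
Lemma pullback_affine_part : affine_part ord0 C (affine_in_proj C).
Proof.
split.
- by move=> v [v0 _]; apply: contraNneq v0 => ->; rewrite mxE.
- by move=> v v0; split=> [[]|]; last split.
move=> d p hp A fA H v [v0 Cv].
have [[hR0 hR1 hT0 hT1] [hK0 hK1 hL]] := par_poly P.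
pose s (w : 'rV[algC]_2) := R0 (w ord0 0) * T0 (w ord0 0) * K0 (w ord0 0).
pose G w := s w *: unchart ord0 (lift_par w).
pose N (w : 'rV[algC]_2) : 'rV[algC]_4 := \row_i [:: s w;
   R1 (w ord0 0) * T0 (w ord0 0) * K0 (w ord0 0);
   T1 (w ord0 0) * R0 (w ord0 0) * K0 (w ord0 0);
   K1 (w ord0 0) * w ord0 1 * R0 (w ord0 0) * T0 (w ord0 0)]`_i.
have hN i : polyfun predT (fun w => N w ord0 i).
  have [a0 a1 b0 b1] := And4 (polyfunT (coord0 hR0)) (polyfunT (coord0 hR1))
      (polyfunT (coord0 hT0)) (polyfunT (coord0 hT1)).
  have [e0 e1 x1] := And3 (polyfunT (coord0 hK0)) (polyfunT (coord0 hK1)) (PolyX predT (1 : 'I_2)).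
  case: i => [[|[|[|[|//]]]]] hi.
  - by apply: (eq_polyfun (PolyM (PolyM a0 b0) e0)) => w; rewrite mxE.
  - by apply: (eq_polyfun (PolyM (PolyM a1 b0) e0)) => w; rewrite mxE.
  - by apply: (eq_polyfun (PolyM (PolyM b1 a0) e0)) => w; rewrite mxE.
  - by apply: (eq_polyfun (PolyM (PolyM (PolyM e1 x1) a0) b0)) => w; rewrite mxE.
have NE (w : 'rV[algC]_2) : R0 (w ord0 0) != 0 -> T0 (w ord0 0) != 0 -> N w = G w.
  move=> r0 t0; have k0 := par_K0 P r0 t0.
  apply/rowP => i; rewrite !mxE; case: (unliftP ord0 i) => [j|] -> /=; last by rewrite mulr1.
  rewrite /lift_par /pt3 !mxE /s.
  case: j => [[|[|[|//]]]] hj /=.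
  - by field.
  - by field.
  - by field.
have Hall : forall w, C' w -> evalpt p (N w) = 0.
  apply: (polyfun_cofinite_eq0 Q0 (mpoly_polyfun p hN)
     (A := (C' `&` [set w | [set u | R0 u = 0 \/ T0 u = 0 \/ K1 u = 0 \/ L u = 0] (w ord0 0)])
            `|` lift_inv @` A)).
    by rewrite finite_setU; split; [exact: fB | exact: finite_image].
  move=> w Cw /not_orP[nB nA].
  have Vw : dom_par w by apply: (good_parameter Cw) => B; apply: nB; split; [exact: Cw|exact: B].
  have [r0 t0 _ _] := dom_par_neq0 Vw; have [Cl _ lK] := lift_parK Cw Vw.
  rewrite (NE w r0 t0) (evalpt_scale _ _ hp) (H _ Cl) ?mulr0 // => Al.
  by apply: nA; exists (lift_par w); [exact: Al | exact: lK].
have [w Cw [r0 t0 wv]] := lift_par_surj Cv.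
rewrite (evalpt_chart hp v0) (_ : chart ord0 v = lift_par w); last by rewrite wv.
suff -> : evalpt p (unchart ord0 (lift_par w)) = 0 by rewrite mulr0.
have := Hall w Cw; rewrite (NE w r0 t0) (evalpt_scale _ _ hp) => /eqP.
rewrite mulf_eq0 expf_eq0 => /orP[/andP[_]|/eqP] //.
by rewrite !mulf_eq0 (negPf r0) (negPf t0) (negPf (par_K0 P r0 t0)).
Qed.

Lemma pullback_defined_over_Q (g : algC -> algC -> algC) :
  (forall r t, D (pt2 r t) <-> g r t = 0) ->
  polyfun Crat (fun w : 'rV[algC]_2 => g (w ord0 0) (w ord0 1)) ->
  affine_defined_over_Q C.
Proof.
move=> Dg hg.
have h1 : polyfun Crat (fun v : 'rV[algC]_3 => g (v ord0 0) (v ord0 1)).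
  by apply: (eq_polyfun (polyfun_comp hg polyfun_proj)) => v; rewrite !pt2E.
have h2 : polyfun Crat (fun v : 'rV[algC]_3 =>
    quartic_product (v ord0 0) (v ord0 1) - v ord0 2 ^+ 2).
  by rewrite /quartic_product; prove_polyfun.
have [p pQ pE] := polyfun_mpoly h1; have [q qQ qE] := polyfun_mpoly h2.
exists [:: p; q].
  by move=> f; rewrite !inE => /orP[/eqP->|/eqP->]; [exact: pQ | exact: qQ].
apply/seteqP; split=> v.
  move=> /in_pullback[/Dg gv qv] f; rewrite !inE => /orP[/eqP->|/eqP->].
    by rewrite -pE.
  by rewrite -qE qv subrr.
move=> H; apply/in_pullback; split.
  by apply/Dg; rewrite pE; apply: H; rewrite inE eqxx.
by apply/eqP; rewrite -subr_eq0 qE; apply/eqP; apply: H; rewrite !inE eqxx orbT.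
Qed.
End RationalCurvePullback.
(** * Genus one pullbacks *)

Section GenusOneDoubleCover.
Local Open Scope ring_scope.
Local Open Scope classical_set_scope.

Definition quartic_jacobian (w0 c1 c2 c3 c4 : rat) : weierstrass :=
  Weierstrass 0%R c2 0%R (quartic_a4 w0 c1 c3 c4) (quartic_a6 w0 c1 c2 c3 c4).

(** The composite of the parametrization with the map from the quartic to its
    jacobian makes the projective Weierstrass curve a smooth model of the
    pullback. *)
Lemma genus_one_pullback (D : set 'rV[algC]_2) (g : algC -> algC -> algC)
  (w0 c1 c2 c3 c4 : rat) R0 R1 T0 T1 K0 K1 L M0 M1 :
  let E := quartic_jacobian w0 c1 c2 c3 c4 in
  parametrization D (quartic_poly w0 c1 c2 c3 c4) R0 R1 T0 T1 K0 K1 L M0 M1 ->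
  (forall r t, D (pt2 r t) <-> g r t = 0) ->
  polyfun Crat (fun w : 'rV[algC]_2 => g (w ord0 0) (w ord0 1)) ->
  w0 != 0 -> 64 * w0 ^+ 6 * c4 != (4 * w0 ^+ 2 * c2 - c1 ^+ 2) ^+ 2 ->
  is_elliptic E -> mordell_weil_rank_ge E 1 ->
  affine_curve_of_genus_over_Q (pullback_to_S D) 1 /\
  exists E : weierstrass, [/\ is_elliptic E,
    birational_over_Q (affine_in_proj (pullback_to_S D)) (wcurve E) &
    mordell_weil_rank_ge E 1].
Proof.
move=> E P Dg hg w00 hk ell rk.
have Q0 : quartic_poly w0 c1 c2 c3 c4 != 0.
  apply: contra_neq w00 => Q0; apply: (fmorph_inj (ratr : {rmorphism rat -> algC})).
  have := quartic_polyE w0 c1 c2 c3 c4 0; rewrite Q0 horner0 /quartic_value.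
  rewrite !expr0n !mulr0 !addr0 /= rmorph0 => /esym/eqP.
  by rewrite sqrf_eq0 => /eqP.
have bir : birational_over_Q (affine_in_proj (pullback_to_S D)) (wcurve E).
  apply: birational_of_affine (pullback_affine_part P Q0)
    (wcurve_affine_part c2 (quartic_a4 w0 c1 c3 c4) (quartic_a6 w0 c1 c2 c3 c4)) _.
  exact: affine_birational_trans (pullback_birational P) (quartic_birational c3 w00 hk).
split; last by exists E; split; [exact: ell | exact: bir | exact: rk].
split; first exact: pullback_defined_over_Q Dg hg.
by exists 2%N, (wcurve E); split; [exact: wcurve_smooth ell | exact: bir].
Qed.
End GenusOneDoubleCover.
(** * Parametrization of D1 *)

Section CurveD1.
Local Open Scope ring_scope.
Local Open Scope classical_set_scope.

Definition eq_D1 (r t : algC) :=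
  r ^+ 2 * t ^+ 2 - 4 * r ^+ 2 * t - 3 * r ^+ 2 - 2 * r * t ^+ 2 - 2 * r
    - 3 * t ^+ 2 - 4 * t + 1.

Lemma curve_D1E r t : curve_D1 (pt2 r t) <-> eq_D1 r t = 0.
Proof. by rewrite /curve_D1 /= !pt2E. Qed.

Definition K1_D1 (m : algC) : algC := (m ^+ 2 - 2 * m - 5) *
  (m ^+ 5 - m ^+ 4 + 2 * m ^+ 3 + 14 * m ^+ 2 + m - 17) ^+ 2.

(** As a quadratic equation for r, D1 has the discriminant
    4 (t + 1)^2 (t^2 - 4 t + 1).  The conic s^2 = t^2 - 4 t + 1 is parametrized
    by the lines s = t + m through one of its points at infinity. *)
Lemma product_D1 (m : algC) : m ^+ 2 - 7 != 0 -> m + 2 != 0 ->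
  quartic_product ((3 + 4 * m - m ^+ 2) / (m ^+ 2 - 7))
                  ((1 - m ^+ 2) / (2 * (m + 2))) =
  (K1_D1 m / (2 * ((m + 2) * (m ^+ 2 - 7)) ^+ 4)) ^+ 2 *
  (- 351 - 348 * m + 114 * m ^+ 2 + 60 * m ^+ 3 - 15 * m ^+ 4).
Proof.
move=> r0 t0; rewrite /quartic_product /K1_D1; field.
by rewrite r0 t0.
Qed.

Definition num_D1 (r t : algC) :=
  r * (t ^+ 2 - 4 * t - 3) - (t ^+ 2 + 1) - 2 * t * (t + 1).

(** Here num_D1 / (2 (t + 1)) is s - t, with s the square root of
    t^2 - 4 t + 1 given by the quadratic formula for r. *)
Lemma surjective_D1 (r t : algC) (m := num_D1 r t / (2 * (t + 1))) :
  eq_D1 r t = 0 -> t + 1 != 0 ->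
  [/\ m ^+ 2 - 7 != 0, m + 2 != 0, (3 + 4 * m - m ^+ 2) / (m ^+ 2 - 7) = r &
      (1 - m ^+ 2) / (2 * (m + 2)) = t].
Proof.
rewrite /eq_D1 => G t1.
have two0 : 2 != 0 :> algC by rewrite pnatr_eq0.
have mt : 2 * (t + 1) * m = num_D1 r t by rewrite /m; field; rewrite t1.
have tE : 2 * t * (m + 2) = 1 - m ^+ 2.
  apply: (mulIf (expf_neq0 2 (mulf_neq0 two0 t1))).
  transitivity (2 * t * (2 * (t + 1)) * (2 * (t + 1) * m) + 4 * t * (2 * (t + 1)) ^+ 2).
    by ring.
  rewrite mt; have -> : (1 - m ^+ 2) * (2 * (t + 1)) ^+ 2 =
     (2 * (t + 1)) ^+ 2 - (2 * (t + 1) * m) ^+ 2 by ring.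
  rewrite mt; apply: (eq_of_multiple (k := t ^+ 2 - 4 * t - 3) G).
  by rewrite /num_D1; ring.
have m2 : m + 2 != 0.
  apply/eqP => m2; have mE : m = - 2 by apply: (eq_of_multiple (k := 1) m2); ring.
  move/eqP: tE; rewrite m2 mulr0 mE -subr_eq0 (_ : _ - _ = 3%:R) ?pnatr_eq0 //.
  by ring.
have tE' : t = (1 - m ^+ 2) / (2 * (m + 2)) by rewrite -tE; field.
(* the two equations for r become multiples of the same linear one *)
pose b := r * (m ^+ 2 - 7) + m ^+ 2 - 4 * m - 3.
have d0 : (2 * (m + 2)) ^+ 2 != 0 by apply: expf_neq0 (mulf_neq0 two0 m2).
have b1 : b * (m ^+ 2 + 8 * m + 9) = 0.
  apply: (eq_of_multiple (k := - (2 * (m + 2)) ^+ 2) mt).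
  by rewrite /b /num_D1 tE'; field.
have b2 : b * (3 * m ^+ 2 + 4 * m - 1) = 0.
  have G2 : r * (2 * (t + 1) * m + 2 * t * (t + 1) - (t ^+ 2 + 1)) = 3 * t ^+ 2 + 4 * t - 1.
    by rewrite mt; apply: (eq_of_multiple (k := 1) G); rewrite /num_D1; ring.
  apply: (eq_of_multiple (k := - (2 * (m + 2)) ^+ 2) G2).
  by rewrite /b tE'; field.
have b0 : b = 0.
  apply: (mulfI (_ : 24 != 0 :> algC)); first by rewrite pnatr_eq0.
  rewrite mulr0; transitivity (- (1 - 15 * m) * (b * (m ^+ 2 + 8 * m + 9))
     - (5 * m + 33) * (b * (3 * m ^+ 2 + 4 * m - 1))); first by ring.
  by rewrite b1 b2; ring.
have m7 : m ^+ 2 - 7 != 0.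
  apply/eqP => m7.
  have m1 : m = 1.
    apply: (mulfI (_ : 4 != 0 :> algC)); first by rewrite pnatr_eq0.
    transitivity (4 * 1 - b + (r + 1) * (m ^+ 2 - 7)); first by rewrite /b; ring.
    by rewrite b0 m7; ring.
  move/eqP: m7; rewrite m1 (_ : _ - 7 = - 6%:R) ?oppr_eq0 ?pnatr_eq0 //.
  by ring.
split; [exact: m7 | exact: m2 | | by rewrite tE'].
apply: (mulIf m7); rewrite divfK //.
by apply: (eq_of_multiple (k := - 1) b0); rewrite /b; ring.
Qed.

(** The shift m = u - 1 places a rational point of the quartic, where its value
    is 6^2, over u = 0. *)
Lemma parametrization_D1 :
  parametrization curve_D1 (quartic_poly 6 (- 336) (- 156) 120 (- 15))
    (fun u => (u - 1) ^+ 2 - 7) (fun u => 3 + 4 * (u - 1) - (u - 1) ^+ 2)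
    (fun u => 2 * (u - 1 + 2)) (fun u => 1 - (u - 1) ^+ 2)
    (fun u => 2 * ((u - 1 + 2) * ((u - 1) ^+ 2 - 7)) ^+ 4) (fun u => K1_D1 (u - 1))
    (fun u => (u - 1) ^+ 2 - 2 * (u - 1) - 5)
    (fun r t => 2 * (t + 1)) (fun r t => num_D1 r t + 2 * (t + 1)).
Proof.
have two0 : 2 != 0 :> algC by rewrite pnatr_eq0.
have h2 u : 2 * u != 0 :> algC -> u != 0.
  by rewrite mulf_eq0 negb_or => /andP[].
have uE r t : t + 1 != 0 :> algC ->
    (num_D1 r t + 2 * (t + 1)) / (2 * (t + 1)) - 1 = num_D1 r t / (2 * (t + 1)).
  by move=> t0; field.
split.
- by rewrite /polyfun1 /K1_D1; split; split; prove_polyfun.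
- by rewrite /num_D1; split; prove_polyfun.
- exists 3; rewrite /K1_D1; split.
  + by rewrite (_ : _ - 7 = - 3%:R) ?oppr_eq0 ?pnatr_eq0 //; ring.
  + by rewrite (_ : 2 * _ = 8%:R) ?pnatr_eq0 //; ring.
  + by rewrite (_ : _ * _ = - 26645%:R) ?oppr_eq0 ?pnatr_eq0 //; ring.
  + by rewrite (_ : _ - 5 = - 5%:R) ?oppr_eq0 ?pnatr_eq0 //; ring.
- by move=> u r0 /h2 u0; apply: mulf_neq0 two0 (expf_neq0 4 (mulf_neq0 u0 r0)).
- move=> u r0 /h2 u0; apply/curve_D1E; rewrite /eq_D1; field.
  by rewrite r0 u0.
- move=> u r0 /h2 u0; rewrite (product_D1 r0 u0) quartic_polyE /quartic_value.
  by congr (_ * _); ring.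
- move=> u r0 /h2 u0 /h2 m0; rewrite -[RHS](subrK 1) -[LHS](subrK 1); congr (_ + _).
  rewrite (uE _ _ m0) /num_D1.
  have n0 : 1 - (u - 1) ^+ 2 + 2 * (u - 1 + 2) != 0.
    apply: contra_neq m0 => n0; apply: (mulIf (mulf_neq0 two0 u0)).
    by rewrite mul0r -n0; field.
  by field; rewrite r0 u0 n0.
- move=> u _ /h2 u0 /eqP; rewrite mulf_eq0 (negPf two0) /= => /eqP m0.
  apply: (eq_of_multiple (k := - (2 * (u - 1 + 2))) m0).
  by field.
- move=> r t /curve_D1E G /h2 t0; rewrite /= uE //.
  have [m3 m0 e1 e2] := surjective_D1 G t0; split; [exact: m3 | | exact: e1 | exact: e2].
  exact: mulf_neq0 two0 m0.
- move=> r t /curve_D1E; rewrite /eq_D1 => G t0.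
  have t1 : t = - 1.
    by apply: (mulfI two0); apply: (eq_of_multiple (k := 1) t0); ring.
  have r1 : r = 1.
    apply/eqP; rewrite -subr_eq0 -sqrf_eq0; apply/eqP; apply: (mulfI two0).
    by rewrite t1 in G; apply: (eq_of_multiple (k := 1) G); ring.
  (* the node (1, -1) corresponds to the roots of m^2 - 2m - 5 *)
  pose s := sqrtC 6 : algC; have s2 : s ^+ 2 = 6 by rewrite sqrtCK.
  have s0 : s != 0 by rewrite -sqrf_eq0 s2 pnatr_eq0.
  have m7 : (s + 2 - 1) ^+ 2 - 7 = 2 * s by apply: (eq_of_multiple (k := 1) s2); ring.
  have m2 : s + 2 - 1 + 2 != 0.
    apply/eqP => e; have sE : s = - 3 by apply: (eq_of_multiple (k := 1) e); ring.
    move/eqP: s2; rewrite sE -subr_eq0 (_ : _ - _ = 3%:R) ?pnatr_eq0 //.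
    by ring.
  exists (s + 2); rewrite m7; split.
  + exact: mulf_neq0 two0 s0.
  + exact: mulf_neq0 two0 m2.
  + rewrite r1; apply: (mulIf (mulf_neq0 two0 s0)); rewrite divfK; last exact: mulf_neq0.
    by apply: (eq_of_multiple (k := - 1) s2); ring.
  + rewrite t1; apply: (mulIf (mulf_neq0 two0 m2)); rewrite divfK; last exact: mulf_neq0.
    by apply: (eq_of_multiple (k := - 1) s2); ring.
Qed.
End CurveD1.
(** * Parametrization of D2 *)

Section CurveD2.
Local Open Scope ring_scope.
Local Open Scope classical_set_scope.

Definition eq_D2 (r t : algC) := r ^+ 2 * t - r ^+ 2 + 2 * r * t ^+ 2 + 2 * r - t - 1.

Lemma curve_D2E r t : curve_D2 (pt2 r t) <-> eq_D2 r t = 0.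
Proof. by rewrite /curve_D2 /= !pt2E. Qed.

Definition K1_D2 (m : algC) : algC :=
  (m ^+ 3 + m ^+ 2 - 3 * m - 3) * (m ^+ 4 - 2 * m ^+ 2 + 9) ^+ 2.

(** As a quadratic equation for r, D2 has the discriminant 4 t^2 (t^2 + 3), and
    the conic s^2 = t^2 + 3 is parametrized by the lines s = t + m. *)
Lemma product_D2 (m : algC) : m + 3 != 0 -> m != 0 ->
  quartic_product (m * (m + 1) / (m + 3)) ((3 - m ^+ 2) / (2 * m)) =
  (K1_D2 m / (16 * (m * (m + 3)) ^+ 3)) ^+ 2 *
  (- 135 + 36 * m + 138 * m ^+ 2 + 12 * m ^+ 3 - 15 * m ^+ 4).
Proof.
move=> r0 t0; rewrite /quartic_product /K1_D2; field.
by rewrite r0 t0.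
Qed.

Lemma surjective_D2 (r t : algC) (m := (r * (t - 1) + 1) / t) :
  eq_D2 r t = 0 -> t != 0 ->
  [/\ m + 3 != 0, m != 0, m * (m + 1) / (m + 3) = r & (3 - m ^+ 2) / (2 * m) = t].
Proof.
rewrite /eq_D2 => G t0.
have mt : m * t = r * (t - 1) + 1 by rewrite /m divfK.
have m0 : m != 0.
  apply: contra_neq t0 => m0; apply/eqP; rewrite -sqrf_eq0; apply/eqP.
  have e : r * (t - 1) = - 1 by apply: (eq_of_multiple (k := -1) mt); rewrite m0; ring.
  apply: (mulfI (_ : 3 != 0 :> algC)); first by rewrite pnatr_eq0.
  apply: (eq_of_multiple (k := - (t - 1)) G).
  transitivity (- ((r * (t - 1)) ^+ 2 + 2 * (r * (t - 1)) * (t ^+ 2 + 1) - (t ^+ 2 - 1))).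
    by rewrite e; ring.
  by ring.
have m3 : m + 3 != 0.
  apply/eqP => m3; have mE : m = - 3 by apply: (eq_of_multiple (k := 1) m3); ring.
  have e : r * (t - 1) = - (3 * t + 1).
    by apply: (eq_of_multiple (k := -1) mt); rewrite mE; ring.
  have : 6 * t ^+ 2 * (1 - t) = 0.
    apply: (eq_of_multiple (k := (t - 1)) G).
    transitivity ((r * (t - 1)) ^+ 2 + 2 * (r * (t - 1)) * (t ^+ 2 + 1) - (t ^+ 2 - 1)).
      by rewrite e; ring.
    by ring.
  move/eqP; rewrite !mulf_eq0 pnatr_eq0 (negPf t0) subr_eq0 /= => /eqP t1.
  move/eqP: e; rewrite -t1 subrr mulr0 eq_sym oppr_eq0 (_ : _ + 1 = 4%:R) ?pnatr_eq0 //.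
  by ring.
split; [exact: m3 | exact: m0 | |].
  apply: (mulIf m3); rewrite divfK //.
  apply: (mulIf (expf_neq0 2 t0)); apply: (eq_of_multiple (k := - 1) G).
  by rewrite /m; field.
apply: (mulIf m0); apply: (mulIf (expf_neq0 2 t0)).
have -> : (3 - m ^+ 2) / (2 * m) * m * t ^+ 2 = (3 * t ^+ 2 - (m * t) ^+ 2) / 2 by field.
have -> : t * m * t ^+ 2 = (m * t) * t ^+ 2 by ring.
rewrite mt; apply: (eq_of_multiple (k := - (t - 1) / 2) G).
by field.
Qed.

(** The shift m = u + 1 places a rational point of the quartic, where its value
    is 6^2, over u = 0. *)
Lemma parametrization_D2 :
  parametrization curve_D2 (quartic_poly 6 288 84 (- 48) (- 15))
    (fun u => u + 1 + 3) (fun u => (u + 1) * (u + 1 + 1))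
    (fun u => 2 * (u + 1)) (fun u => 3 - (u + 1) ^+ 2)
    (fun u => 16 * ((u + 1) * (u + 1 + 3)) ^+ 3) (fun u => K1_D2 (u + 1))
    (fun u => 3 - (u + 1) ^+ 2) (fun r t => t) (fun r t => r * (t - 1) + 1 - t).
Proof.
have h2 u : 2 * u != 0 :> algC -> u != 0.
  by rewrite mulf_eq0 negb_or => /andP[].
have uE r t : t != 0 :> algC -> (r * (t - 1) + 1 - t) / t + 1 = (r * (t - 1) + 1) / t.
  by move=> t0; field.
split.
- by rewrite /polyfun1 /K1_D2; split; split; prove_polyfun.
- by split; prove_polyfun.
- exists 1; rewrite /K1_D2; split.
  + by rewrite (_ : _ + 3 = 5%:R) ?pnatr_eq0 //; ring.
  + by rewrite (_ : 2 * _ = 4%:R) ?pnatr_eq0 //; ring.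
  + by rewrite (_ : _ * _ = 867%:R) ?pnatr_eq0 //; ring.
  + by rewrite (_ : _ - _ = - 1%:R) ?oppr_eq0 ?pnatr_eq0 //; ring.
- move=> u r0 /h2 u0; apply: mulf_neq0 (expf_neq0 3 (mulf_neq0 u0 r0)).
  by rewrite pnatr_eq0.
- move=> u r0 /h2 u0; apply/curve_D2E; rewrite /eq_D2; field.
  by rewrite r0 u0.
- move=> u r0 /h2 u0; rewrite (product_D2 r0 u0) quartic_polyE /quartic_value.
  by congr (_ * _); ring.
- move=> u r0 /h2 u0 m0; rewrite -[RHS](addrK 1) -[LHS](addrK 1); congr (_ - _).
  rewrite (uE _ _ m0); move: m0; rewrite mulf_eq0 negb_or => /andP[m0 _].
  by field; rewrite r0 u0 m0.
- move=> u _ /h2 u0 /eqP; rewrite mulf_eq0 invr_eq0 mulf_eq0 (negPf u0) pnatr_eq0 !orbF.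
  by move/eqP.
- move=> r t /curve_D2E G t0; rewrite /= uE //.
  have [m3 m0 e1 e2] := surjective_D2 G t0; split; [exact: m3 | | exact: e1 | exact: e2].
  by apply: mulf_neq0 m0; rewrite pnatr_eq0.
- move=> r t /curve_D2E; rewrite /eq_D2 => G t0.
  have r1 : r = 1.
    apply/eqP; rewrite -subr_eq0 -sqrf_eq0; apply/eqP.
    by rewrite t0 in G; apply: (eq_of_multiple (k := -1) G); ring.
  (* the node (1, 0) corresponds to the two square roots of 3 *)
  pose m := sqrtC 3 : algC; have m2 : m ^+ 2 = 3 by rewrite sqrtCK.
  have m0 : m != 0 by rewrite -sqrf_eq0 m2 pnatr_eq0.
  have m3 : m + 3 != 0.
    apply/eqP => /addr0_eq mE; move: m2; rewrite -[m]opprK mE sqrrN => /eqP.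
    by rewrite -subr_eq0 (_ : _ - _ = 6%:R) ?pnatr_eq0 //; ring.
  exists (m - 1); rewrite subrK m2 subrr mul0r t0 r1; split; [exact: m3 | | | by []].
    by apply: mulf_neq0 m0; rewrite pnatr_eq0.
  by apply: (mulIf m3); rewrite divfK // mul1r mulrDr -expr2 m2 mulr1 addrC.
Qed.
End CurveD2.
(** * Parametrization of D3 *)

Section CurveD3.
Local Open Scope ring_scope.
Local Open Scope classical_set_scope.

Definition eq_D3 (r t : algC) := r ^+ 2 * t ^+ 2 + 3 * r ^+ 2 - t ^+ 2 + 2 * t - 1.

Lemma curve_D3E r t : curve_D3 (pt2 r t) <-> eq_D3 r t = 0.
Proof. by rewrite /curve_D3 /= !pt2E. Qed.

Definition K1_D3 (u : algC) : algC :=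
  (u ^+ 4 - 10 * u ^+ 2 + 9) * (u ^+ 4 - 2 * u ^+ 2 + 9) ^+ 2.

(** D3 is r^2 (t^2 + 3) = (t - 1)^2: again t^2 + 3 is a square s^2, with
    s = (t - 1) / r, and s = t + u parametrizes the conic. *)
Lemma product_D3 (u : algC) : u ^+ 2 + 3 != 0 -> u != 0 ->
  quartic_product ((1 - u) * (u + 3) / (u ^+ 2 + 3)) ((3 - u ^+ 2) / (2 * u)) =
  (K1_D3 u / (4 * u ^+ 3 * (u ^+ 2 + 3) ^+ 4)) ^+ 2 *
  (81 - 144 * u - 42 * u ^+ 2 + 48 * u ^+ 3 + 9 * u ^+ 4).
Proof.
move=> r0 t0; rewrite /quartic_product /K1_D3; field.
by rewrite r0 t0.
Qed.

(** The only point with r = 0 is the node (0, 1), reached for u = 1. *)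
Lemma parametrization_D3 :
  parametrization curve_D3 (quartic_poly 9 (- 144) (- 42) 48 9)
    (fun u => u ^+ 2 + 3) (fun u => (1 - u) * (u + 3))
    (fun u => 2 * u) (fun u => 3 - u ^+ 2)
    (fun u => 4 * u ^+ 3 * (u ^+ 2 + 3) ^+ 4) K1_D3
    (fun u => (1 - u) * (u + 3)) (fun r t => r) (fun r t => t - 1 - r * t).
Proof.
have h2 u : 2 * u != 0 :> algC -> u != 0.
  by rewrite mulf_eq0 negb_or => /andP[].
split.
- by rewrite /polyfun1 /K1_D3; split; split; prove_polyfun.
- by split; prove_polyfun.
- exists 2; rewrite /K1_D3; split.
  + by rewrite (_ : _ + 3 = 7%:R) ?pnatr_eq0 //; ring.
  + by rewrite (_ : 2 * 2 = 4%:R) ?pnatr_eq0 //; ring.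
  + by rewrite (_ : _ * _ = - 4335%:R) ?oppr_eq0 ?pnatr_eq0 //; ring.
  + by rewrite (_ : _ * _ = - 5%:R) ?oppr_eq0 ?pnatr_eq0 //; ring.
- move=> u r0 /h2 u0; apply: mulf_neq0 (expf_neq0 4 r0).
  by apply: mulf_neq0 (expf_neq0 3 u0); rewrite pnatr_eq0.
- move=> u r0 /h2 u0; apply/curve_D3E; rewrite /eq_D3; field.
  by rewrite r0 u0.
- move=> u r0 /h2 u0; rewrite (product_D3 r0 u0) quartic_polyE /quartic_value.
  by congr (_ * _); ring.
- move=> u r0 /h2 u0; rewrite mulf_eq0 negb_or => /andP[r1 _]; field.
  by move: r1; rewrite mulf_eq0 negb_or => /andP[-> ->]; rewrite r0 u0.
- move=> u r0 _ /eqP; rewrite mulf_eq0 invr_eq0 (negPf r0) orbF.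
  by move/eqP.
- move=> r t /curve_D3E; rewrite /eq_D3 => G r0.
  have nz (k : nat) (x : algC) : k != 0%N -> k%:R * x ^+ 2 = 0 -> x = 0.
    move=> k0 /eqP; rewrite mulf_eq0 pnatr_eq0 (negPf k0) sqrf_eq0.
    by move/eqP.
  have t1 : t - 1 != 0.
    apply: contra_neq r0 => t1; apply: (nz 4%N) => //.
    by rewrite (subr0_eq t1) in G; apply: (eq_of_multiple (k := 1) G); ring.
  have n0 : t - 1 - r * t != 0.
    apply: contra_neq r0 => n0; apply: (nz 3%N) => //.
    apply: (eq_of_multiple (k := 1) G).
    transitivity ((r ^+ 2 * t ^+ 2 + 3 * r ^+ 2 - t ^+ 2 + 2 * t - 1)
      + (t - 1 - r * t) * (t - 1 + r * t)); first by ring.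
    by rewrite n0; ring.
  pose u := (t - 1 - r * t) / r; rewrite -/u.
  have u0 : u != 0 by apply: mulf_neq0 n0 _; rewrite invr_eq0.
  have RE : u ^+ 2 + 3 = 2 * (t - 1) * (t - 1 - r * t) / r ^+ 2.
    apply: (mulIf (expf_neq0 2 r0)); apply: (eq_of_multiple (k := 1) G).
    by rewrite /u; field.
  have R0 : u ^+ 2 + 3 != 0.
    rewrite RE; apply: mulf_neq0; last by rewrite invr_eq0; exact: expf_neq0.
    by apply: mulf_neq0 n0; apply: mulf_neq0 t1; rewrite pnatr_eq0.
  split; [exact: R0 | by apply: mulf_neq0 u0; rewrite pnatr_eq0 | |].
    apply: (mulIf R0); rewrite divfK //.
    apply: (mulIf (expf_neq0 2 r0)); apply: (eq_of_multiple (k := 1 - r) G).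
    by rewrite /u; field.
  apply: (mulIf u0); apply: (mulIf (expf_neq0 2 r0)).
  apply: (eq_of_multiple (k := 1 / 2) G).
  by rewrite /u; field; rewrite n0 r0.
- move=> r t /curve_D3E; rewrite /eq_D3 => G r0; exists 1.
  have t1 : t = 1.
    apply/eqP; rewrite -subr_eq0 -sqrf_eq0; apply/eqP.
    by rewrite r0 in G; apply: (eq_of_multiple (k := -1) G); ring.
  split.
  + by rewrite (_ : _ + 3 = 4%:R) ?pnatr_eq0 //; ring.
  + by rewrite mulr1 pnatr_eq0.
  + by rewrite subrr !mul0r r0.
  + by rewrite t1; field.
Qed.
End CurveD3.
(** * The jacobians of the three curves *)

Section Ranks.
Local Open Scope ring_scope.

Lemma nonsquare_nat (p n : nat) :
  prime p -> odd (logn p n) -> forall s : rat, s ^+ 2 <> n%:R.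
Proof.
move=> pp on s e.
have n0 : (0 < n)%N by case: n on {e} => //; rewrite logn0.
have ab0 : (0 < `|denq s|)%N by rewrite absz_gt0 denq_eq0.
have E : (`|numq s| ^ 2 = n * `|denq s| ^ 2)%N.
  have H : (numq s)%:~R ^+ 2 = n%:R * (denq s)%:~R ^+ 2 :> rat.
    by rewrite -e -exprMn numqE.
  have H2 : numq s ^+ 2 = n%:Z * denq s ^+ 2.
    by apply: (@intr_inj rat); move: H; rewrite !expr2 !intrM pmulrn.
  by move: (congr1 absz H2); rewrite abszM !abszX.
have num0 : (0 < `|numq s|)%N.
  rewrite lt0n; apply: contraTN isT => /eqP h0; move: E.
  rewrite h0 exp0n // => /esym/eqP; rewrite muln_eq0 expn_eq0 /=.
  by rewrite (gtn_eqF ab0) (gtn_eqF n0).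
have := congr1 (logn p) E.
rewrite lognM ?expn_gt0 ?ab0 // !lognX => /(congr1 odd).
by rewrite oddD !oddM /= on.
Qed.

Lemma negative_nonsquare (x : rat) : x < 0 -> forall s : rat, s ^+ 2 <> x.
Proof. by move=> x0 s e; move: x0; rewrite -e ltNge sqr_ge0. Qed.

Arguments negative_nonsquare {x} _ s _.

Lemma nonsquare_multiple (p n m : nat) (x : rat) : prime p -> odd (logn p n) ->
  (0 < m)%N -> x = n%:R * m%:R ^+ 2 -> forall s : rat, s ^+ 2 <> x.
Proof.
move=> pp on m0 -> s e; apply: (nonsquare_nat pp on (s := s / m%:R)).
by rewrite expr_div_n e mulfK // expf_neq0 // pnatr_eq0 -lt0n.
Qed.

Arguments nonsquare_multiple {p n m x} _ _ _ _ s _.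

Lemma opp_nat_lt0 (b : nat) (x : rat) : (0 < b)%N -> x = - b%:R -> x < 0.
Proof. by move=> b0 ->; rewrite oppr_lt0 ltr0n. Qed.

Lemma mul_opp_nat_lt0 (a b : nat) (x y : rat) :
  (0 < a)%N -> (0 < b)%N -> x = a%:R -> y = - b%:R -> x * y < 0.
Proof. by move=> a0 b0 -> ->; rewrite mulrN oppr_lt0 mulr_gt0 ?ltr0n. Qed.

Lemma wdisc_split b2 b4 b6 (e e' e'' : rat) :
  (forall x, x ^+ 3 + b2 * x ^+ 2 + b4 * x + b6 = (x - e) * (x - e') * (x - e'')) ->
  wdisc (Weierstrass 0%R b2 0%R b4 b6) =
  (4 * (e - e') * (e - e'') * (e' - e'')) ^+ 2.
Proof.
move=> H.
have E6 : b6 = - (e * e' * e'').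
  by apply: (eq_of_multiple (k := 1) (H 0)); ring.
have E2 : b2 = - (e + e' + e'').
  apply: (mulfI (_ : 2 != 0 :> rat)); first by rewrite pnatr_eq0.
  apply: (eq_of_multiple (k := 1) (congr2 +%R (H 1) (H (-1)))).
  by rewrite E6; ring.
have E4 : b4 = e * e' + e * e'' + e' * e''.
  by apply: (eq_of_multiple (k := 1) (H 1)); rewrite E6 E2; ring.
by rewrite /wdisc /= E2 E4 E6; ring.
Qed.

Definition jacobian_D1 := quartic_jacobian 6 (- 336) (- 156) 120 (- 15).
Definition jacobian_D2 := quartic_jacobian 6 288 84 (- 48) (- 15).
Definition jacobian_D3 := quartic_jacobian 9 (- 144) (- 42) 48 9.

Local Notation split_cubic E e e' e'' := (forall x : rat,
  x ^+ 3 + wa2 E * x ^+ 2 + wa4 E * x + wa6 E = (x - e) * (x - e') * (x - e'')).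

(** The three jacobians have all their 2-torsion over Q. *)
Lemma split_D1 : split_cubic jacobian_D1 300 (- 84) (- 60).
Proof. by move=> x; rewrite /= /quartic_a4 /quartic_a6; ring. Qed.

Lemma split_D2 : split_cubic jacobian_D2 108 (- 108) (- 84).
Proof. by move=> x; rewrite /= /quartic_a4 /quartic_a6; ring. Qed.

Lemma split_D3 : split_cubic jacobian_D3 (- 102) 54 90.
Proof. by move=> x; rewrite /= /quartic_a4 /quartic_a6; ring. Qed.

(** Kept as a product: a large numeral of rat would be computed in unary. *)
Lemma nat_product_neq0 (a b c : nat) : (0 < a)%N -> (0 < b)%N -> (0 < c)%N ->
  - (4 * a%:R * b%:R * c%:R) != 0 :> rat.
Proof.
move=> a0 b0 c0; rewrite oppr_eq0.
by do 3!(apply: mulf_neq0; last by rewrite pnatr_eq0 -lt0n); rewrite pnatr_eq0.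
Qed.

Lemma elliptic_D1 : is_elliptic jacobian_D1.
Proof.
rewrite /is_elliptic (wdisc_split split_D1); apply: expf_neq0.
rewrite (_ : 4 * _ * _ * _ = - (4 * 384%:R * 360%:R * 24%:R)); last by ring.
exact: nat_product_neq0.
Qed.

Lemma elliptic_D2 : is_elliptic jacobian_D2.
Proof.
rewrite /is_elliptic (wdisc_split split_D2); apply: expf_neq0.
rewrite (_ : 4 * _ * _ * _ = - (4 * 216%:R * 192%:R * 24%:R)); last by ring.
exact: nat_product_neq0.
Qed.

Lemma elliptic_D3 : is_elliptic jacobian_D3.
Proof.
rewrite /is_elliptic (wdisc_split split_D3); apply: expf_neq0.
rewrite (_ : 4 * _ * _ * _ = - (4 * 156%:R * 192%:R * 36%:R)); last by ring.
exact: nat_product_neq0.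
Qed.

Lemma nondegenerate_negative (a b c : nat) (x y : rat) :
  (0 < a)%N -> (0 < b)%N -> (0 < c)%N -> x = - (a%:R * b%:R * c%:R) -> x != y ^+ 2.
Proof.
move=> a0 b0 c0 ->; rewrite lt_eqF // (lt_le_trans _ (sqr_ge0 y)) // oppr_lt0.
by rewrite !mulr_gt0 ?ltr0n.
Qed.

(** The quartic is not the square of the quadratic polynomial that osculates
    one of its two branches at 0.  For the first two curves its leading
    coefficient is negative. *)
Lemma nondegenerate_D1 :
  64 * 6 ^+ 6 * (- 15) != (4 * 6 ^+ 2 * (- 156) - (- 336) ^+ 2) ^+ 2 :> rat.
Proof. by apply: (@nondegenerate_negative 960 216 216 _ _ isT isT isT); ring. Qed.

Lemma nondegenerate_D2 :
  64 * 6 ^+ 6 * (- 15) != (4 * 6 ^+ 2 * 84 - 288 ^+ 2) ^+ 2 :> rat.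
Proof. by apply: (@nondegenerate_negative 960 216 216 _ _ isT isT isT); ring. Qed.

Lemma nondegenerate_D3 :
  64 * 9 ^+ 6 * 9 != (4 * 9 ^+ 2 * (- 42) - (- 144) ^+ 2) ^+ 2 :> rat.
Proof.
rewrite -subr_eq0 (_ : _ - _ = - (4 * 1053%:R * 4320%:R * 48%:R)); last by ring.
exact: nat_product_neq0.
Qed.

Lemma point_D1 : (8640 : rat) ^+ 2 =
  516 ^+ 3 + wa2 jacobian_D1 * 516 ^+ 2 + wa4 jacobian_D1 * 516 + wa6 jacobian_D1.
Proof. by apply: etrans _ (esym (split_D1 516)); ring. Qed.

Lemma point_D2 : (3240 : rat) ^+ 2 =
  216 ^+ 3 + wa2 jacobian_D2 * 216 ^+ 2 + wa4 jacobian_D2 * 216 + wa6 jacobian_D2.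
Proof. by apply: etrans _ (esym (split_D2 216)); ring. Qed.

Lemma point_D3 : (288 : rat) ^+ 2 =
  42 ^+ 3 + wa2 jacobian_D3 * 42 ^+ 2 + wa4 jacobian_D3 * 42 + wa6 jacobian_D3.
Proof. by apply: etrans _ (esym (split_D3 42)); ring. Qed.

Local Notation multiple_of E := (multiple (wa2 E) (wa4 E) (wa6 E)).

Lemma infinite_order_D1 n : (0 < n)%N -> multiple_of jacobian_D1 516 8640 n <> None.
Proof.
have c0 : (516 - 300 : rat) = 216%:R by ring.
have n1 : (- 84) - 300 = - 384%:R :> rat by ring.
have n2 : (- 60) - 300 = - 360%:R :> rat by ring.
have y0 : 8640 != 0 :> rat by rewrite pnatr_eq0.
have cE : 516 - 300 = 6%:R * 6%:R ^+ 2 :> rat by ring.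
have dE : (300 - (- 84)) * (300 - (- 60)) = 15%:R * 96%:R ^+ 2 :> rat by ring.
have cdE : (516 - 300) * ((300 - (- 84)) * (300 - (- 60))) = 10%:R * 1728%:R ^+ 2 :> rat.
  by ring.
have A := nonsquare_multiple (p := 2) (n := 6) (m := 6) isT isT isT cE.
have B1 := nonsquare_multiple (p := 3) (n := 15) (m := 96) isT isT isT dE.
have C1 := nonsquare_multiple (p := 2) (n := 10) (m := 1728) isT isT isT cdE.
have B s := And3 (B1 s) (negative_nonsquare (opp_nat_lt0 (b := 384) isT n1) s)
  (negative_nonsquare (opp_nat_lt0 (b := 360) isT n2) s).
have C s := And3 (C1 s) (negative_nonsquare (mul_opp_nat_lt0 (a := 216) (b := 384) isT isT c0 n1) s)
  (negative_nonsquare (mul_opp_nat_lt0 (a := 216) (b := 360) isT isT c0 n2) s).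
exact: (infinite_order split_D1 (ex_intro _ _ (ex_intro _ _ split_D1))
  point_D1 y0 A B C).
Qed.

Lemma infinite_order_D2 n : (0 < n)%N -> multiple_of jacobian_D2 216 3240 n <> None.
Proof.
have c0 : (216 - 108 : rat) = 108%:R by ring.
have n1 : (- 108) - 108 = - 216%:R :> rat by ring.
have n2 : (- 84) - 108 = - 192%:R :> rat by ring.
have y0 : 3240 != 0 :> rat by rewrite pnatr_eq0.
have cE : 216 - 108 = 3%:R * 6%:R ^+ 2 :> rat by ring.
have dE : (108 - (- 108)) * (108 - (- 84)) = 2%:R * 144%:R ^+ 2 :> rat by ring.
have cdE : (216 - 108) * ((108 - (- 108)) * (108 - (- 84))) = 6%:R * 864%:R ^+ 2 :> rat.
  by ring.
have A := nonsquare_multiple (p := 3) (n := 3) (m := 6) isT isT isT cE.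
have B1 := nonsquare_multiple (p := 2) (n := 2) (m := 144) isT isT isT dE.
have C1 := nonsquare_multiple (p := 2) (n := 6) (m := 864) isT isT isT cdE.
have B s := And3 (B1 s) (negative_nonsquare (opp_nat_lt0 (b := 216) isT n1) s)
  (negative_nonsquare (opp_nat_lt0 (b := 192) isT n2) s).
have C s := And3 (C1 s) (negative_nonsquare (mul_opp_nat_lt0 (a := 108) (b := 216) isT isT c0 n1) s)
  (negative_nonsquare (mul_opp_nat_lt0 (a := 108) (b := 192) isT isT c0 n2) s).
exact: (infinite_order split_D2 (ex_intro _ _ (ex_intro _ _ split_D2))
  point_D2 y0 A B C).
Qed.

(** Here xP - e = 144 is a square for e = - 102: the root 54 shows that P is not
    a double. *)
Lemma infinite_order_D3 n : (0 < n)%N -> multiple_of jacobian_D3 42 288 n <> None.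
Proof.
have y0 : 288 != 0 :> rat by rewrite pnatr_eq0.
have cE : 42 - 54 = - 12%:R :> rat by ring.
have A := negative_nonsquare (opp_nat_lt0 (b := 12) isT cE).
have split' : forall x : rat, x ^+ 3 + wa2 jacobian_D3 * x ^+ 2 + wa4 jacobian_D3 * x
    + wa6 jacobian_D3 = (x - 54) * (x - (- 102)) * (x - 90).
  by move=> x; apply: etrans (split_D3 x) _; ring.
have E1 : (- 102 - 54) * (- 102 - 90) = 13%:R * 48%:R ^+ 2 :> rat by ring.
have E2 : 54 - - 102 = 39%:R * 2%:R ^+ 2 :> rat by ring.
have E3 : 90 - - 102 = 3%:R * 8%:R ^+ 2 :> rat by ring.
have F1 : (42 - - 102) * ((- 102 - 54) * (- 102 - 90)) = 13%:R * 576%:R ^+ 2 :> rat.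
  by ring.
have F2 : (42 - - 102) * (54 - - 102) = 39%:R * 24%:R ^+ 2 :> rat by ring.
have F3 : (42 - - 102) * (90 - - 102) = 3%:R * 96%:R ^+ 2 :> rat by ring.
have B s := And3 (nonsquare_multiple (p := 13) (n := 13) (m := 48) isT isT isT E1 s)
  (nonsquare_multiple (p := 3) (n := 39) (m := 2) isT isT isT E2 s)
  (nonsquare_multiple (p := 3) (n := 3) (m := 8) isT isT isT E3 s).
have C s := And3 (nonsquare_multiple (p := 13) (n := 13) (m := 576) isT isT isT F1 s)
  (nonsquare_multiple (p := 3) (n := 39) (m := 24) isT isT isT F2 s)
  (nonsquare_multiple (p := 3) (n := 3) (m := 96) isT isT isT F3 s).
exact: (infinite_order split_D3 (ex_intro _ _ (ex_intro _ _ split')) point_D3 y0 A B C).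
Qed.

Lemma rank_D1 : mordell_weil_rank_ge jacobian_D1 1.
Proof. exact: (rank_ge1 point_D1 infinite_order_D1). Qed.

Lemma rank_D2 : mordell_weil_rank_ge jacobian_D2 1.
Proof. exact: (rank_ge1 point_D2 infinite_order_D2). Qed.

Lemma rank_D3 : mordell_weil_rank_ge jacobian_D3 1.
Proof. exact: (rank_ge1 point_D3 infinite_order_D3). Qed.
End Ranks.
(** * Exotic quintuples from three tangents *)

Section ExoticQuintuples.
Local Open Scope ring_scope.
Local Open Scope classical_set_scope.

(** If abcd = 1 and x^2 = ab, y^2 = ac, z^2 = ad, then a, b, c and d are
    recovered up to sign from x, y and z, and the Diophantine condition on them
    is that x^2 + 1, y^2 + 1 and z^2 + 1 be squares.  The equation hxy says that
    the triples a, b, d and a, c, d have a regular extension e in common; its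
    square gives hXY up to a sign; and hv makes ae a square. *)
Variables x y z X Y Z v : rat.
Hypotheses (hX : X ^+ 2 = x ^+ 2 + 1) (hY : Y ^+ 2 = y ^+ 2 + 1)
  (hZ : Z ^+ 2 = z ^+ 2 + 1).
Hypothesis hxy : 2 * z * Z * (1 - x * y) = x + y.
Hypothesis hXY : X * Y = (1 - x * y) * (1 + 2 * z ^+ 2).
Hypothesis hv : v ^+ 2 = z ^+ 2 * (1 - x * y) ^+ 2 - x * y.
Hypotheses (x0 : x != 0) (y0 : y != 0) (z0 : z != 0) (v0 : v != 0).

Definition qa := x * y * z.
Definition qb := x / (y * z).
Definition qc := y / (x * z).
Definition qd := z / (x * y).
Definition qe := v ^+ 2 / (x * y * z).

Hypothesis distinct : uniq [:: qa; qb; qc; qd; qe].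

(** The right sides are the regular extensions of a, b, d and of a, c, d. *)
Lemma qe_eq1 : qe = qa + qb + qd + 2 * qa * qb * qd - 2 * X * Y * Z / y.
Proof.
have -> : qe = (z ^+ 2 * (1 - x * y) ^+ 2 - x * y) / (x * y * z) by rewrite /qe hv.
have -> : 2 * X * Y * Z / y = 2 * Z * (X * Y) / y by field.
rewrite hXY /qa /qb /qd; apply: (mulIf (mulf_neq0 (mulf_neq0 x0 y0) z0)).
apply: (eq_of_multiple (k := x * (1 + 2 * z ^+ 2)) hxy).
by field; rewrite x0 y0 z0.
Qed.

Lemma qe_eq2 : qe = qa + qc + qd + 2 * qa * qc * qd - 2 * X * Y * Z / x.
Proof.
have -> : qe = (z ^+ 2 * (1 - x * y) ^+ 2 - x * y) / (x * y * z) by rewrite /qe hv.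
have -> : 2 * X * Y * Z / x = 2 * Z * (X * Y) / x by field.
rewrite hXY /qa /qc /qd; apply: (mulIf (mulf_neq0 (mulf_neq0 x0 y0) z0)).
apply: (eq_of_multiple (k := y * (1 + 2 * z ^+ 2)) hxy).
by field; rewrite x0 y0 z0.
Qed.

(** Regularity from the extension formula e = a + b + d + 2abd - 2RST, where
    R, S and T are square roots of ab + 1, ad + 1 and bd + 1; the same formula
    makes ae + 1, be + 1 and de + 1 squares. *)
Lemma extension (a b d R S T : rat) (e := a + b + d + 2 * a * b * d - 2 * R * S * T) :
  R ^+ 2 = a * b + 1 -> S ^+ 2 = a * d + 1 -> T ^+ 2 = b * d + 1 ->
  [/\ a * e + 1 = (a * T - R * S) ^+ 2, b * e + 1 = (b * S - R * T) ^+ 2,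
      d * e + 1 = (d * R - S * T) ^+ 2 & regular_quadruple a b d e].
Proof.
move=> hR hS hT; have E : [/\ a * e + 1 = (a * T - R * S) ^+ 2, b * e + 1 = (b * S - R * T) ^+ 2 &
    d * e + 1 = (d * R - S * T) ^+ 2].
  split.
  - have -> : (a * T - R * S) ^+ 2 = a ^+ 2 * T ^+ 2 - 2 * a * R * S * T + R ^+ 2 * S ^+ 2 by ring.
    by rewrite hR hS hT /e; ring.
  - have -> : (b * S - R * T) ^+ 2 = b ^+ 2 * S ^+ 2 - 2 * b * R * S * T + R ^+ 2 * T ^+ 2 by ring.
    by rewrite hR hS hT /e; ring.
  - have -> : (d * R - S * T) ^+ 2 = d ^+ 2 * R ^+ 2 - 2 * d * R * S * T + S ^+ 2 * T ^+ 2 by ring.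
    by rewrite hR hS hT /e; ring.
case: E => E1 E2 E3; split=> //; rewrite /regular_quadruple E3 -hR /e.
have -> : 4 * R ^+ 2 * (d * R - S * T) ^+ 2 = (2 * d * R ^+ 2 - 2 * R * S * T) ^+ 2 by ring.
by rewrite hR; ring.
Qed.

Lemma exotic_of_xyz : exotic_quintuple qa qb qc qd qe.
Proof.
have nz : x * y * z != 0 by apply: mulf_neq0 z0; exact: mulf_neq0.
have hab : qa * qb = x ^+ 2 by rewrite /qa /qb; field; rewrite y0 z0.
have hac : qa * qc = y ^+ 2 by rewrite /qa /qc; field; rewrite x0 z0.
have had : qa * qd = z ^+ 2 by rewrite /qa /qd; field; rewrite x0 y0.
have hbc : qb * qc = z^-1 ^+ 2 by rewrite /qb /qc; field; rewrite x0 y0 z0.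
have hbd : qb * qd = y^-1 ^+ 2 by rewrite /qb /qd; field; rewrite x0 y0 z0.
have hcd : qc * qd = x^-1 ^+ 2 by rewrite /qc /qd; field; rewrite x0 y0 z0.
have hae : qa * qe = v ^+ 2 by rewrite /qa /qe; field; rewrite x0 y0 z0.
have hbe : qb * qe = (v / (y * z)) ^+ 2 by rewrite /qb /qe; field; rewrite x0 y0 z0.
have hce : qc * qe = (v / (x * z)) ^+ 2 by rewrite /qc /qe; field; rewrite x0 y0 z0.
have hde : qd * qe = (v / (x * y)) ^+ 2 by rewrite /qd /qe; field; rewrite x0 y0 z0.
have inv1 (s S : rat) : s != 0 -> S ^+ 2 = s ^+ 2 + 1 -> (S / s) ^+ 2 = s^-1 ^+ 2 + 1.
  by move=> s0 hS; rewrite expr_div_n hS; field.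
have [e1 e2 e3 reg1] : [/\ qa * qe + 1 = (qa * (Y / y) - X * Z) ^+ 2,
    qb * qe + 1 = (qb * Z - X * (Y / y)) ^+ 2,
    qd * qe + 1 = (qd * X - Z * (Y / y)) ^+ 2 & regular_quadruple qa qb qd qe].
  have -> : qe = qa + qb + qd + 2 * qa * qb * qd - 2 * X * Z * (Y / y).
    by rewrite qe_eq1; ring.
  apply: extension; first by rewrite hab.
    by rewrite had.
  by rewrite hbd inv1.
have [_ e4 _ reg2] : [/\ qa * qe + 1 = (qa * (X / x) - Y * Z) ^+ 2,
    qc * qe + 1 = (qc * Z - Y * (X / x)) ^+ 2,
    qd * qe + 1 = (qd * Y - Z * (X / x)) ^+ 2 & regular_quadruple qa qc qd qe].
  have -> : qe = qa + qc + qd + 2 * qa * qc * qd - 2 * Y * Z * (X / x).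
    by rewrite qe_eq2; ring.
  apply: extension; first by rewrite hac.
    by rewrite had.
  by rewrite hcd inv1.
have pairs (Pr : rat -> Prop) : [/\ Pr (qa * qb), Pr (qa * qc), Pr (qa * qd) & Pr (qa * qe)] ->
   [/\ Pr (qb * qc), Pr (qb * qd) & Pr (qb * qe)] ->
   [/\ Pr (qc * qd), Pr (qc * qe) & Pr (qd * qe)] ->
   {in [:: qa; qb; qc; qd; qe] &, forall s t, s != t -> Pr (s * t)}.
  move=> [p1 p2 p3 p4] [p5 p6 p7] [p8 p9 p10] s t; rewrite !inE.
  by do 4?[case/orP=> [/eqP->|]]; try move=> /eqP ->;
     do 4?[case/orP=> [/eqP->|]]; try move=> /eqP ->; rewrite ?eqxx // mulrC.
split.
- split; first exact: distinct.
    rewrite !inE !negb_or ![0 == _]eq_sym /qa /qb /qc /qd /qe nz.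
    by rewrite !mulf_neq0 ?invr_eq0 ?mulf_neq0 ?expf_neq0.
  apply: (pairs (fun p => is_square (p + 1))); split.
  + by exists X; rewrite hab hX.
  + by exists Y; rewrite hac hY.
  + by exists Z; rewrite had hZ.
  + by rewrite e1; eexists.
  + by exists (Z / z); rewrite hbc inv1.
  + by exists (Y / y); rewrite hbd inv1.
  + by rewrite e2; eexists.
  + by exists (X / x); rewrite hcd inv1.
  + by rewrite e4; eexists.
  + by rewrite e3; eexists.
- by rewrite /qa /qb /qc /qd; field; rewrite x0 y0 z0.
- exact: reg1.
- exact: reg2.
- apply: pairs; split; rewrite ?hab ?hac ?had ?hbc ?hbd ?hcd ?hae ?hbe ?hce ?hde; by eexists.
Qed.
End ExoticQuintuples.
(** * The quintuples given by the points of D3 *)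

Section PolynomialFunctionsOverQ.
Local Open Scope ring_scope.
Local Open Scope classical_set_scope.

Definition polynomial_fun (f : rat -> rat) : Prop :=
  exists p : {poly rat}, forall x, f x = p.[x].

Lemma polynomial_cst c : polynomial_fun (fun=> c).
Proof. by exists c%:P => x; rewrite hornerC. Qed.

Lemma polynomial_id : polynomial_fun (fun x => x).
Proof. by exists 'X => x; rewrite hornerX. Qed.

Lemma polynomialD f g : polynomial_fun f -> polynomial_fun g ->
  polynomial_fun (fun x => f x + g x).
Proof. by move=> [p hp] [q hq]; exists (p + q) => x; rewrite hornerD hp hq. Qed.

Lemma polynomialN f : polynomial_fun f -> polynomial_fun (fun x => - f x).
Proof. by move=> [p hp]; exists (- p) => x; rewrite hornerN hp. Qed.

Lemma polynomialM f g : polynomial_fun f -> polynomial_fun g ->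
  polynomial_fun (fun x => f x * g x).
Proof. by move=> [p hp] [q hq]; exists (p * q) => x; rewrite hornerM hp hq. Qed.

Lemma polynomialXn f k : polynomial_fun f -> polynomial_fun (fun x => f x ^+ k).
Proof. by move=> [p hp]; exists (p ^+ k) => x; rewrite horner_exp hp. Qed.

Lemma finite_polynomial_zeros f a : polynomial_fun f -> f a != 0 ->
  finite_set [set x | f x = 0].
Proof.
move=> [p pE] fa; pose q := map_poly (ratr : {rmorphism rat -> algC}) p.
have q0 : q != 0.
  rewrite map_poly_eq0; apply: contra_neq fa => p0; by rewrite pE p0 horner0.
have inj : {in (fun x : rat => ratr x : algC) @^-1` [set z | q.[z] = 0] &,
    injective (fun x : rat => ratr x : algC)} by move=> x y _ _; exact: fmorph_inj.
apply: sub_finite_set (finite_preimage inj (finite_root_set q0)) => x /= fx.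
by rewrite /q horner_map -pE fx rmorph0.
Qed.

Lemma finite_bad (fs : seq (rat -> rat)) a :
  foldr (fun f P => (polynomial_fun f /\ f a != 0) /\ P) True fs ->
  finite_set [set x | has (fun f => f x == 0) fs].
Proof.
elim: fs => [|f fs IH] /= H.
  by apply: (sub_finite_set _ (finite_set0 rat)) => x.
have [[hf fa] {}H] := H.
apply: (@sub_finite_set _ _ ([set x | f x = 0] `|` [set x | has (fun f => f x == 0) fs])).
  by move=> x /= /orP[/eqP|]; [left|right].
rewrite finite_setU; split; first exact: finite_polynomial_zeros hf fa.
exact: IH.
Qed.
End PolynomialFunctionsOverQ.

(* The matching is syntactic: unification would compute in rat. *)
Ltac prove_polynomial := lazymatch goal with
  | |- polynomial_fun (fun _ => ?c) => exact (polynomial_cst c)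
  | |- polynomial_fun (fun x => x) => exact polynomial_id
  | |- polynomial_fun (fun x => (@?f x + @?g x)%R) =>
      apply (@polynomialD f g); prove_polynomial
  | |- polynomial_fun (fun x => (- @?f x)%R) => apply (@polynomialN f); prove_polynomial
  | |- polynomial_fun (fun x => (@?f x * @?g x)%R) =>
      apply (@polynomialM f g); prove_polynomial
  | |- polynomial_fun (fun x => (@?f x ^+ ?k)%R) =>
      apply (@polynomialXn f k); prove_polynomial
  end.

Section ExoticFromD3.
Local Open Scope ring_scope.
Local Open Scope classical_set_scope.

Definition quartic_D3 (m : rat) := quartic_value 9 (- 144) (- 42) 48 9 m.

(** The tangents x = nx / px, y = ny / py and z = nz / pz on D3, as functions of
    the parameter. *)
Definition nx (m : rat) := - (8 * (m ^+ 3 + 2 * m ^+ 2 - 3 * m)).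
Definition px (m : rat) := m ^+ 4 + 4 * m ^+ 3 - 18 * m ^+ 2 - 12 * m + 9.
Definition ny (m : rat) := 4 * (m ^+ 3 - 3 * m).
Definition py (m : rat) := m ^+ 4 - 10 * m ^+ 2 + 9.
Definition nz (m : rat) := 2 * (m ^+ 3 - 2 * m ^+ 2 - 3 * m).
Definition pz (m : rat) := m ^+ 4 + 2 * m ^+ 3 + 6 * m - 9.

(** Their nonvanishing makes the five numbers nonzero and distinct: apart from
    the first eight, each is a factor of a difference of two of them. *)
Definition conditions : seq (rat -> rat) := [::
  (fun m => m); px; py; pz; nx; ny; nz; quartic_D3;
  (fun m => ny m * nz m - py m * pz m); (fun m => ny m * nz m + py m * pz m);
  (fun m => nx m * nz m - px m * pz m); (fun m => nx m * nz m + px m * pz m);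
  (fun m => nx m * ny m - px m * py m); (fun m => nx m * ny m + px m * py m);
  (fun m => nx m * py m - ny m * px m); (fun m => nx m * py m + ny m * px m);
  (fun m => nx m * pz m - nz m * px m); (fun m => nx m * pz m + nz m * px m);
  (fun m => ny m * pz m - nz m * py m); (fun m => ny m * pz m + nz m * py m);
  (fun m => nz m ^+ 2 * px m * py m - nx m * ny m * (pz m ^+ 2 + 2 * nz m ^+ 2));
  (fun m => 4 * m ^+ 2 * quartic_D3 m - nx m ^+ 2);
  (fun m => 4 * m ^+ 2 * quartic_D3 m * py m ^+ 2 - ny m ^+ 2 * px m ^+ 2);
  (fun m => 4 * m ^+ 2 * quartic_D3 m * pz m ^+ 2 - nz m ^+ 2 * px m ^+ 2)].

Lemma value_neq0 (a b c : nat) (v : rat) : (0 < a)%N -> (0 < b)%N -> (0 < c)%N ->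
  v = a%:R * b%:R * c%:R \/ v = - (a%:R * b%:R * c%:R) -> v != 0.
Proof.
move=> a0 b0 c0; have nz : a%:R * b%:R * c%:R != 0 :> rat.
  by do 2!(apply: mulf_neq0; last by rewrite pnatr_eq0 -lt0n); rewrite pnatr_eq0 -lt0n.
by case=> ->; rewrite ?oppr_eq0.
Qed.

Ltac condition_at2 a b c side := split;
  [ rewrite /px /py /pz /nx /ny /nz /quartic_D3 /quartic_value; prove_polynomial
  | apply (@value_neq0 a b c _ isT isT isT); side;
    rewrite /px /py /pz /nx /ny /nz /quartic_D3 /quartic_value; ring ].

(** No condition vanishes at m = 2; the arguments are its absolute value there,
    as a product of three factors, and its sign. *)
Lemma finite_conditions : finite_set [set m | has (fun f => f m == 0) conditions].
Proof.
apply: (finite_bad (a := 2)).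
split; first condition_at2 2%N 1%N 1%N ltac:(left).
split; first condition_at2 39%N 1%N 1%N ltac:(right).
split; first condition_at2 15%N 1%N 1%N ltac:(right).
split; first condition_at2 35%N 1%N 1%N ltac:(left).
split; first condition_at2 80%N 1%N 1%N ltac:(right).
split; first condition_at2 8%N 1%N 1%N ltac:(left).
split; first condition_at2 12%N 1%N 1%N ltac:(right).
split; first condition_at2 153%N 1%N 1%N ltac:(left).
split; first condition_at2 429%N 1%N 1%N ltac:(left).
split; first condition_at2 621%N 1%N 1%N ltac:(right).
split; first condition_at2 2325%N 1%N 1%N ltac:(left).
split; first condition_at2 405%N 1%N 1%N ltac:(right).
split; first condition_at2 1225%N 1%N 1%N ltac:(right).
split; first condition_at2 55%N 1%N 1%N ltac:(right).
split; first condition_at2 1512%N 1%N 1%N ltac:(left).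
split; first condition_at2 888%N 1%N 1%N ltac:(left).
split; first condition_at2 3268%N 1%N 1%N ltac:(right).
split; first condition_at2 2332%N 1%N 1%N ltac:(right).
split; first condition_at2 100%N 1%N 1%N ltac:(left).
split; first condition_at2 460%N 1%N 1%N ltac:(left).
split; first condition_at2 80%N 59%N 223%N ltac:(left).
split; first condition_at2 3952%N 1%N 1%N ltac:(right).
split; first condition_at2 144%N 47%N 67%N ltac:(left).
split; first condition_at2 1152%N 19%N 127%N ltac:(left).
exact: I.
Qed.

Definition xD3 m := nx m / px m.
Definition yD3 m := ny m / py m.
Definition zD3 m := nz m / pz m.

(** A point (m, w) of the double cover of D3 supplies the square root of ae. *)
Definition vD3 m w := 2 * m * w / px m.

Lemma has_negated (fs : seq (rat -> rat)) (u : rat) :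
  ~~ has (fun f => f u == 0) fs -> foldr (fun f P => f u != 0 /\ P) True fs.
Proof. by elim: fs => //= f fs IH; rewrite negb_or => /andP[? /IH]. Qed.

Lemma neq_of_multiple (a b c d : rat) : (a - b) * c = d -> d != 0 -> a != b.
Proof. by move=> E; apply: contra_neq => e; rewrite -E e subrr mul0r. Qed.

(** The differences of e with b, c and d factor if v^2 is Q4 / PX^2; the
    difference with a does so with the expression of v^2 in x, y and z. *)
Lemma distinct_conditions (X PX Y PY Z PZ Q4 x y z v : rat) :
  x = X / PX -> y = Y / PY -> z = Z / PZ -> v ^+ 2 = Q4 / PX ^+ 2 ->
  v ^+ 2 = z ^+ 2 * (1 - x * y) ^+ 2 - x * y ->
  [/\ PX != 0, PY != 0, PZ != 0 & [/\ X != 0, Y != 0 & Z != 0]] ->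
  [/\ Y * Z - PY * PZ != 0, Y * Z + PY * PZ != 0, X * Z - PX * PZ != 0 &
      X * Z + PX * PZ != 0] ->
  [/\ X * Y - PX * PY != 0, X * Y + PX * PY != 0, X * PY - Y * PX != 0 &
      X * PY + Y * PX != 0] ->
  [/\ X * PZ - Z * PX != 0, X * PZ + Z * PX != 0, Y * PZ - Z * PY != 0 &
      Y * PZ + Z * PY != 0] ->
  [/\ Z ^+ 2 * PX * PY - X * Y * (PZ ^+ 2 + 2 * Z ^+ 2) != 0, Q4 - X ^+ 2 != 0,
      Q4 * PY ^+ 2 - Y ^+ 2 * PX ^+ 2 != 0 & Q4 * PZ ^+ 2 - Z ^+ 2 * PX ^+ 2 != 0] ->
  uniq [:: qa x y z; qb x y z; qc x y z; qd x y z; qe x y z v].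
Proof.
move=> -> -> -> vE vE' [PX0 PY0 PZ0 [X0 Y0 Z0]] [f1 f2 f3 f4] [f5 f6 f7 f8]
  [f9 f10 f11 f12] [f13 f14 f15 f16].
have ab : qa (X / PX) (Y / PY) (Z / PZ) != qb (X / PX) (Y / PY) (Z / PZ).
  apply: (neq_of_multiple (c := Y / PY * (Z / PZ) / (X / PX) * (PY * PZ) ^+ 2) _ (mulf_neq0 f1 f2)).
  by rewrite /qa /qb; field; rewrite ?PX0 ?PY0 ?PZ0 ?X0 ?Y0 ?Z0.
have ac : qa (X / PX) (Y / PY) (Z / PZ) != qc (X / PX) (Y / PY) (Z / PZ).
  apply: (neq_of_multiple (c := X / PX * (Z / PZ) / (Y / PY) * (PX * PZ) ^+ 2) _ (mulf_neq0 f3 f4)).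
  by rewrite /qa /qc; field; rewrite ?PX0 ?PY0 ?PZ0 ?X0 ?Y0 ?Z0.
have ad : qa (X / PX) (Y / PY) (Z / PZ) != qd (X / PX) (Y / PY) (Z / PZ).
  apply: (neq_of_multiple (c := X / PX * (Y / PY) / (Z / PZ) * (PX * PY) ^+ 2) _ (mulf_neq0 f5 f6)).
  by rewrite /qa /qd; field; rewrite ?PX0 ?PY0 ?PZ0 ?X0 ?Y0 ?Z0.
pose p := X / PX * (Y / PY) * (Z / PZ).
have bc : qb (X / PX) (Y / PY) (Z / PZ) != qc (X / PX) (Y / PY) (Z / PZ).
  apply: (neq_of_multiple (c := p * (PX * PY) ^+ 2) _ (mulf_neq0 f7 f8)).
  by rewrite /qb /qc /p; field; rewrite ?PX0 ?PY0 ?PZ0 ?X0 ?Y0 ?Z0.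
have bd : qb (X / PX) (Y / PY) (Z / PZ) != qd (X / PX) (Y / PY) (Z / PZ).
  apply: (neq_of_multiple (c := p * (PX * PZ) ^+ 2) _ (mulf_neq0 f9 f10)).
  by rewrite /qb /qd /p; field; rewrite ?PX0 ?PY0 ?PZ0 ?X0 ?Y0 ?Z0.
have cd : qc (X / PX) (Y / PY) (Z / PZ) != qd (X / PX) (Y / PY) (Z / PZ).
  apply: (neq_of_multiple (c := p * (PY * PZ) ^+ 2) _ (mulf_neq0 f11 f12)).
  by rewrite /qc /qd /p; field; rewrite ?PX0 ?PY0 ?PZ0 ?X0 ?Y0 ?Z0.
have ae : qa (X / PX) (Y / PY) (Z / PZ) != qe (X / PX) (Y / PY) (Z / PZ) v.
  apply: (neq_of_multiple (c := - (p * PX * PY * PZ ^+ 2)) _ f13).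
  by rewrite /qa /qe vE' /p; field; rewrite ?PX0 ?PY0 ?PZ0 ?X0 ?Y0 ?Z0.
have be : qb (X / PX) (Y / PY) (Z / PZ) != qe (X / PX) (Y / PY) (Z / PZ) v.
  apply: (neq_of_multiple (c := - (p * PX ^+ 2)) _ f14).
  by rewrite /qb /qe vE /p; field; rewrite ?PX0 ?PY0 ?PZ0 ?X0 ?Y0 ?Z0.
have ce : qc (X / PX) (Y / PY) (Z / PZ) != qe (X / PX) (Y / PY) (Z / PZ) v.
  apply: (neq_of_multiple (c := - (p * PX ^+ 2 * PY ^+ 2)) _ f15).
  by rewrite /qc /qe vE /p; field; rewrite ?PX0 ?PY0 ?PZ0 ?X0 ?Y0 ?Z0.
have de : qd (X / PX) (Y / PY) (Z / PZ) != qe (X / PX) (Y / PY) (Z / PZ) v.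
  apply: (neq_of_multiple (c := - (p * PX ^+ 2 * PZ ^+ 2)) _ f16).
  by rewrite /qd /qe vE /p; field; rewrite ?PX0 ?PY0 ?PZ0 ?X0 ?Y0 ?Z0.
rewrite cons_uniq; apply/andP; split.
  by rewrite !inE !negb_or ab ac ad ae.
rewrite cons_uniq; apply/andP; split; first by rewrite !inE !negb_or bc bd be.
rewrite cons_uniq; apply/andP; split; first by rewrite !inE !negb_or cd ce.
by rewrite cons_uniq; apply/andP; split; first by rewrite inE de.
Qed.

Section Good.
Variables m w : rat.
Hypothesis good : ~~ has (fun f => f m == 0) conditions.
Hypothesis onQ : w ^+ 2 = quartic_D3 m.

Let x := xD3 m.
Let y := yD3 m.
Let z := zD3 m.
Let v := vD3 m w.

Lemma exotic_on_D3 :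
  exotic_quintuple (qa x y z) (qb x y z) (qc x y z) (qd x y z) (qe x y z v).
Proof.
case: (has_negated good) => m0 [px0 [py0 [pz0 [nx0 [ny0 [nz0 [Q0]]]]]]].
case=> f1 [f2 [f3 [f4 [f5 [f6 [f7 [f8 [f9 [f10 [f11 [f12 [f13 [f14 [f15 [f16 _]]]]]]]]]]]]]]].
have vE : v ^+ 2 = 4 * m ^+ 2 * quartic_D3 m / px m ^+ 2.
  by rewrite -onQ /v /vD3; field.
have hv : v ^+ 2 = z ^+ 2 * (1 - x * y) ^+ 2 - x * y.
  rewrite vE /x /y /z /xD3 /yD3 /zD3 /nx /ny /nz; move: px0 py0 pz0.
  rewrite /quartic_D3 /quartic_value /px /py /pz => px0' py0' pz0'; field.
  by rewrite px0' py0' pz0'.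
apply: (@exotic_of_xyz x y z (- (m ^+ 4 + 4 * m ^+ 3 + 14 * m ^+ 2 - 12 * m + 9) / px m)
    (- (m ^+ 4 - 2 * m ^+ 2 + 9) / py m)
    (- (m ^+ 4 + 2 * m ^+ 3 + 2 * m ^+ 2 - 6 * m + 9) / pz m)).
- by rewrite /x /xD3 /nx; move: px0; rewrite /px => px0; field.
- by rewrite /y /yD3 /ny; move: py0; rewrite /py => py0; field.
- by rewrite /z /zD3 /nz; move: pz0; rewrite /pz => pz0; field.
- rewrite /x /y /z /xD3 /yD3 /zD3 /nx /ny /nz; move: px0 py0 pz0.
  by rewrite /px /py /pz => px0 py0 pz0; field; rewrite px0 py0 pz0.
- rewrite /x /y /z /xD3 /yD3 /zD3 /nx /ny /nz; move: px0 py0 pz0.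
  by rewrite /px /py /pz => px0 py0 pz0; field; rewrite px0 py0 pz0.
- exact: hv.
- by apply: mulf_neq0 nx0 _; rewrite invr_eq0.
- by apply: mulf_neq0 ny0 _; rewrite invr_eq0.
- by apply: mulf_neq0 nz0 _; rewrite invr_eq0.
- have w0 : w != 0 by move: Q0; rewrite -onQ sqrf_eq0.
  apply: mulf_neq0; last by rewrite invr_eq0.
  by apply: mulf_neq0 w0; apply: mulf_neq0 m0; rewrite pnatr_eq0.
apply: (@distinct_conditions (nx m) (px m) (ny m) (py m) (nz m) (pz m)
  (4 * m ^+ 2 * quartic_D3 m) x y z v (erefl x) (erefl y) (erefl z) vE hv);
  repeat split; assumption.
Qed.
End Good.
End ExoticFromD3.
(** * Infinitely many exotic quintuples *)

Section InfinitelyMany.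
Local Open Scope ring_scope.
Local Open Scope classical_set_scope.

(** Outside a finite set, the rational points of the jacobian are the images of
    the rational points of the quartic, of which at most two lie over each u;
    and the multiples of a point of infinite order are all distinct. *)
Lemma infinite_quartic_points (w0 c1 c2 c3 c4 xP yP : rat)
    (E := quartic_jacobian w0 c1 c2 c3 c4) :
  w0 != 0 ->
  yP ^+ 2 = xP ^+ 3 + wa2 E * xP ^+ 2 + wa4 E * xP + wa6 E -> yP != 0 ->
  (forall n, (0 < n)%N -> multiple (wa2 E) (wa4 E) (wa6 E) xP yP n <> None) ->
  infinite_set [set u | exists w, w ^+ 2 = quartic_value w0 c1 c2 c3 c4 u].
Proof.
move=> w00 onP y0 Pinf finM.
pose M := multiple (wa2 E) (wa4 E) (wa6 E) xP yP.
have Minj : injective M := multiple_inj onP y0 Pinf.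
pose root u := xget 0 [set w | w ^+ 2 = quartic_value w0 c1 c2 c3 c4 u].
pose S := [set u | exists w, w ^+ 2 = quartic_value w0 c1 c2 c3 c4 u].
pose back u w := Some (to_cubic_x w0 c1 u w, to_cubic_y w0 c1 c2 c3 u w).
pose toC (P : rat * rat) := pt2 (ratr P.1) (ratr P.2).
have toC_inj : injective toC.
  move=> [x y] [x' y'] e; have := congr1 (fun v : 'rV_2 => v ord0 0) e.
  have := congr1 (fun v : 'rV_2 => v ord0 1) e; rewrite !pt2E /=.
  by move=> /fmorph_inj -> /fmorph_inj ->.
have [B finB inB] : exists2 B : set (rat * rat), finite_set B &
    forall x y, y ^+ 2 = cubic_value w0 c1 c2 c3 c4 x ->
      to_quartic_num w0 c1 c2 x = 0 \/ to_quartic_den w0 c1 c3 x y = 0 -> B (x, y).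
  have fC := @finite_cubic_complement w0 c1 c2 c3 c4 w00.
  set C := (X in finite_set X) in fC; exists (toC @^-1` C).
    by apply: finite_preimage fC => P P' _ _; exact: toC_inj.
  move=> x y onE bad; split.
    apply/double_coverE; rewrite quartic_cubicE /=.
    by rewrite -rmorphXn onE /cubic_value; ring.
  have nE : to_quartic_num (ratr w0) (ratr c1) (ratr c2) (ratr x)
      = ratr (to_quartic_num w0 c1 c2 x) :> algC by rewrite /to_quartic_num; ring.
  have dE : to_quartic_den (ratr w0) (ratr c1) (ratr c3) (ratr x) (ratr y)
      = ratr (to_quartic_den w0 c1 c3 x y) :> algC by rewrite /to_quartic_den; ring.
  rewrite /= !pt2E nE dE; case=> n0 d0.
  by case: bad => e; [move: n0|move: d0]; rewrite e rmorph0 eqxx.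
have finR : finite_set ([set None] `|` (fun u => back u (root u)) @` S `|`
    (fun u => back u (- root u)) @` S `|` Some @` B).
  rewrite !finite_setU; split; last exact: finite_image finB.
  by split; [split; [exact: finite_set1|]|]; apply: finite_image.
have sub : range M `<=` [set None] `|` (fun u => back u (root u)) @` S `|`
    (fun u => back u (- root u)) @` S `|` Some @` B.
  move=> P [n _ <-]; case q: (M n) => [[x y]|]; last by do 3!left.
  have onE : y ^+ 2 = cubic_value w0 c1 c2 c3 c4 x.
    by have := multiple_on onP n; rewrite -/M q => /on_wcurve_short.
  have [bad|good] := pselect (to_quartic_num w0 c1 c2 x = 0 \/ to_quartic_den w0 c1 c3 x y = 0).
    by right; exists (x, y); first exact: inB.
  case/not_orP: good => /eqP n0 /eqP d0.
  have [e1 e2] := to_quarticK w00 n0 d0.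
  have onQ := to_quartic_on w00 d0 onE.
  set u := to_quartic_u _ _ _ _ _ _ in e1 e2 onQ; set w := to_quartic_w _ _ _ _ _ _ in e1 e2 onQ.
  have Su : S u by exists w.
  have rE : root u ^+ 2 = quartic_value w0 c1 c2 c3 c4 u.
    by have := xgetPex 0 Su.
  have : w ^+ 2 == root u ^+ 2 by rewrite rE onQ.
  rewrite eqf_sqr => /orP[/eqP e|/eqP e]; left; [left; right|right];
    (exists u; [exact: Su|by rewrite /back -e e1 e2]).
have := sub_finite_set sub finR.
have injM : {in M @^-1` range M &, injective M} by move=> i j _ _; exact: Minj.
move=> /(finite_preimage injM) finN.
apply: infinite_nat; apply: sub_finite_set finN => n _; by exists n.
Qed.

(** If the quintuples were finitely many, bc = z^-2 would take finitely many
    values, each of them for finitely many parameters. *)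
Lemma infinite_exotic : infinite_set exotic_quintuple_sets.
Proof.
move=> finX.
have infM : infinite_set [set m | exists w, w ^+ 2 = quartic_D3 m].
  apply: (@infinite_quartic_points 9 (- 144) (- 42) 48 9 42 288 _ point_D3 _ infinite_order_D3).
  - by rewrite pnatr_eq0.
  - by rewrite pnatr_eq0.
pose F := \bigcup_(X in exotic_quintuple_sets) X.
have finF : finite_set F.
  apply: bigcup_finite => // X [a [b [c [d [e [_ ->]]]]]].
  exact: finite_seq.
have [] := infinite_setD infM finite_conditions.
apply: (@sub_finite_set _ _ (\bigcup_(p in F `*` F)
   [set m | nz m ^+ 2 * (p.1 * p.2) - pz m ^+ 2 = 0])); last first.
  apply: bigcup_finite; first exact: finite_setX.
  move=> [b c] _; apply: (@finite_polynomial_zeros _ 0).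
    by rewrite /nz /pz; prove_polynomial.
  have -> : nz 0 ^+ 2 * (b * c) - pz 0 ^+ 2 = - 81%:R by rewrite /nz /pz; ring.
  by rewrite oppr_eq0 pnatr_eq0.
move=> m [[w onQ] /negP good].
have ex := exotic_on_D3 good onQ.
set x := xD3 m in ex; set y := yD3 m in ex; set z := zD3 m in ex; set v := vD3 m w in ex.
have inF s : s \in [:: qa x y z; qb x y z; qc x y z; qd x y z; qe x y z v] -> F s.
  move=> hs; exists [set` [:: qa x y z; qb x y z; qc x y z; qd x y z; qe x y z v]]; last exact: hs.
  by do 5!eexists; split; [exact: ex | reflexivity].
exists (qb x y z, qc x y z).
  split; apply: inF; rewrite in_cons; apply/orP; right; rewrite in_cons; apply/orP.
    by left; exact: eqxx.
  by right; rewrite in_cons; apply/orP; left; exact: eqxx.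
case: (has_negated good) => m0 [px0 [py0 [pz0 [nx0 [ny0 [nz0 _]]]]]].
rewrite /= /qb /qc /x /y /z /xD3 /yD3 /zD3; field.
by rewrite px0 py0 pz0 nx0 ny0 nz0.
Qed.
End InfinitelyMany.

Theorem proposition3 :
  (forall D : set 'rV[algC]_2,
     [\/ D = curve_D1, D = curve_D2 | D = curve_D3] ->
     affine_curve_of_genus_over_Q (pullback_to_S D) 1 /\
     exists E : weierstrass,
       [/\ is_elliptic E,
           birational_over_Q (affine_in_proj (pullback_to_S D)) (wcurve E) &
           mordell_weil_rank_ge E 1]) /\
  infinite_set exotic_quintuple_sets.
Proof.
split; last exact: infinite_exotic.
move=> D [] ->.
- apply: (genus_one_pullback parametrization_D1 curve_D1E _ _ nondegenerate_D1
    elliptic_D1 rank_D1); last by rewrite pnatr_eq0.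
  by rewrite /eq_D1; prove_polyfun.
- apply: (genus_one_pullback parametrization_D2 curve_D2E _ _ nondegenerate_D2
    elliptic_D2 rank_D2); last by rewrite pnatr_eq0.
  by rewrite /eq_D2; prove_polyfun.
- apply: (genus_one_pullback parametrization_D3 curve_D3E _ _ nondegenerate_D3
    elliptic_D3 rank_D3); last by rewrite pnatr_eq0.
  by rewrite /eq_D3; prove_polyfun.
Qed.
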